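(* The ring $\mathbf{\Lambda}$ of symmetric functions in superspace, with its usual product and the coproduct $\Delta$, is a cocommutative and self-dual Hopf algebra (in the topologist's sense).
   Context: Let $x_1,x_2,\dots$ be commuting variables and $\theta_1,\theta_2,\dots$ anticommuting variables ($\theta_i\theta_j=-\theta_j\theta_i$, $\theta_i^2=0$). $\mathbf{\Lambda}$ is the ring of formal power series over $\mathbb Q$ of bounded degree in these variables invariant under simultaneous permutation of the pairs $(x_i,\theta_i)$. The fermionic degree (degree in the $\theta$'s) is denoted $\deg$. $\mathbf{\Lambda}$ is graded by the sum of the total degree (degree in the $x$'s) and the fermionic degree. $\mathbf{\Lambda}\otimes\mathbf{\Lambda}$ is identified with functions of two sets of variables $(x;\theta)$, $(y;\phi)$, symmetric in each, with $\theta$'s and $\phi$'s anticommuting with each other; $f\otimes g$ corresponds to $f(x;\theta)g(y;\phi)$. It is thus an algebra with $(f_1\otimes g_1)(f_2\otimes g_2)=(-1)^{\deg(g_1)\deg(f_2)}f_1f_2\otimes g_1g_2$ for homogeneous elements. The coproduct is $(\Delta f)(x,y;\theta,\phi)=f(x,y;\theta,\phi)$, i.e. $f$ evaluated on the union of the two sets of variables; the counit $\epsilon$ is the identity on constants and zero on elements homogeneous of positive degree. A Hopf algebra here means: an associative unital algebra which is a coassociative counital coalgebra such that $\Delta$ and $\epsilon$ are algebra morphisms ($\mathbf{\Lambda}\otimes\mathbf{\Lambda}$ carrying the signed product above), possessing an antipode, i.e. a linear map $S$ with $\mathrm{mult}\circ(S\otimes1)\circ\Delta=u\circ\epsilon=\mathrm{mult}\circ(1\otimes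 S)\circ\Delta$, where $\mathrm{mult}$ is the multiplication and $u$ the unit map. Cocommutative (in the topologist's sense) means $\tau\circ\Delta=\Delta$, where $\tau(g\otimes h)=(-1)^{\deg(g)\deg(h)}h\otimes g$ for homogeneous $g,h$. Self-dual (in the topologist's sense) means that there is a non-degenerate bilinear pairing $\langle\cdot,\cdot\rangle:\mathbf{\Lambda}\otimes\mathbf{\Lambda}\to\mathbb Q$ such that for all $f,g,a,b\in\mathbf{\Lambda}$: $\langle fg,a\rangle=\langle f\otimes g,\Delta(a)\rangle$, $\langle f,ab\rangle=\langle\Delta(f),a\otimes b\rangle$, $\langle1,a\rangle=\epsilon(a)$, $\langle f,1\rangle=\epsilon(f)$ and $\langle S(f),a\rangle=\langle f,S(a)\rangle$, where on tensors the pairing is $\langle f\otimes g,a\otimes b\rangle=(-1)^{\deg(g)\deg(a)}\langle f,a\rangle\langle g,b\rangle$ for homogeneous elements (obtained by applying $1\otimes\tau\otimes1$ to $f\otimes g\otimes a\otimes b$ and then pairing). *)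

(* Defs.v *)
From HB Require Import structures.
From mathcomp Require Import all_boot all_order all_algebra.
From mathcomp Require Import finmap generic_quotient.
From mathcomp Require Import mathcomp_extra boolp classical_sets functions.
From mathcomp Require Import cardinality fsbigop.
From mathcomp Require Import ring.

Set Implicit Arguments.
Unset Strict Implicit.
Unset Printing Implicit Defensive.

Import Order.TTheory GRing.Theory Num.Theory.
Local Open Scope fset_scope.
Local Open Scope quotient_scope.
Local Open Scope ring_scope.

(* Tensor product of vector spaces: formal sums of pairs, two of them being    *)
(* identified when every bilinear map takes the same value on them.            *)

Section Tensor.
Variables (K : fieldType) (U V : lmodType K).

Definition bilin (W : lmodType K) (b : U -> V -> W) : Prop :=
  (forall v, linear (b^~ v)) /\ (forall u, linear (b u)).

Definition tsum (W : lmodType K) (b : U -> V -> W) (s : seq (U * V)) : W :=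
  \sum_(p <- s) b p.1 p.2.

Definition teq (s t : seq (U * V)) : bool :=
  `[< forall (W : lmodType K) (b : U -> V -> W),
        bilin b -> tsum b s = tsum b t >].

Lemma teq_refl : reflexive teq.
Proof. by move=> s; apply/asboolP. Qed.

Lemma teq_sym : symmetric teq.
Proof.
by move=> s t; apply/idP/idP => /asboolP e; apply/asboolP => W b hb;
   rewrite e.
Qed.

Lemma teq_trans : transitive teq.
Proof.
move=> t s r /asboolP e1 /asboolP e2; apply/asboolP => W b hb.
by rewrite e1 // e2.
Qed.

Canonical teq_equiv := EquivRel teq teq_refl teq_sym teq_trans.

Definition tensor := {eq_quot teq_equiv}.
HB.instance Definition _ := Choice.on tensor.
HB.instance Definition _ := EqQuotient.on tensor.

Definition tens (u : U) (v : V) : tensor := \pi_tensor [:: (u, v)].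

(* The linear map induced by a bilinear map (junk if b is not bilinear).       *)
Definition tlift (W : lmodType K) (b : U -> V -> W) (t : tensor) : W :=
  tsum b (repr t).

Lemma tlift_pi (W : lmodType K) (b : U -> V -> W) s : bilin b ->
  tlift b (\pi_tensor s) = tsum b s.
Proof.
move=> hb; rewrite /tlift; case: piP => r /eqmodP /asboolP e.
by rewrite e.
Qed.

Lemma tens_eqP s t :
  (forall (W : lmodType K) (b : U -> V -> W), bilin b -> tsum b s = tsum b t) <->
  \pi_tensor s = \pi_tensor t.
Proof. by split=> [e|/eqmodP /asboolP//]; apply/eqmodP/asboolP. Qed.

Definition tzero : tensor := \pi_tensor [::].
Definition tadd (s t : tensor) : tensor := \pi_tensor (repr s ++ repr t).
Definition tscale (a : K) (t : tensor) : tensor :=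
  \pi_tensor [seq (a *: p.1, p.2) | p <- repr t].

Lemma tsum_cat (W : lmodType K) (b : U -> V -> W) s t :
  tsum b (s ++ t) = tsum b s + tsum b t.
Proof. by rewrite /tsum big_cat. Qed.

Lemma tsum_scale (W : lmodType K) (b : U -> V -> W) a s : bilin b ->
  tsum b [seq (a *: p.1, p.2) | p <- s] = a *: tsum b s.
Proof.
move=> [bl _]; rewrite /tsum big_map scaler_sumr; apply: eq_bigr => p _ /=.
by have := scalable_linear (bl p.2) a p.1.
Qed.

Lemma tsum_repr (W : lmodType K) (b : U -> V -> W) s : bilin b ->
  tsum b (repr (\pi_tensor s)) = tsum b s.
Proof. exact: tlift_pi. Qed.

Lemma tensor_ext (s t : tensor) :
  (forall (W : lmodType K) (b : U -> V -> W), bilin b ->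
     tsum b (repr s) = tsum b (repr t)) -> s = t.
Proof.
by rewrite -[s]reprK -[t]reprK => e; apply/tens_eqP => W b hb; have := e W b hb;
  rewrite !tsum_repr.
Qed.

Lemma taddA : associative tadd.
Proof.
move=> s t r; apply: tensor_ext => W b hb.
by rewrite !(tsum_repr, tsum_cat) // addrA.
Qed.
Lemma taddC : commutative tadd.
Proof.
move=> s t; apply: tensor_ext => W b hb.
by rewrite !(tsum_repr, tsum_cat) // addrC.
Qed.
Lemma tadd0 : left_id tzero tadd.
Proof.
move=> s; apply: tensor_ext => W b hb.
by rewrite !(tsum_repr, tsum_cat) // /tsum big_nil add0r.
Qed.
Lemma taddN : left_inverse tzero (tscale (-1)) tadd.
Proof.
move=> s; apply: tensor_ext => W b hb.
rewrite !(tsum_repr, tsum_cat, tsum_scale) // scaleN1r addNr.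
by rewrite /tsum big_nil.
Qed.
HB.instance Definition _ := GRing.isZmodule.Build tensor taddA taddC tadd0 taddN.

Lemma tscaleA a b t : tscale a (tscale b t) = tscale (a * b) t.
Proof.
by apply: tensor_ext => W c hc; rewrite !(tsum_repr, tsum_scale) // scalerA.
Qed.
Lemma tscale1 : left_id 1 tscale.
Proof.
by move=> t; apply: tensor_ext => W c hc; rewrite !(tsum_repr, tsum_scale) // scale1r.
Qed.
Lemma tscaleDr : right_distributive tscale +%R.
Proof.
move=> a s t; apply: tensor_ext => W c hc.
by rewrite !(tsum_repr, tsum_cat, tsum_scale) // scalerDr.
Qed.
Lemma tscaleDl t : {morph tscale^~ t : a b / a + b}.
Proof.
move=> a b; apply: tensor_ext => W c hc.
by rewrite !(tsum_repr, tsum_cat, tsum_scale) // scalerDl.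
Qed.
HB.instance Definition _ := GRing.Zmodule_isLmodule.Build K tensor
  tscaleA tscale1 tscaleDr tscaleDl.

Lemma tens_bilin : bilin tens.
Proof.
split=> [v a u u'|u a v v']; apply: tensor_ext => W b hb;
  rewrite !(tsum_repr, tsum_cat, tsum_scale) //;
  rewrite /tsum /= !big_cons !big_nil !addr0 /=; case: hb => bl br.
- exact: bl.
- exact: br.
Qed.

Lemma tlift_linear (W : lmodType K) (b : U -> V -> W) : bilin b -> linear (tlift b).
Proof.
by move=> hb a s t; rewrite /tlift !(tsum_repr, tsum_cat, tsum_scale).
Qed.

Lemma tlift_tens (W : lmodType K) (b : U -> V -> W) u v : bilin b ->
  tlift b (tens u v) = b u v.
Proof. by move=> hb; rewrite tlift_pi // /tsum big_seq1. Qed.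

Lemma tens_sum (t : tensor) : t = \sum_(p <- repr t) tens p.1 p.2.
Proof.
apply: tensor_ext => W b hb; move: (repr t) => s.
have -> : \sum_(p <- s) tens p.1 p.2 = \pi_tensor s.
  elim: s => [|p s IH]; first by rewrite big_nil.
  rewrite big_cons IH; apply: tensor_ext => W' b' hb'.
  rewrite !(tsum_repr, tsum_cat) // -tsum_cat.
  by congr tsum; case: p.
by rewrite tsum_repr.
Qed.

End Tensor.

Arguments tensor {K} U V.

Notation "U ⨂ V" := (tensor U V) (at level 40, left associativity) : type_scope.
Notation "u ⊗ v" := (tens u v) (at level 40, left associativity) : ring_scope.

Lemma linear_at0 (K : fieldType) (U W : lmodType K) (h : U -> W) : linear h -> h 0 = 0.
Proof. by move=> L; have := L (-1) 0 0; rewrite scaler0 addr0 scaleN1r addNr. Qed.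

(* Hopf algebras in the topologist's sense. The Z/2-grading responsible for    *)
(* the signs is given by par, par b being the projection onto the part of      *)
(* parity b; a sign (-1)^(deg f * deg g) depends on the parities only.         *)

Section HopfSuperalgebra.
Variables (K : fieldType) (A : lmodType K) (par : bool -> A -> A).

Definition bisum (W : lmodType K) (F : bool -> bool -> W) : W :=
  \sum_(i : bool) \sum_(j : bool) (-1) ^+ (i && j) *: F i j.

Definition tswap : A ⨂ A -> A ⨂ A :=
  tlift (fun g h => bisum (fun i j => par j h ⊗ par i g)).

Definition tmap (f g : A -> A) : A ⨂ A -> A ⨂ A :=
  tlift (fun a b => f a ⊗ g b).

Definition tassoc : (A ⨂ A) ⨂ A -> A ⨂ (A ⨂ A) :=
  tlift (fun t c => tlift (fun a b => a ⊗ (b ⊗ c)) t).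

Variables (mul : A -> A -> A) (one : A).

Definition tmul (s t : A ⨂ A) : A ⨂ A :=
  tlift (fun f1 g1 => tlift (fun f2 g2 =>
    bisum (fun i j => mul f1 (par j f2) ⊗ mul (par i g1) g2)) t) s.

Variables (Delta : A -> A ⨂ A) (eps : A -> K).

Definition super_algebra : Prop :=
  [/\ bilin mul, associative mul, left_id one mul & right_id one mul].

Definition super_coalgebra : Prop :=
  [/\ linear Delta, scalar eps,
      (forall f, tassoc (tlift (fun a b => Delta a ⊗ b) (Delta f)) =
                 tlift (fun a b => a ⊗ Delta b) (Delta f)),
      (forall f, tlift (fun a b => eps a *: b) (Delta f) = f) &
      (forall f, tlift (fun a b => eps b *: a) (Delta f) = f)].

Definition super_bialgebra : Prop :=
  [/\ super_algebra, super_coalgebra,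
      (forall f g, Delta (mul f g) = tmul (Delta f) (Delta g)) /\
        Delta one = one ⊗ one &
      (forall f g, eps (mul f g) = eps f * eps g) /\ eps one = 1].

Definition antipode (S : A -> A) : Prop :=
  [/\ linear S,
      forall f, tlift mul (tmap S id (Delta f)) = eps f *: one &
      forall f, tlift mul (tmap id S (Delta f)) = eps f *: one].

Definition super_hopf (S : A -> A) : Prop := super_bialgebra /\ antipode S.

Definition super_cocommutative : Prop := forall f, tswap (Delta f) = Delta f.

Definition tpair (pair : A -> A -> K^o) (s t : A ⨂ A) : K^o :=
  tlift (fun f g => tlift (fun a b =>
    bisum (fun i j => pair f (par j a) * pair (par i g) b)) t) s.

Definition nondegenerate (pair : A -> A -> K^o) : Prop :=
  (forall f, (forall a, pair f a = 0) -> f = 0) /\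
  (forall a, (forall f, pair f a = 0) -> a = 0).

Record self_dual_pairing (S : A -> A) (pair : A -> A -> K^o) : Prop := {
  pair_bilin : bilin pair;
  pair_nondegenerate : nondegenerate pair;
  pair_mull : forall f g a, pair (mul f g) a = tpair pair (f ⊗ g) (Delta a);
  pair_mulr : forall f a b, pair f (mul a b) = tpair pair (Delta f) (a ⊗ b);
  pair_onel : forall a, pair one a = eps a;
  pair_oner : forall f, pair f one = eps f;
  pair_antipode : forall f a, pair (S f) a = pair f (S a) }.

Definition self_dual (S : A -> A) : Prop :=
  exists pair : A -> A -> K^o, self_dual_pairing S pair.

Definition parity (b : bool) (g : A) : Prop := forall i, par i g = if b == i then g else 0.

Hypothesis par_linear : forall i, linear (par i).

Lemma bisum_parity (W : lmodType K) (F : A -> A -> W) b c g h :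
  bilin F -> parity b g -> parity c h ->
  bisum (fun i j => F (par i g) (par j h)) = (-1) ^+ (b && c) *: F g h.
Proof.
move=> [Fl Fr] hg hh; rewrite /bisum !big_bool /= !hg !hh.
have F0l v : F 0 v = 0 := linear_at0 (Fl v).
have F0r v : F v 0 = 0 := linear_at0 (Fr v).
by case: b {hg}; case: c {hh}; rewrite /= !(F0l, F0r, scaler0, addr0, add0r).
Qed.

Lemma bisum_bilin (U V W : lmodType K) (F : U -> V -> bool -> bool -> W) :
  (forall i j, bilin (fun u v => F u v i j)) -> bilin (fun u v => bisum (F u v)).
Proof.
move=> h; split=> [v k u u'|u k v v']; rewrite /bisum scaler_sumr -big_split;
  apply: eq_bigr => i _; rewrite scaler_sumr -big_split; apply: eq_bigr => j _ /=.
- have /= -> := (h i j).1 v k u u'; by rewrite scalerDr !scalerA mulrC.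
- have /= -> := (h i j).2 u k v v'; by rewrite scalerDr !scalerA mulrC.
Qed.

Lemma tlift_bilin (U V W : lmodType K) (F : U -> V -> A -> A -> W) t :
  (forall a b, bilin (fun u v => F u v a b)) -> bilin (fun u v => tlift (F u v) t).
Proof.
move=> h; split=> [v k u u'|u k v v']; rewrite /tlift /tsum scaler_sumr -big_split;
  apply: eq_bigr => p _ /=.
- exact: (h p.1 p.2).1.
- exact: (h p.1 p.2).2.
Qed.

Lemma bilin_comp (U V U' V' W : lmodType K) (F : U' -> V' -> W) (p : U -> U') (q : V -> V') :
  bilin F -> linear p -> linear q -> bilin (fun u v => F (p u) (q v)).
Proof.
move=> [Fl Fr] pl ql; split=> [v k u u'|u k v v'].
- by rewrite pl; exact: Fl.
- by rewrite ql; exact: Fr.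
Qed.

Lemma bilin_flip (U V W : lmodType K) (F : U -> V -> W) :
  bilin F -> bilin (fun v u => F u v).
Proof. by case. Qed.

Lemma tswap_tens b c g h : parity b g -> parity c h ->
  tswap (g ⊗ h) = (-1) ^+ (b && c) *: (h ⊗ g).
Proof.
move=> hg hh; have tb := bilin_flip (@tens_bilin K A A).
rewrite /tswap tlift_tens; last first.
  by apply: bisum_bilin => i j; exact: (bilin_comp tb (par_linear i) (par_linear j)).
by have := bisum_parity tb hg hh => ->.
Qed.

Lemma tmul_tens b c f1 g1 f2 g2 : bilin mul -> parity b g1 -> parity c f2 ->
  tmul (f1 ⊗ g1) (f2 ⊗ g2) = (-1) ^+ (b && c) *: (mul f1 f2 ⊗ mul g1 g2).
Proof.
move=> hm hg hf; have tb := @tens_bilin K A A; have [ml mr] := hm.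
have idl : linear (@id A) by [].
rewrite /tmul tlift_tens; last first.
  apply: tlift_bilin => a d; apply: bisum_bilin => i j.
  by apply: (bilin_comp tb) => //= k u v; rewrite par_linear; exact: ml.
rewrite tlift_tens; last first.
  apply: bisum_bilin => i j.
  by apply: (bilin_comp tb) => //= k u v; rewrite par_linear; exact: mr.
apply: (bisum_parity _ hg hf (F := fun g h => mul f1 h ⊗ mul g g2)).
by apply: bilin_flip; apply: (bilin_comp tb).
Qed.

Lemma tpair_tens (pair : A -> A -> K^o) b c f g a d :
  bilin pair -> parity b g -> parity c a ->
  tpair pair (f ⊗ g) (a ⊗ d) = (-1) ^+ (b && c) * (pair f a * pair g d).
Proof.
move=> [pl pr] hg ha.
have mb : bilin (fun x y : K^o => x * y : K^o).
  split=> [y k x x'|x k y y'] /=; first by rewrite mulrDl -mulrA.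
  by rewrite mulrDr mulrCA.
rewrite /tpair tlift_tens; last first.
  apply: tlift_bilin => x y; apply: bisum_bilin => i j.
  by apply: (bilin_comp mb) => //= k u v; rewrite ?par_linear; exact: pl.
rewrite tlift_tens; last first.
  apply: bisum_bilin => i j.
  by apply: (bilin_comp mb) => //= k u v; rewrite ?par_linear; exact: pr.
apply: (bisum_parity _ hg ha (F := fun g a => (pair f a * pair g d : K^o))).
by apply: bilin_flip; apply: (bilin_comp mb).
Qed.

End HopfSuperalgebra.

(* Formal power series over Q in commuting variables x_0, x_1, ... and         *)
(* anticommuting variables th_0, th_1, ... The pair (a, I) stands for the      *)
(* monomial x^a th_I, where th_I is the product of the th_i, i \in I, taken in *)
(* increasing order of i.                                                      *)

Definition smono : choiceType := ({fsfun nat -> nat with 0%N} * {fset nat})%type.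

Definition series : Type := smono -> rat^o.
Identity Coercion fun_of_series : series >-> Funclass.
HB.instance Definition _ := GRing.Lmodule.copy series (smono -> rat^o).

Definition ordered (I : {fset nat}) : seq nat := sort leq I.

(* th_s1 ... th_sk = wsign s * th_{s1, ..., sk} for any word s = s1 ... sk.    *)
Fixpoint wsign (s : seq nat) : rat :=
  if s is i :: s' then
    if i \in s' then 0 else (-1) ^+ count (fun j => j < i)%N s' * wsign s'
  else 1.

(* The coefficient of x^a th_s1 ... th_sk in f. *)
Definition wcoef (f : series) (a : {fsfun nat -> nat with 0%N}) (s : seq nat) : rat :=
  wsign s * f (a, [fset i in s]).

Definition mdeg (m : smono) : nat := (\sum_(i <- finsupp m.1) m.1 i + #|` m.2|)%N.

Definition bounded_degree (f : series) : Prop :=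
  exists N : nat, forall m, f m != 0 -> (mdeg m <= N)%N.

Definition symmetric_series (f : series) : Prop :=
  forall (sigma : nat -> nat) (a b : {fsfun nat -> nat with 0%N}) (I : {fset nat}),
    bijective sigma -> (forall i, b (sigma i) = a i) ->
    wcoef f b (map sigma (ordered I)) = wcoef f a (ordered I).

(* The (finitely many) pairs of monomials with product m up to sign, or with   *)
(* product zero because of a repeated th_i, for which wsign vanishes below.    *)
Definition factorizations (m : smono) : set (smono * smono) :=
  [set p : smono * smono | (forall i, p.1.1 i + p.2.1 i = m.1 i)%N /\
             (p.1.2 `|` p.2.2)%fset = m.2]%classic.

Definition series_mul (f g : series) : series := fun m =>
  \sum_(p \in factorizations m)
     wsign (ordered p.1.2 ++ ordered p.2.2) * (f p.1 * g p.2).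

Definition mono1 : smono := ([fsfun], fset0).

Definition series_one : series := fun m => (m == mono1)%:R.

Definition series_par (b : bool) (f : series) : series := fun m =>
  if odd #|` m.2| == b then f m else 0.

(* f(x,y;th,ph) for symmetric f, with coefficient at (m, n) that of            *)
(* x^a th_I y^b ph_J for m = (a, I) and n = (b, J). The variables of f are     *)
(* x_0, y_0, x_1, y_1, ..., and likewise for th and ph.                        *)
Definition interleave (a b : {fsfun nat -> nat with 0%N}) : {fsfun nat -> nat with 0%N} :=
  [fsfun i in [fset i.*2 | i in finsupp a] `|` [fset i.*2.+1 | i in finsupp b]
     => if odd i then b i./2 else a i./2].

Definition dbl (i : nat) := i.*2.
Definition dblS (i : nat) := i.*2.+1.

Definition series_union (f : series) : smono * smono -> rat^o := fun p =>
  wcoef f (interleave p.1.1 p.2.1)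
    (map dbl (ordered p.1.2) ++ map dblS (ordered p.2.2)).

Lemma signsq n : (-1) ^+ n * (-1) ^+ n = 1 :> rat.
Proof. by rewrite -exprD addnn -signr_odd odd_double. Qed.

Definition sg (i j : nat) : rat := if i == j then 0 else if (j < i)%N then -1 else 1.
Definition cross (s t : seq nat) : rat := \prod_(i <- s) \prod_(j <- t) sg i j.

Lemma wsign_cons i s : wsign (i :: s) = (\prod_(j <- s) sg i j) * wsign s.
Proof.
have -> : \prod_(j <- s) sg i j =
    if i \in s then 0 else (-1) ^+ count (fun j => j < i)%N s.
  elim: s => [|j s IH]; first by rewrite big_nil.
  rewrite big_cons IH inE /sg; case: eqVneq => [|ne] /=; first by rewrite mul0r.
  case: (i \in s); rewrite ?mulr0 //.
  by case: (j < i)%N; rewrite ?mul1r //= ?add1n ?exprS ?add0n.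
by rewrite /=; case: (i \in s); rewrite ?mul0r.
Qed.

Lemma wsign_cat s t : wsign (s ++ t) = wsign s * wsign t * cross s t.
Proof.
elim: s => [|i s IH]; first by rewrite /cross big_nil mulr1 mul1r.
rewrite cat_cons !wsign_cons IH big_cat /= /cross big_cons -/(cross s t).
ring.
Qed.

Lemma perm_cross s s' t t' : perm_eq s s' -> perm_eq t t' -> cross s t = cross s' t'.
Proof.
move=> ps pt; rewrite /cross (perm_big _ ps); apply: eq_bigr => i _.
exact: perm_big.
Qed.

Lemma cross_cat s1 s2 t : cross (s1 ++ s2) t = cross s1 t * cross s2 t.
Proof. by rewrite /cross big_cat. Qed.

Lemma sgC i j : sg j i = - sg i j.
Proof. by rewrite /sg eq_sym; case: ltngtP => //= _; rewrite ?oppr0 ?opprK. Qed.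

Lemma crossC s t : cross t s = (-1) ^+ (size s * size t) * cross s t.
Proof.
rewrite /cross exchange_big /=; elim: s => [|i s IH]; first by rewrite !big_nil mulr1.
rewrite !big_cons IH /= mulSn exprD mulrACA; congr (_ * _).
elim: t {IH} => [|j t IH]; first by rewrite !big_nil mulr1.
by rewrite !big_cons IH sgC /= exprS; ring.
Qed.

Lemma wsign_uniq s : (wsign s != 0) = uniq s.
Proof.
elim: s => //= i s IH; case: (i \in s) => //=.
by rewrite mulf_eq0 signr_eq0.
Qed.

Lemma wsign_sq s : uniq s -> wsign s * wsign s = 1.
Proof.
elim: s => //= i s IH /andP[/negPf -> us].
by rewrite mulrACA IH // signsq mulr1.
Qed.

Lemma wsign_sorted s : uniq s -> sorted leq s -> wsign s = 1.
Proof.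
elim: s => //= i s IH /andP[/negPf is' us]; rewrite is' (path_sortedE leq_trans).
case/andP=> /allP mi so; rewrite IH // mulr1; rewrite (_ : count _ s = 0%N) //.
apply/eqP; rewrite -leqn0 leqNgt -has_count -all_predC.
by apply/allP => j /mi /=; rewrite -leqNgt.
Qed.

Lemma wsign_ordered I : wsign (ordered I) = 1.
Proof.
by apply: wsign_sorted; rewrite ?sort_uniq ?fset_uniq ?sort_sorted //; exact: leq_total.
Qed.

Lemma ordered_uniq I : uniq (ordered I).
Proof. by rewrite sort_uniq fset_uniq. Qed.

Lemma mem_ordered I i : (i \in ordered I) = (i \in I).
Proof. by rewrite mem_sort. Qed.

Lemma fset_ordered (I : {fset nat}) : [fset i in ordered I] = I.
Proof. by apply/fsetP => i; rewrite in_fset mem_ordered. Qed.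

Lemma ordered_perm I s : uniq s -> I = [fset i in s] -> perm_eq (ordered I) s.
Proof.
move=> us ->; apply: uniq_perm; rewrite ?ordered_uniq // => i.
by rewrite mem_ordered in_fset.
Qed.

Lemma perm_wsign_map (h : nat -> nat) s t : injective h -> perm_eq s t ->
  wsign s * wsign (map h s) = wsign t * wsign (map h t).
Proof.
move=> hI pst.
pose P t := wsign t * wsign (map h t) = wsign s * wsign (map h s).
suff : P t by rewrite /P => ->.
apply: (catCA_perm_ind _ pst) => // s1 s2 s3; rewrite /P => <-.
rewrite !catA !map_cat !wsign_cat !cross_cat.
rewrite (crossC s1 s2) (crossC (map h s1)) !size_map.
set e := (-1) ^+ _; have e2 : e * e = 1 by exact: signsq.
by rewrite -[RHS]mul1r -e2; ring.
Qed.

Lemma fset_map (h : nat -> nat) s : [fset i in map h s] = h @` [fset i in s].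
Proof.
apply/fsetP => i; rewrite in_fset; apply/mapP/imfsetP => /= -[j js ->];
  by exists j => //; rewrite in_fset in js *.
Qed.

Lemma fset_perm (s t : seq nat) : s =i t -> [fset i in s] = [fset i in t].
Proof. by move=> st; apply/fsetP => i; rewrite !in_fset st. Qed.

Lemma fset_wcat (s t : seq nat) : [fset i in s ++ t] = [fset i in s] `|` [fset i in t].
Proof. by apply/fsetP => i; rewrite inE !in_fset mem_cat. Qed.

Lemma wcoef_ordered f a I : wcoef f a (ordered I) = f (a, I).
Proof. by rewrite /wcoef wsign_ordered mul1r fset_ordered. Qed.

Lemma symmetric_word f (sigma : nat -> nat)
    (a b : {fsfun nat -> nat with 0%N}) (s : seq nat) : symmetric_series f -> bijective sigma ->
  (forall i, b (sigma i) = a i) ->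
  wcoef f b (map sigma s) = wcoef f a s.
Proof.
move=> sf bs ab; have sI := bij_inj bs.
case us: (uniq s); last first.
  have w0 t : uniq t = false -> wsign t = 0 by rewrite -wsign_uniq; case: eqP.
  by rewrite /wcoef !w0 ?mul0r // map_inj_uniq.
have := sf sigma a b [fset i in s] bs ab.
have po : perm_eq (ordered [fset i in s]) s by exact: ordered_perm.
rewrite /wcoef !fset_map fset_ordered wsign_ordered mul1r => <-.
have := perm_wsign_map sI po; rewrite wsign_ordered mul1r => ->.
by rewrite !mulrA wsign_sq // mul1r.
Qed.

Section Relabel.
Variables (sigma tau : nat -> nat).
Hypotheses (st : cancel sigma tau) (ts : cancel tau sigma).

Definition erelabel (a : {fsfun nat -> nat with 0%N}) : {fsfun nat -> nat with 0%N} :=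
  [fsfun i in sigma @` finsupp a => a (tau i)].

Lemma erelabelE a i : erelabel a i = a (tau i).
Proof.
rewrite fsfun_fun; case: ifPn => // /imfsetP ni; case: finsuppP => // hi.
by case: ni; exists (tau i) => //=; rewrite ts.
Qed.

Definition mrelabel (m : smono) : smono := (erelabel m.1, sigma @` m.2).

Lemma symmetric_relabel f m : symmetric_series f ->
  f (mrelabel m) = wsign (map sigma (ordered m.2)) * f m.
Proof.
case: m => a I sf; have bs : bijective sigma by exists tau.
have := @symmetric_word f sigma a (erelabel a) (ordered I) sf bs.
rewrite wcoef_ordered /wcoef => <-; last by move=> i; rewrite erelabelE st.
by rewrite mulrA wsign_sq ?map_inj_uniq ?ordered_uniq ?mul1r ?fset_map ?fset_ordered //;
  exact: can_inj st.
Qed.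

End Relabel.

Lemma mrelabelK (sigma tau : nat -> nat) : cancel sigma tau -> cancel tau sigma ->
  cancel (mrelabel sigma tau) (mrelabel tau sigma).
Proof.
move=> st ts [a I]; congr pair.
  by apply/fsfunP => i; rewrite !erelabelE // st.
apply/fsetP => i; apply/imfsetP/idP => /= [[j /imfsetP[/= k kI ->] ->]|iI].
  by rewrite st.
by exists (sigma i); rewrite ?st //; apply/imfsetP; exists i.
Qed.

Lemma mono_wsign_relabel (sigma : nat -> nat) I J : injective sigma ->
  wsign (map sigma (ordered (I `|` J))) * wsign (ordered (sigma @` I) ++ ordered (sigma @` J))
  * (wsign (map sigma (ordered I)) * wsign (map sigma (ordered J)))
  = wsign (ordered I ++ ordered J).
Proof.
move=> sI.
have pm (L : {fset nat}) : perm_eq (ordered (sigma @` L)) (map sigma (ordered L)).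
  by apply: ordered_perm; rewrite ?map_inj_uniq ?ordered_uniq // fset_map fset_ordered.
have -> : wsign (ordered (sigma @` I) ++ ordered (sigma @` J)) =
   cross (map sigma (ordered I)) (map sigma (ordered J)).
  by rewrite wsign_cat !wsign_ordered !mul1r; apply: perm_cross.
set c := cross _ _.
rewrite -mulrA (_ : c * (wsign (map sigma (ordered I)) * wsign (map sigma (ordered J))) =
   wsign (map sigma (ordered I ++ ordered J)));  last first.
  by rewrite map_cat wsign_cat /c; ring.
case uIJ: (uniq (ordered I ++ ordered J)); last first.
  have w0 t : uniq t = false -> wsign t = 0 by rewrite -wsign_uniq; case: eqP.
  by rewrite [RHS]w0 // [X in _ * X]w0 ?mulr0 // map_inj_uniq.
have po : perm_eq (ordered (I `|` J)) (ordered I ++ ordered J).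
  by apply: ordered_perm => //; rewrite fset_wcat !fset_ordered.
have := perm_wsign_map sI po; rewrite wsign_ordered mul1r => ->.
by rewrite -mulrA wsign_sq ?mulr1 // map_inj_uniq.
Qed.

Lemma series_mul_symmetric f g :
  symmetric_series f -> symmetric_series g -> symmetric_series (series_mul f g).
Proof.
move=> sf sg sigma a b I bs ab; have [tau st ts] := bs.
have sI := bij_inj bs; have tI := can_inj ts.
rewrite wcoef_ordered /wcoef fset_map fset_ordered.
have -> : b = erelabel sigma tau a.
  by apply/fsfunP => i; rewrite erelabelE // -ab ts.
rewrite /series_mul.
set A := factorizations _; set B := factorizations (a, I).
pose h (p : smono * smono) := (mrelabel sigma tau p.1, mrelabel sigma tau p.2).
have hb : set_bij B A h.
  split.
  - move=> p [/= p1 p2]; split => [i|] /=; first by rewrite !erelabelE.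
    by rewrite -imfsetU p2.
  - move=> [p1 p2] [q1 q2] _ _ [] e1 e2 e3 e4; congr pair.
      by apply: (can_inj (mrelabelK st ts)); rewrite /mrelabel e1 e2.
    by apply: (can_inj (mrelabelK st ts)); rewrite /mrelabel e3 e4.
  - move=> [p1 p2] [/= h1 h2]; exists (mrelabel tau sigma p1, mrelabel tau sigma p2).
      split => [i|] /=; first by rewrite !erelabelE // h1 erelabelE // st.
      by rewrite -imfsetU h2; have := mrelabelK st ts (a, I); case.
    by rewrite /h /= !mrelabelK.
rewrite (reindex_fsbig h B A) // mulr_fsumr.
apply: eq_fsbigr => p /set_mem [_ p2].
rewrite /h /= !symmetric_relabel //; move: p2 => /= p2.
by rewrite -p2 -(mono_wsign_relabel p.1.2 p.2.2 sI); ring.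
Qed.

Definition edeg (a : {fsfun nat -> nat with 0%N}) : nat := (\sum_(i <- finsupp a) a i)%N.

Lemma edeg_incl a (S : {fset nat}) : finsupp a `<=` S -> (\sum_(i <- S) a i)%N = edeg a.
Proof.
move=> sub; rewrite /edeg; apply/esym/big_fset_incl => // i _ ni.
exact: fsfun_dflt.
Qed.

Lemma edeg_inj (h : nat -> nat) (a c : {fsfun nat -> nat with 0%N}) :
  injective h -> (forall i, c (h i) = a i) -> (edeg a <= edeg c)%N.
Proof.
move=> hI hc; rewrite /edeg; under eq_bigr do rewrite -hc.
have -> : (\sum_(i <- finsupp a) c (h i) = \sum_(j <- h @` finsupp a) c j)%N.
  by rewrite big_imfset //= => i j _ _; exact: hI.
have sub : h @` finsupp a `<=` finsupp c.
  by apply/fsubsetP => _ /imfsetP[/= i ia ->]; move: ia; rewrite !mem_finsupp hc.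
by rewrite [X in (_ <= X)%N](big_fsetID _ (mem (h @` finsupp a))) /=
  (_ : [fset x in finsupp c | x \in h @` finsupp a] = h @` finsupp a) ?leq_addr //;
  apply/fsetP => i; rewrite !inE andbC; case: (boolP (i \in h @` _)) => //= /(fsubsetP sub).
Qed.

Lemma mdeg_factor m p : factorizations m p -> (mdeg m <= mdeg p.1 + mdeg p.2)%N.
Proof.
case=> h1 h2; rewrite /mdeg -/(edeg p.1.1) -/(edeg p.2.1).
have s1 : finsupp p.1.1 `<=` finsupp m.1.
  by apply/fsubsetP => i; rewrite !mem_finsupp -h1 addn_eq0 negb_and => ->.
have s2 : finsupp p.2.1 `<=` finsupp m.1.
  by apply/fsubsetP => i; rewrite !mem_finsupp -h1 addn_eq0 negb_and orbC => ->.
rewrite -(edeg_incl s1) -(edeg_incl s2) addnACA leq_add //.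
  by rewrite -big_split /= leq_sum // => i _; rewrite h1.
by rewrite -h2 cardfsU leq_subr.
Qed.

Lemma series_mul_bounded f g :
  bounded_degree f -> bounded_degree g -> bounded_degree (series_mul f g).
Proof.
move=> [N hN] [M hM]; exists (N + M)%N => m.
apply: contraR; rewrite -ltnNge => lt; apply/eqP; apply: fsbig1 => p hp.
case: (eqVneq (f p.1) 0) => [->|/hN l1]; first by rewrite mul0r mulr0.
case: (eqVneq (g p.2) 0) => [->|/hM l2]; first by rewrite !mulr0.
have := leq_trans lt (mdeg_factor hp).
by rewrite ltnNge leq_add.
Qed.

(* The ring of symmetric functions in superspace. *)

Definition sym_super : {pred series} :=
  fun f => `[< bounded_degree f /\ symmetric_series f >].

Record Lambda := MkLambda { lval :> series; lvalP : lval \in sym_super }.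

HB.instance Definition _ := [isSub for lval].
HB.instance Definition _ := [Choice of Lambda by <:].

Lemma wcoef_lin k f g a s : wcoef (k *: f + g) a s = k * wcoef f a s + wcoef g a s.
Proof. by rewrite /wcoef /= -[(k *: f + g) _]/(k * f _ + g _); ring. Qed.

Lemma sym_super_submod : submod_closed sym_super.
Proof.
split=> [|k f g].
  apply/asboolP; split; first by exists 0%N => m; rewrite eqxx.
  by move=> sigma a b I _ _; rewrite /wcoef !mulr0.
move=> /asboolP[[N hN] sf] /asboolP[[M hM] sg]; apply/asboolP; split.
  exists (maxn N M) => m; rewrite leq_max -[(k *: f + g) m]/(k * f m + g m) => nz.
  case: (eqVneq (f m) 0) nz => [->|/hN -> //]; rewrite mulr0 add0r => /hM ->.
  by rewrite orbT.
move=> sigma a b I bs ab; rewrite !wcoef_lin.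
by rewrite (sf sigma a b) // (sg sigma a b).
Qed.

HB.instance Definition _ := GRing.isSubmodClosed.Build rat series sym_super
  sym_super_submod.
HB.instance Definition _ := [SubChoice_isSubLmodule of Lambda by <:].

Lemma lambda_bounded (f : Lambda) : bounded_degree f.
Proof. by have /asboolP[] := lvalP f. Qed.

Lemma lambda_symmetric (f : Lambda) : symmetric_series f.
Proof. by have /asboolP[] := lvalP f. Qed.

Lemma Lambda_mul_proof (f g : Lambda) : series_mul f g \in sym_super.
Proof.
apply/asboolP; split.
  exact: series_mul_bounded (lambda_bounded f) (lambda_bounded g).
exact: series_mul_symmetric (lambda_symmetric f) (lambda_symmetric g).
Qed.

Definition Lambda_mul (f g : Lambda) : Lambda := MkLambda (Lambda_mul_proof f g).

Lemma Lambda_one_proof : series_one \in sym_super.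
Proof.
apply/asboolP; split.
  exists 0%N => m; rewrite /series_one; case: (m =P mono1) => [-> _|_]; last by rewrite eqxx.
  by rewrite /mdeg finsupp0 big_seq_fset0 cardfs0.
move=> sigma a b I bs ab; rewrite /wcoef /series_one fset_map fset_ordered.
case: (eqVneq I fset0) => [->|I0].
  have -> : ordered fset0 = [::] by apply/nilP; rewrite /nilp size_sort cardfs0.
  rewrite imfset0; have -> // : ((b, fset0) == mono1) = ((a, fset0) == mono1).
  apply/eqP/eqP => -[e]; congr pair; apply/fsfunP => i.
    by rewrite -ab e !fsfunE.
  by have [tau st ts] := bs; rewrite -(ts i) ab e !fsfunE.
have -> : ((b, sigma @` I) == mono1) = false.
  apply/eqP => -[_ /eqP]; case/fset0Pn: I0 => i iI.
  by move/eqP/fsetP/(_ (sigma i)); rewrite in_fset0 => /negP; case; apply/imfsetP; exists i.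
have -> : ((a, I) == mono1) = false by apply/eqP => -[_ /eqP]; apply/negP.
by rewrite !mulr0.
Qed.

Definition Lambda_one : Lambda := MkLambda Lambda_one_proof.

Lemma Lambda_par_proof b (f : Lambda) : series_par b f \in sym_super.
Proof.
apply/asboolP; split.
  have [N hN] := lambda_bounded f; exists N => m; rewrite /series_par.
  by case: ifP => _; [exact: hN | rewrite eqxx].
move=> sigma a c I bs ac; rewrite /wcoef /series_par /= fset_map fset_ordered.
rewrite card_imfset; last exact: bij_inj bs.
case: ifP => _; last by rewrite !mulr0.
have := @lambda_symmetric f sigma a c I bs ac.
by rewrite /wcoef fset_map fset_ordered.
Qed.

Definition Lambda_par (b : bool) (f : Lambda) : Lambda := MkLambda (Lambda_par_proof b f).

Definition counit (f : Lambda) : rat := f mono1.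

Lemma counit_constant c : counit (c *: Lambda_one) = c.
Proof. by rewrite -[LHS]/(c * (mono1 == mono1)%:R) eqxx mulr1. Qed.

Lemma counit_homogeneous d (f : Lambda) : (0 < d)%N ->
  (forall m, f m != 0 -> mdeg m = d) -> counit f = 0.
Proof.
move=> d0 hd; apply/eqP/negPn/negP => /hd; rewrite /mdeg finsupp0 big_seq_fset0 cardfs0.
by move=> e; rewrite -e in d0.
Qed.

(* The identification of Lambda (x) Lambda with functions of two sets of       *)
(* variables: the coefficient of f(x;th) g(y;ph) at (m, n) is f m * g n.       *)
Definition two_sets : Lambda ⨂ Lambda -> (smono * smono -> rat^o) :=
  tlift (fun f g : Lambda => (fun p => f p.1 * g p.2) : smono * smono -> rat^o).

Lemma two_sets_bilin : bilin (fun f g : Lambda =>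
  (fun p => f p.1 * g p.2) : smono * smono -> rat^o).
Proof.
split=> [g k f f'|f k g g']; apply/funext => p.
  by rewrite -[RHS]/(k * (f p.1 * g p.2) + f' p.1 * g p.2)
       -[lval (k *: f + f') _]/(k * f p.1 + f' p.1); ring.
by rewrite -[RHS]/(k * (f p.1 * g p.2) + f p.1 * g' p.2)
     -[lval (k *: g + g') _]/(k * g p.2 + g' p.2); ring.
Qed.

Lemma lambda_ext (f g : Lambda) : (forall m, f m = g m) -> f = g.
Proof. by move=> e; apply/val_inj/funext. Qed.

Lemma lval_lin k (f g : Lambda) m : (k *: f + g) m = k * f m + g m.
Proof. by []. Qed.

Lemma lval_scale k (f : Lambda) m : (k *: f) m = k * f m.
Proof. by []. Qed.

Lemma lambda_sumE (I : Type) (s : seq I) (F : I -> Lambda) m :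
  (\sum_(i <- s) F i) m = \sum_(i <- s) F i m.
Proof.
elim: s => [|i s IH]; first by rewrite !big_nil.
by rewrite !big_cons -IH.
Qed.

Lemma two_sets_tens (f g : Lambda) m n : two_sets (f ⊗ g) (m, n) = f m * g n.
Proof. by rewrite /two_sets tlift_tens //; exact: two_sets_bilin. Qed.

Lemma two_sets_linear : linear two_sets.
Proof. exact: tlift_linear two_sets_bilin. Qed.

Lemma two_sets_sum (I : Type) (s : seq I) (F G : I -> Lambda) m n :
  two_sets (\sum_(i <- s) F i ⊗ G i) (m, n) = \sum_(i <- s) F i m * G i n.
Proof.
have L := two_sets_linear.
elim: s => [|i s IH].
  by rewrite !big_nil (linear_at0 L).
rewrite !big_cons -IH -two_sets_tens.
by have := L 1 (F i ⊗ G i) (\sum_(i <- s) F i ⊗ G i);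
   rewrite !scale1r => /(congr1 (@^~ (m, n))) ->.
Qed.

Lemma two_sets_inj0 (s : seq (Lambda * Lambda)) :
  (forall m n, \sum_(p <- s) p.1 m * p.2 n = 0) -> \sum_(p <- s) p.1 ⊗ p.2 = 0.
Proof.
have [tl tr] := @tens_bilin rat Lambda Lambda.
have t0l (v : Lambda) : 0 ⊗ v = 0 :> Lambda ⨂ Lambda := linear_at0 (tl v).
have t0r (v : Lambda) : v ⊗ 0 = 0 :> Lambda ⨂ Lambda := linear_at0 (tr v).
have tPl (k : rat) (u u' v : Lambda) : (k *: u + u') ⊗ v = k *: (u ⊗ v) + u' ⊗ v :=
  tl v k u u'.
have tPr (k : rat) (u v v' : Lambda) : u ⊗ (k *: v + v') = k *: (u ⊗ v) + u ⊗ v' :=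
  tr u k v v'.
have tZl (k : rat) (u v : Lambda) : (k *: u) ⊗ v = k *: (u ⊗ v) := scalable_linear (tl v) k u.
have [k] := ubnP (size s); elim: k s => // k IH [|[f g] s] /=; first by rewrite big_nil.
rewrite ltnS => sk H; rewrite big_cons /=.
have [[m0 fm0]|f0] := pselect (exists m, f m != 0); last first.
  have -> : f = 0.
    apply: lambda_ext => m; apply/eqP/negPn/negP => nz; apply: f0; by exists m.
  rewrite t0l add0r.
  apply: IH => // m n; have := H m n; rewrite big_cons /=.
  suff -> : f m = 0 by rewrite mul0r add0r.
  by apply/eqP/negPn/negP => nz; apply: f0; exists m.
pose c (p : Lambda * Lambda) := - (p.1 m0 / f m0).
have gE : g = \sum_(p <- s) c p *: p.2.
  apply: lambda_ext => n; rewrite lambda_sumE.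
  have := H m0 n; rewrite big_cons /= => /eqP; rewrite addr_eq0 => /eqP e.
  rewrite -[g n](mulKf fm0) e mulrN mulr_sumr -sumrN; apply: eq_bigr => p _.
  by rewrite -[RHS]/(c p * p.2 n) /c; field.
have -> : f ⊗ g = \sum_(p <- s) (c p *: f) ⊗ p.2.
  rewrite gE; elim: (s) => [|p r IHr].
    by rewrite !big_nil t0r.
  by rewrite !big_cons -IHr tPr tZl.
rewrite -big_split /=.
under eq_bigr => p _.
  have -> : (c p *: f) ⊗ p.2 + p.1 ⊗ p.2 = (c p *: f + p.1) ⊗ p.2.
    by rewrite tPl tZl.
  over.
have := IH [seq (c p *: f + p.1, p.2) | p <- s]; rewrite size_map big_map /=.
apply=> // m n; rewrite big_map /= -[RHS](H m n) big_cons /= gE lambda_sumE.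
rewrite mulr_sumr -big_split /=; apply: eq_bigr => p _.
by rewrite -[LHS]/((c p * f m + p.1 m) * p.2 n)
   -[RHS]/(f m * (c p * p.2 n) + p.1 m * p.2 n); ring.
Qed.

Lemma two_sets_inj : injective two_sets.
Proof.
have L := two_sets_linear.
move=> s t e; apply/eqP; rewrite -subr_eq0; apply/eqP.
rewrite [LHS]tens_sum; apply: two_sets_inj0 => m n.
rewrite -two_sets_sum -tens_sum addrC -scaleN1r L -e.
by rewrite -[LHS]/(-1 * two_sets s (m, n) + two_sets s (m, n)) mulN1r addNr.
Qed.

(* f(x,y;th,ph) comes from an element of Lambda (x) Lambda: its slices at a    *)
(* fixed monomial in one set of variables lie in Lambda, and those of bounded  *)
(* degree span a finite dimensional space.                                     *)

Lemma interleaveE a b i : interleave a b i = if odd i then b i./2 else a i./2.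
Proof.
rewrite fsfun_fun; case: ifPn => //; rewrite inE negb_or => /andP[/imfsetP ha /imfsetP hb].
case: ifPn => oi; case: finsuppP => // hi.
  by case: hb; exists i./2 => //=; rewrite -[LHS]odd_double_half oi.
by case: ha; exists i./2 => //=; rewrite -[LHS]odd_double_half (negPf oi).
Qed.

Lemma dbl_inj : injective dbl. Proof. exact: double_inj. Qed.
Lemma dblS_inj : injective dblS. Proof. by move=> i j [] /double_inj. Qed.

Lemma bounded_union f : bounded_degree f ->
  exists N : nat, forall m n, series_union f (m, n) != 0 ->
    (mdeg m <= N)%N /\ (mdeg n <= N)%N.
Proof.
move=> [N hN]; exists N => -[a I] [b J]; rewrite /series_union /wcoef mulf_eq0 negb_or.
case/andP=> _ /hN /= le; rewrite /mdeg /= -/(edeg a) -/(edeg b) in le *.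
have card (h : nat -> nat) (s : seq nat) L : injective h ->
    {subset map h (ordered L) <= s} -> (#|` L| <= #|` [fset i in s]|)%N.
  move=> hI sub; rewrite (_ : #|` L| = #|` h @` L|); last by rewrite card_imfset.
  rewrite fsubset_leq_card //.
  by apply/fsubsetP => _ /imfsetP[/= i iL ->]; rewrite in_fset sub ?map_f ?mem_ordered.
split; apply: leq_trans le; apply: leq_add.
- by apply: (edeg_inj dbl_inj) => i; rewrite interleaveE odd_double doubleK.
- by apply: (card _ _ _ dbl_inj) => i; rewrite mem_cat => ->.
- apply: (edeg_inj dblS_inj) => i.
  by rewrite interleaveE /dblS /= odd_double /= uphalf_double.
- by apply: (card _ _ _ dblS_inj) => i; rewrite mem_cat orbC => ->.
Qed.

Lemma wsign_relabel_map (sigma h : nat -> nat) I : injective sigma -> injective h ->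
  wsign (map sigma (ordered I)) * wsign (map h (ordered (sigma @` I)))
  = wsign (map h (map sigma (ordered I))).
Proof.
move=> sI hI.
have pm : perm_eq (ordered (sigma @` I)) (map sigma (ordered I)).
  by apply: ordered_perm; rewrite ?map_inj_uniq ?ordered_uniq // fset_map fset_ordered.
have := perm_wsign_map hI pm; rewrite wsign_ordered mul1r => ->.
by rewrite mulrA wsign_sq ?mul1r // map_inj_uniq ?ordered_uniq.
Qed.

Lemma perm_relabel_map (sigma h : nat -> nat) I : injective sigma ->
  perm_eq (map h (ordered (sigma @` I))) (map h (map sigma (ordered I))).
Proof.
move=> sI; apply: perm_map.
by apply: ordered_perm; rewrite ?map_inj_uniq ?ordered_uniq // fset_map fset_ordered.
Qed.

Definition on_even (s : nat -> nat) i := if odd i then i else (s i./2).*2.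
Definition on_odd (s : nat -> nat) i := if odd i then (s i./2).*2.+1 else i.

Lemma on_evenK s t : cancel s t -> cancel (on_even s) (on_even t).
Proof.
move=> st i; rewrite /on_even; case: (boolP (odd i)) => oi; first by rewrite oi.
by rewrite odd_double doubleK st -[RHS]odd_double_half (negPf oi).
Qed.

Lemma on_oddK s t : cancel s t -> cancel (on_odd s) (on_odd t).
Proof.
move=> st i; rewrite /on_odd; case: (boolP (odd i)) => oi; last by rewrite (negPf oi).
by rewrite /= odd_double /= uphalf_double st -[RHS]odd_double_half oi.
Qed.

Lemma union_slice_proof (f : Lambda) n :
  (fun m => series_union f (m, n)) \in sym_super.
Proof.
apply/asboolP; split.
  by have [N hN] := bounded_union (lambda_bounded f); exists N => m /hN[].
move=> sigma a b I bs ab; have sI := bij_inj bs; have [tau st ts] := bs.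
rewrite wcoef_ordered [LHS]/wcoef /series_union /= fset_map fset_ordered.
have bs' : bijective (on_even sigma).
  by exists (on_even tau); exact: on_evenK.
have ab' i : interleave b n.1 (on_even sigma i) = interleave a n.1 i.
  rewrite !interleaveE /on_even; case: (boolP (odd i)) => oi; first by rewrite oi.
  by rewrite odd_double doubleK ab.
rewrite -(symmetric_word _ (lambda_symmetric f) bs' ab') map_cat -!map_comp.
rewrite (@eq_map _ _ (on_even sigma \o dblS) dblS); last first.
  by move=> i /=; rewrite /on_even /dblS /= odd_double.
rewrite (@eq_map _ _ (on_even sigma \o dbl) (dbl \o sigma)); last first.
  by move=> i /=; rewrite /on_even /dbl odd_double doubleK.
rewrite map_comp /wcoef mulrA; congr (_ * _); last first.
  congr (f (_, _)); apply: fset_perm => i; rewrite !mem_cat.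
  by rewrite (perm_mem (perm_relabel_map dbl I sI)).
rewrite !wsign_cat -wsign_relabel_map //; last exact: dbl_inj.
by rewrite (perm_cross (perm_relabel_map dbl I sI) (perm_refl _)) !mulrA.
Qed.

Lemma union_slice_proof' (f : Lambda) m :
  (fun n => series_union f (m, n)) \in sym_super.
Proof.
apply/asboolP; split.
  by have [N hN] := bounded_union (lambda_bounded f); exists N => n /hN[].
move=> sigma a b I bs ab; have sI := bij_inj bs; have [tau st ts] := bs.
rewrite wcoef_ordered [LHS]/wcoef /series_union /= fset_map fset_ordered.
have bs' : bijective (on_odd sigma).
  by exists (on_odd tau); exact: on_oddK.
have ab' i : interleave m.1 b (on_odd sigma i) = interleave m.1 a i.
  rewrite !interleaveE /on_odd; case: (boolP (odd i)) => oi; last by rewrite (negPf oi).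
  by rewrite /= odd_double /= uphalf_double ab.
rewrite -(symmetric_word _ (lambda_symmetric f) bs' ab') map_cat -!map_comp.
rewrite (@eq_map _ _ (on_odd sigma \o dbl) dbl); last first.
  by move=> i /=; rewrite /on_odd /dbl odd_double.
rewrite (@eq_map _ _ (on_odd sigma \o dblS) (dblS \o sigma)); last first.
  by move=> i /=; rewrite /on_odd /dblS /= odd_double /= uphalf_double.
rewrite [map (dblS \o _) _]map_comp /wcoef mulrA; congr (_ * _); last first.
  congr (f (_, _)); apply: fset_perm => i; rewrite !mem_cat.
  by rewrite (perm_mem (perm_relabel_map dblS I sI)).
rewrite !wsign_cat -wsign_relabel_map //; last exact: dblS_inj.
by rewrite (perm_cross (perm_refl _) (perm_relabel_map dblS I sI)); ring.
Qed.

Lemma bij_iota (s : seq nat) : uniq s ->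
  exists2 sigma : nat -> nat, bijective sigma & map sigma s = iota 0 (size s).
Proof.
elim/last_ind: s => [|s x IH]; first by exists id => //; exists id.
rewrite rcons_uniq => /andP[xs us]; have [sigma bs es] := IH us.
have sI := bij_inj bs; pose k := size s.
pose sw i := if i == sigma x then k else if i == k then sigma x else i.
have swK : involutive sw.
  move=> i; rewrite /sw; case: (eqVneq i (sigma x)) => [->|n1].
    by rewrite eqxx; case: eqP => [->|].
  case: (eqVneq i k) => [->|n2]; first by rewrite eqxx.
  by rewrite (negPf n1) (negPf n2).
exists (sw \o sigma); first by apply: bij_comp => //; exists sw.
rewrite map_rcons size_rcons -cats1 -addn1 iotaD -es /= {2}/sw eqxx; congr (_ ++ _).
apply/eq_in_map => i is_ /=; rewrite /sw (inj_eq sI).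
have -> : (i == x) = false by apply/eqP => e; rewrite -e is_ in xs.
have : sigma i \in iota 0 (size s) by rewrite -es map_f.
by rewrite mem_iota add0n /= ltn_neqAle => /andP[/negPf ->].
Qed.

Definition test_mono N (g : {ffun 'I_N -> 'I_N.+1 * bool}) : smono :=
  ([fsfun i in [fset i in iota 0 N] => if insub i is Some j then val (g j).1 else 0%N],
   [fset i in iota 0 N | if insub i is Some j then (g j).2 else false]).

Lemma test_monoP N (m : smono) : (mdeg m <= N)%N ->
  (forall i, (N <= i)%N -> m.1 i = 0%N /\ i \notin m.2) -> exists g, m = @test_mono N g.
Proof.
case: m => a I /= dm sup; exists [ffun j : 'I_N => (inord (a j), val j \in I)].
have ale i : (a i <= N)%N.
  apply: leq_trans dm; rewrite /mdeg /=; case: finsuppP => // hi.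
  by rewrite (big_fsetD1 i) //= -addnA leq_addr.
congr pair.
  apply/fsfunP => i; rewrite fsfun_fun in_fset mem_iota add0n /=.
  case: insubP => [j iN <-|]; last first.
    by rewrite -leqNgt => /[dup] /sup[-> _]; rewrite leqNgt => /negPf ->.
  by rewrite ffunE /= inordK ?ltnS // ltn_ord.
apply/fsetP => i; rewrite !inE mem_iota add0n /=.
case: insubP => [j iN <-|]; first by rewrite ffunE /= ltn_ord.
by rewrite -leqNgt => /sup[_ /negPf ->]; rewrite andbF.
Qed.

Lemma test_mono_separates N (f : Lambda) :
  (forall m, f m != 0 -> (mdeg m <= N)%N) ->
  (forall g, f (@test_mono N g) = 0) -> f = 0.
Proof.
move=> hN H; apply: lambda_ext => m; apply/eqP/negPn/negP => nz.
have [sigma bs es] := bij_iota (fset_uniq (finsupp m.1 `|` m.2)).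
have [tau st ts] := bs; have sI := can_inj st.
have dm := hN _ nz.
have sz : (size (finsupp m.1 `|` m.2) <= N)%N.
  apply: leq_trans dm; rewrite cardfsU; apply: leq_trans (leq_subr _ _) _.
  rewrite leq_add2r -sum1_size; rewrite big_seq [X in (_ <= X)%N]big_seq.
  by apply: leq_sum => i; rewrite mem_finsupp lt0n.
have nz' : f (mrelabel sigma tau m) != 0.
  rewrite (symmetric_relabel st ts m (lambda_symmetric f)) mulf_neq0 //.
  by rewrite wsign_uniq map_inj_uniq ?ordered_uniq.
have [g eg] : exists g, mrelabel sigma tau m = @test_mono N g.
  apply: test_monoP; first exact: hN.
  move=> i iN; have out : tau i \notin finsupp m.1 `|` m.2.
    apply/negP => hi; have : i \in map sigma (finsupp m.1 `|` m.2).
      by rewrite -[i]ts map_f.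
    by rewrite es mem_iota add0n /= ltnNge (leq_trans sz iN).
  move: out; rewrite inE negb_or => /andP[o1 o2]; split => /=.
    by rewrite erelabelE // fsfun_dflt.
  by apply/negP => /imfsetP[/= j jI e]; rewrite e st jI in o2.
by rewrite eg H eqxx in nz'.
Qed.

(* A space of functions separated by finitely many points has a basis which is *)
(* dual to evaluation at some of these points.                                 *)
Lemma dual_points (T : eqType) (ev : T -> Lambda -> rat) (E : seq T)
    (V : Lambda -> Prop) :
  (forall k f g, V f -> V g -> V (k *: f + g)) ->
  (forall x, scalar (ev x)) ->
  (forall f, V f -> (forall x, x \in E -> ev x f = 0) -> f = 0) ->
  exists s : seq (T * Lambda), forall f, V f -> f = \sum_(p <- s) ev p.1 f *: p.2.
Proof.
move=> + evL; elim: E V => [|x E IH] V VL sep.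
  by exists [::] => f Vf; rewrite big_nil; exact: sep.
have [s hs] : exists s : seq (T * Lambda), forall f, V f /\ ev x f = 0 ->
    f = \sum_(p <- s) ev p.1 f *: p.2.
  apply: IH => [k f g [Vf xf] [Vg xg]|f [Vf xf] H].
    by split; [exact: VL | rewrite evL xf xg mulr0 addr0].
  by apply: sep => // y; rewrite inE => /predU1P[->|/H].
have [[g [Vg xg]]|no] := pselect (exists g, V g /\ ev x g != 0); last first.
  exists s => f Vf; apply: hs; split=> //; apply/eqP/negPn/negP => nz.
  by apply: no; exists f.
pose c f := - (ev x f / ev x g).
exists ((x, (ev x g)^-1 *: (g - \sum_(p <- s) ev p.1 g *: p.2)) :: s) => f Vf.
have : V (c f *: g + f) /\ ev x (c f *: g + f) = 0.
  by split; [exact: VL | rewrite evL /c; field].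
move=> /hs; under eq_bigr do rewrite evL scalerDl -scalerA.
rewrite big_split /= -scaler_sumr => e; rewrite big_cons /=.
rewrite scalerA -[ev x f / _]opprK -/(c f) scaleNr scalerBr opprB addrAC -e.
by rewrite addrAC subrr add0r.
Qed.

Lemma union_in_tensor (f : Lambda) : exists t, two_sets t = series_union f.
Proof.
pose slice n := MkLambda (union_slice_proof f n).
pose slice' m := MkLambda (union_slice_proof' f m).
have [N hN] := bounded_union (lambda_bounded f).
pose V (g : Lambda) := forall m, g m != 0 -> (mdeg m <= N)%N.
have [||h Vh H|s hs] := @dual_points _ (fun g (h : Lambda) => h (@test_mono N g))
   (enum {: {ffun 'I_N -> 'I_N.+1 * bool}}) V.
- move=> k g h Vg Vh m; rewrite lval_lin => nz.
  case: (eqVneq (g m) 0) nz => [->|/Vg -> //]; rewrite mulr0 add0r; exact: Vh.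
- by [].
- by apply: (test_mono_separates Vh) => g; apply: H; rewrite mem_enum.
exists (\sum_(p <- s) p.2 ⊗ slice' (test_mono p.1)); apply/funext => -[m n].
rewrite two_sets_sum.
have /hs e : V (slice n) by move=> k /hN[].
rewrite -[RHS]/(slice n m) e lambda_sumE; apply: eq_bigr => p _.
by rewrite mulrC.
Qed.

Definition coproduct (f : Lambda) : Lambda ⨂ Lambda :=
  xget 0 [set t | two_sets t = series_union f]%classic.

Lemma coproductE (f : Lambda) : two_sets (coproduct f) = series_union f.
Proof. exact: (xgetPex 0 (union_in_tensor f)). Qed.

Definition fermionic_degree (d : nat) (f : Lambda) : Prop :=
  forall m, f m != 0 -> #|` m.2| = d.

Lemma fermionic_parity d f : fermionic_degree d f -> parity Lambda_par (odd d) f.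
Proof.
move=> hf b; apply: lambda_ext => m; rewrite /= /series_par.
have [fm|/hf <-] := eqVneq (f m) 0; last by case: ifP.
by rewrite [lval f m]fm if_same; case: ifP.
Qed.

Lemma Lambda_par_linear b : linear (Lambda_par b).
Proof.
move=> k f g; apply: lambda_ext => m.
rewrite -[RHS]/(k * series_par b f m + series_par b g m) /= /series_par.
by case: ifP => _; [|rewrite mulr0 addr0].
Qed.

Lemma Lambda_par_sum f : Lambda_par false f + Lambda_par true f = f.
Proof.
apply: lambda_ext => m; rewrite -[LHS]/(series_par false f m + series_par true f m).
by rewrite /series_par; case: (odd _); rewrite /= ?addr0 ?add0r.
Qed.

(* Main.v *)
(* A symmetric series is unchanged when its variables are split into the even and
   the odd ones, so writing f(x) g(y) in interlaced variables embeds Lambda (x)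
   Lambda into the series in such a way that f corresponds to its own coproduct:
   multiplicativity, coassociativity and cocommutativity of Delta then follow from
   the supercommutativity of the product and from the invariance of f under
   bijections of the variables.

   The power sums p_r and their fermionic analogues are primitive. A product of
   power sums contains no monomial in more variables than it has factors, and its
   coefficients at the monomials with exactly that many variables are given by the
   invertible Gram matrix of a signed permanent. Hence the products of power sums
   over the sorted words without repeated fermionic letter form a basis, and any
   function of words with the supersymmetry of these products extends linearly to
   Lambda. This provides the antipode, multiplication by (-1)^k on products of k
   power sums, and the pairing, for which multiplication by a power sum is adjoint
   to a superderivation that is compatible with Delta because power sums are
   primitive. *)

Require Import Defs.
From mathcomp Require Import all_boot all_order all_algebra.
From mathcomp Require Import finmap.
From mathcomp Require Import boolp classical_sets functions.
From mathcomp Require Import fsbigop.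
From mathcomp Require Import ring zify.

Set Implicit Arguments.
Unset Strict Implicit.
Unset Printing Implicit Defensive.

Import Order.TTheory GRing.Theory Num.Theory.
Local Open Scope fset_scope.
Local Open Scope ring_scope.

Local Notation expo := {fsfun nat -> nat with 0%N}.
Local Notation "f ** g" := (series_mul f g) (at level 40, left associativity).
Local Notation "f *L g" := (Lambda_mul f g) (at level 40, left associativity).
Local Notation par := (parity Lambda_par).
Local Notation tmulL := (tmul Lambda_par Lambda_mul).
Local Notation tpairL := (tpair Lambda_par).

(** * The algebra of series *)

(** The basis is indexed by sorted words, yet all functions are given on arbitrary words with a sign
    rule for adjacent letters: inductions can then prepend a letter without sorting again. This is
    sound because the sign of a rearrangement is the same for every function that obeys the rule, so
    a linear relation between products of power sums reduces to sorted words in the same way for all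
    of them.

    One matrix, [word_pair], plays two roles: it gives the top coefficients of the products of power
    sums, and it is the pairing. On sorted words without repeated odd letter it is diagonal, its
    entries being signed products of factorials; over the rationals this yields both the basis and
    non-degeneracy. Each power sum has norm 1, where the Hall scalar product gives r to p_r:
    self-duality leaves the norms of primitive generators free. *)

Definition expo_add (a b : expo) : expo :=
  [fsfun i in finsupp a `|` finsupp b => (a i + b i)%N].

Lemma expo_addE a b i : expo_add a b i = (a i + b i)%N.
Proof.
rewrite fsfun_fun; case: ifPn => //; rewrite inE negb_or => /andP[ha hb].
by rewrite !fsfun_dflt.
Qed.

Definition mono_mul (u v : smono) : smono := (expo_add u.1 v.1, u.2 `|` v.2).

Lemma mono_mulC u v : mono_mul u v = mono_mul v u.
Proof.
by rewrite /mono_mul fsetUC; congr pair; apply/fsfunP => i; rewrite !expo_addE addnC.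
Qed.

Lemma mono_mulA u v w : mono_mul u (mono_mul v w) = mono_mul (mono_mul u v) w.
Proof.
by rewrite /mono_mul fsetUA; congr pair; apply/fsfunP => i; rewrite !expo_addE addnA.
Qed.

Lemma mono_mul1l u : mono_mul mono1 u = u.
Proof.
case: u => a I; rewrite /mono_mul fset0U; congr pair; apply/fsfunP => i.
by rewrite expo_addE fsfunE.
Qed.

Lemma factorizationsP m p : factorizations m p <-> mono_mul p.1 p.2 = m.
Proof.
case: m p => a I [[b J] [c K]]; split=> [[/= h1 h2]|[<- <-]].
  by rewrite /mono_mul h2; congr pair; apply/fsfunP => i; rewrite expo_addE.
by split=> // i; rewrite expo_addE.
Qed.

Definition msupp (m : smono) : {fset nat} := finsupp m.1 `|` m.2.

Lemma msupp_mono_mul u v : msupp (mono_mul u v) = msupp u `|` msupp v.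
Proof.
apply/fsetP => i; rewrite !inE !mem_finsupp expo_addE addn_eq0 negb_and.
by rewrite -!orbA; congr orb; rewrite orbCA.
Qed.

Lemma msupp0 m : msupp m = fset0 -> m = mono1.
Proof.
case: m => a I /eqP; rewrite fsetU_eq0 /= => /andP[/eqP a0 /eqP ->].
congr pair; apply/fsfunP => i; rewrite fsfunE fsfun_dflt //.
by rewrite a0 inE.
Qed.

(** The degree and the indices are both bounded, so that only finitely many monomials qualify; the
    condition passes to divisors. *)
Definition within N (m : smono) := (mdeg m <= N)%N /\ forall i, i \in msupp m -> (i < N)%N.

Lemma mdeg_mono_mul u v : (mdeg u <= mdeg (mono_mul u v))%N.
Proof.
rewrite /mdeg leq_add //; last by rewrite fsubset_leq_card // fsubsetUl.
rewrite -/(edeg _) -/(edeg _).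
have sub : finsupp u.1 `<=` finsupp (mono_mul u v).1.
  by apply/fsubsetP => i; rewrite !mem_finsupp expo_addE addn_eq0 negb_and => ->.
rewrite -(edeg_incl sub) -(edeg_incl (fsubset_refl _)).
by apply: leq_sum => i _; rewrite expo_addE leq_addr.
Qed.

Lemma within_mono_mul N u v : within N (mono_mul u v) -> within N u.
Proof.
case=> h1 h2; split; first exact: leq_trans (mdeg_mono_mul _ _) h1.
by move=> i iu; apply: h2; rewrite msupp_mono_mul inE iu.
Qed.

Lemma within_ex m : exists N, within N m.
Proof.
exists (mdeg m + \max_(i <- msupp m) i.+1)%N; split; first by rewrite leq_addr.
move=> i im; apply: leq_trans (leq_addl _ _).
by rewrite (big_rem i) //= leq_max leqnn.
Qed.

(* A finite list containing every divisor of a monomial within N: it turns the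
   sums over factorizations into double sums over one fixed list. *)
Definition monos N : seq smono :=
  undup [seq test_mono g | g <- enum {: {ffun 'I_N -> 'I_N.+1 * bool}}].

Lemma within_monos N m : within N m -> m \in monos N.
Proof.
case=> h1 h2; have [i iN|g ->] := @test_monoP N m h1.
  have : i \notin msupp m by apply/negP => /h2; rewrite ltnNge iN.
  by rewrite inE negb_or mem_finsupp negbK => /andP[/eqP].
by rewrite mem_undup map_f // mem_enum.
Qed.

Lemma monos_uniq N : uniq (monos N). Proof. exact: undup_uniq. Qed.

Definition mono_sign (u v : smono) : rat := wsign (ordered u.2 ++ ordered v.2).

Lemma mono_sign_cross u v : mono_sign u v = cross (ordered u.2) (ordered v.2).
Proof. by rewrite /mono_sign wsign_cat !wsign_ordered !mul1r. Qed.

Lemma ordered0 : ordered fset0 = [::].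
Proof. by apply/nilP; rewrite /nilp size_sort cardfs0. Qed.

Lemma size_ordered I : size (ordered I) = #|` I|.
Proof. by rewrite size_sort. Qed.

Lemma mono_sign1l u : mono_sign mono1 u = 1.
Proof. by rewrite /mono_sign ordered0 wsign_ordered. Qed.

Lemma mono_sign1r u : mono_sign u mono1 = 1.
Proof. by rewrite /mono_sign ordered0 cats0 wsign_ordered. Qed.


(** [cross] is multiplicative over disjoint unions. When I and J meet, the common factor
    [cross (ordered I) (ordered J)] vanishes. *)
Lemma mono_sign_union I J t :
  cross (ordered I) (ordered J) * cross (ordered (I `|` J)) t =
  cross (ordered I) (ordered J) * (cross (ordered I) t * cross (ordered J) t).
Proof.
have [uIJ|nu] := boolP (uniq (ordered I ++ ordered J)).
  rewrite -cross_cat; congr (_ * _); apply: perm_cross => //.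
  by apply: ordered_perm => //; rewrite fset_wcat !fset_ordered.
suff -> : cross (ordered I) (ordered J) = 0 by rewrite !mul0r.
apply/eqP; move: nu; rewrite -wsign_uniq wsign_cat !wsign_ordered !mul1r.
by rewrite negbK.
Qed.

(** Both sides are the product of the three pairwise signs. [crossC] brings the union on the right
    into first position; the powers of -1 that this costs cancel because the cardinality of a
    disjoint union is additive, and if v and w overlap both sides are 0. *)
Lemma mono_sign_cocycle u v w :
  mono_sign u v * mono_sign (mono_mul u v) w = mono_sign v w * mono_sign u (mono_mul v w).
Proof.
rewrite !mono_sign_cross /= mono_sign_union.
rewrite [cross (ordered u.2) (ordered (_ `|` _))]crossC.
rewrite [RHS]mulrCA mono_sign_union !(crossC (ordered u.2)) !size_ordered.
case: (eqVneq (cross (ordered v.2) (ordered w.2)) 0) => [->|nz].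
  by rewrite !mul0r !mulr0.
have -> : #|` v.2 `|` w.2| = (#|` v.2| + #|` w.2|)%N.
  move: nz; rewrite -[cross _ _]mul1r -(wsign_ordered v.2) -[X in X * _]mulr1.
  rewrite -(wsign_ordered w.2) -wsign_cat wsign_uniq cat_uniq !ordered_uniq andbT /=.
  move=> nh; rewrite cardfsU (_ : v.2 `&` w.2 = fset0) ?cardfs0 ?subn0 //.
  apply/fsetP => i; rewrite !inE; apply/negbTE/negP => /andP[iv iw].
  by case/negP: nh; apply/hasP; exists i; rewrite /= mem_ordered.
rewrite mulnDl exprD ![(_ * #|` u.2|)%N]mulnC.
have := signsq (#|` u.2| * #|` v.2|); have := signsq (#|` u.2| * #|` w.2|).
set e := (-1) ^+ _; set d := (-1) ^+ _ => e2 d2.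
by rewrite -[LHS]mul1r -[X in X * _]mul1r -{1}e2 -d2; ring.
Qed.

Lemma mono_signC u v : mono_sign v u = (-1) ^+ (#|` u.2| * #|` v.2|) * mono_sign u v.
Proof. by rewrite !mono_sign_cross crossC !size_ordered. Qed.


Lemma series_mulE N f g m : within N m -> (f ** g) m =
  \sum_(u <- monos N) \sum_(v <- monos N | mono_mul u v == m) mono_sign u v * (f u * g v).
Proof.
move=> wm; pose D := [seq (u, v) | u <- monos N, v <- monos N].
rewrite /series_mul (fsbigE [seq p <- D | mono_mul p.1 p.2 == m]).
- rewrite big_filter_cond (eq_bigl (fun p => mono_mul p.1 p.2 == m)); last first.
    move=> p; case: eqP => //= /factorizationsP e; exact/mem_set.
  rewrite big_mkcond big_allpairs; apply: eq_bigr => u _.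
  by rewrite -big_mkcond.
- by rewrite filter_uniq // allpairs_uniq ?monos_uniq // => -[? ?] [? ?] _ _ [-> ->].
- by move=> p /=; rewrite mem_filter => /andP[/eqP e _]; apply/factorizationsP.
- move=> [u v] /factorizationsP /= e; rewrite mem_filter e eqxx /= => /negP[].
  have wu : within N u by apply: (@within_mono_mul _ _ v); rewrite e.
  have wv : within N v by apply: (@within_mono_mul _ _ u); rewrite mono_mulC e.
  by apply/allpairsP; exists (u, v); rewrite !within_monos.
Qed.

Lemma big_uniq_pick (T : eqType) (r : seq T) x (F : T -> rat) (P : pred T) :
  uniq r -> x \in r -> \sum_(u <- r | (u == x) && P u) F u = if P x then F x else 0.
Proof.
move=> ur xr; rewrite -big_filter; case: ifP => Px.
  rewrite (_ : [seq _ <- _ | _] = [:: x]) ?big_seq1 //.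
  apply: perm_small_eq => //; apply: uniq_perm; rewrite ?filter_uniq //.
  by move=> u; rewrite mem_filter inE; case: eqVneq => //= ->; rewrite Px.
rewrite big_filter big1 // => u /andP[/eqP ->]; by rewrite Px.
Qed.

(** Factoring m as u v and then u as a b amounts to choosing a triple, since u is determined and
    lies in the list as a divisor of m. [X] receives u separately, so that a sign depending on u can
    be carried along. *)
Lemma sum_mono_mul3 N m (X : smono -> smono -> smono -> smono -> rat) : within N m ->
  \sum_(u <- monos N) \sum_(v <- monos N | mono_mul u v == m)
    \sum_(a <- monos N) \sum_(b <- monos N | mono_mul a b == u) X a b v u =
  \sum_(a <- monos N) \sum_(b <- monos N) \sum_(v <- monos N | mono_mul (mono_mul a b) v == m)
     X a b v (mono_mul a b).
Proof.
move=> wm; transitivity (\sum_(a <- monos N) \sum_(b <- monos N) \sum_(v <- monos N)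
   \sum_(u <- monos N) if (u == mono_mul a b) && (mono_mul u v == m) then X a b v u else 0).
  under [RHS]eq_bigr do (under eq_bigr do rewrite exchange_big /=; rewrite exchange_big /=).
  rewrite [RHS]exchange_big /=; apply: eq_bigr => u _.
  under [RHS]eq_bigr do rewrite exchange_big /=.
  rewrite [RHS]exchange_big /= big_mkcond /=; apply: eq_bigr => v _.
  case: (eqVneq (mono_mul u v) m) => [e|ne]; last first.
    by rewrite big1 // => a _; rewrite big1 // => b _; rewrite andbF.
  apply: eq_bigr => a _; rewrite [in LHS]big_mkcond /=; apply: eq_bigr => b _.
  by rewrite andbT eq_sym.
apply: eq_bigr => a _; apply: eq_bigr => b _; rewrite [RHS]big_mkcond /=.
apply: eq_bigr => c _; rewrite -big_mkcond /=; case: (boolP (mono_mul a b \in monos N)) => abN.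
  by rewrite big_uniq_pick ?monos_uniq.
rewrite big1_seq => [|u /andP[/andP[/eqP -> _]]]; last by rewrite (negPf abN).
by case: eqP => // e; rewrite within_monos // in abN; apply: (@within_mono_mul _ _ c); rewrite e.
Qed.

Lemma series_mulA f g h : f ** (g ** h) = (f ** g) ** h.
Proof.
apply/funext => m; have [N wm] := within_ex m; apply/esym.
have wl u v : mono_mul u v == m -> within N u.
  by move/eqP => e; apply: (@within_mono_mul _ _ v); rewrite e.
rewrite !(series_mulE _ _ wm).
transitivity (\sum_(a <- monos N) \sum_(b <- monos N)
    \sum_(c <- monos N | mono_mul (mono_mul a b) c == m)
     mono_sign a b * mono_sign (mono_mul a b) c * (f a * g b * h c)).
  rewrite -(sum_mono_mul3 (fun a b c u => mono_sign a b * mono_sign u c * (f a * g b * h c))) //.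
  apply: eq_bigr => u _; apply: eq_bigr => v /wl wu.
  rewrite (series_mulE _ _ wu) mulrCA mulr_suml; apply: eq_bigr => a _.
  by rewrite mulr_suml; apply: eq_bigr => b _; ring.
(* [sum_mono_mul3] splits the left factor only. Monomials commute, so b c is put in front of a,
   while the sign keeps the true order. *)
transitivity (\sum_(a <- monos N) \sum_(b <- monos N)
    \sum_(c <- monos N | mono_mul (mono_mul b c) a == m)
     mono_sign b c * mono_sign a (mono_mul b c) * (f a * g b * h c)).
  apply: eq_bigr => a _; apply: eq_bigr => b _.
  apply: eq_big => [c|c _]; first by rewrite -mono_mulA mono_mulC.
  by rewrite mono_sign_cocycle.
transitivity (\sum_(b <- monos N) \sum_(c <- monos N)
    \sum_(a <- monos N | mono_mul (mono_mul b c) a == m)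
     mono_sign b c * mono_sign a (mono_mul b c) * (f a * g b * h c)).
  rewrite exchange_big /=; apply: eq_bigr => b _.
  under eq_bigr do rewrite big_mkcond /=.
  by rewrite exchange_big /=; apply: eq_bigr => c _; rewrite -big_mkcond.
rewrite -(sum_mono_mul3 (fun b c a u => mono_sign b c * mono_sign a u * (f a * g b * h c))) //.
under [LHS]eq_bigr do rewrite big_mkcond /=.
rewrite [LHS]exchange_big /=; apply: eq_bigr => a _; rewrite [RHS]big_mkcond.
apply: eq_bigr => u _; rewrite [mono_mul a u]mono_mulC; case: ifP => // /wl wu.
rewrite (series_mulE _ _ wu) !mulr_sumr; apply: eq_bigr => b _.
by rewrite !mulr_sumr; apply: eq_bigr => c _; ring.
Qed.

Lemma series_mul_neq0 f g m : (f ** g) m != 0 ->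
  exists u v, [/\ mono_mul u v = m, f u != 0 & g v != 0].
Proof.
apply: contraNP => H; apply/eqP/fsbig1 => -[u v] /factorizationsP /= e.
case: (eqVneq (f u) 0) => [->|fu]; first by rewrite mul0r mulr0.
case: (eqVneq (g v) 0) => [->|gv]; first by rewrite !mulr0.
by case: H; exists u, v.
Qed.

Lemma series_mul1m f : series_one ** f = f.
Proof.
apply/funext => m; have [N wm] := within_ex m; rewrite (series_mulE _ _ wm).
have w1 : mono1 \in monos N.
  by apply: within_monos; apply: (@within_mono_mul _ _ m); rewrite mono_mul1l.
rewrite (bigD1_seq mono1) ?monos_uniq //= [X in _ + X]big1 ?addr0; last first.
  by move=> u /negPf ne; rewrite big1 // => v _; rewrite /series_one ne mul0r mulr0.
under eq_bigl do rewrite mono_mul1l -[_ == m]andbT.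
rewrite big_uniq_pick ?monos_uniq ?within_monos //.
by rewrite mono_sign1l /series_one eqxx !mul1r.
Qed.

Lemma series_mulm1 f : f ** series_one = f.
Proof.
apply/funext => m; have [N wm] := within_ex m; rewrite (series_mulE _ _ wm).
have w1 : mono1 \in monos N.
  by apply: within_monos; apply: (@within_mono_mul _ _ m); rewrite mono_mul1l.
under eq_bigr do rewrite big_mkcond /=.
rewrite exchange_big /= (bigD1_seq mono1) ?monos_uniq //= [X in _ + X]big1 ?addr0; last first.
  move=> u /negPf ne; rewrite big1 // => v _; rewrite /series_one ne !mulr0.
  by case: ifP.
rewrite -big_mkcond; under eq_bigl do rewrite mono_mulC mono_mul1l -[_ == m]andbT.
rewrite big_uniq_pick ?monos_uniq ?within_monos //.
by rewrite mono_sign1r /series_one eqxx mul1r mulr1.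
Qed.

Lemma seriesE k (f g : series) m : (k *: f + g) m = k * f m + g m.
Proof. by []. Qed.

Lemma series_mul_linl g : linear (fun f => f ** g : series).
Proof.
move=> k f f'; apply/funext => m; have [N wm] := within_ex m.
rewrite seriesE !(series_mulE _ _ wm) mulr_sumr -big_split; apply: eq_bigr => u _ /=.
rewrite mulr_sumr -big_split; apply: eq_bigr => v _ /=.
by rewrite -[(k *: f + f') u]/(k * f u + f' u); ring.
Qed.

Lemma series_mul_linr f : linear (fun g => f ** g : series).
Proof.
move=> k g g'; apply/funext => m; have [N wm] := within_ex m.
rewrite seriesE !(series_mulE _ _ wm) mulr_sumr -big_split; apply: eq_bigr => u _ /=.
rewrite mulr_sumr -big_split; apply: eq_bigr => v _ /=.
by rewrite -[(k *: g + g') v]/(k * g v + g' v); ring.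
Qed.

Lemma series_mul_bilin : bilin (fun f g => f ** g : series).
Proof. by split; [exact: series_mul_linl | exact: series_mul_linr]. Qed.

Definition homog (b : bool) (f : series) := forall m, f m != 0 -> odd #|` m.2| = b.

Lemma series_mulC b c f g : homog b f -> homog c g ->
  f ** g = (-1) ^+ (b && c) *: (g ** f).
Proof.
move=> hf hg; apply/funext => m; have [N wm] := within_ex m.
rewrite -[RHS]/((-1) ^+ (b && c) * (g ** f) m) !(series_mulE _ _ wm).
rewrite mulr_sumr; under eq_bigr do rewrite big_mkcond /=.
rewrite exchange_big /=; apply: eq_bigr => v _; rewrite mulr_sumr.
rewrite -big_mkcond; apply: eq_big => [u|u _]; first by rewrite mono_mulC.
case: (eqVneq (f u) 0) => [->|/hf <-]; first by rewrite mul0r !mulr0.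
case: (eqVneq (g v) 0) => [->|/hg <-]; first by rewrite mul0r !mulr0.
by rewrite mono_signC mulnC -signr_odd oddM; ring.
Qed.

(** Cardinalities add only for disjoint sets of anticommuting variables, so a factorization with
    nonzero sign is extracted; [series_mul_neq0] forgets the sign. *)
Lemma homog_mul b c f g : homog b f -> homog c g -> homog (b (+) c) (f ** g).
Proof.
move=> hf hg m; rewrite /series_mul => nz.
have [p [/factorizationsP e] s0] : exists p, factorizations m p /\
    wsign (ordered p.1.2 ++ ordered p.2.2) * (f p.1 * g p.2) != 0.
  apply: contraNP nz => H; apply/eqP/fsbig1 => p hp; apply/eqP/negPn/negP => nz.
  by apply: H; exists p.
move: s0; rewrite !mulf_eq0 !negb_or wsign_uniq => /andP[us /andP[/hf <- /hg <-]].
rewrite -oddD -e /= -(size_ordered p.1.2) -(size_ordered p.2.2) -size_cat.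
rewrite -size_ordered; congr odd; apply: perm_size; apply: ordered_perm => //.
by rewrite fset_wcat !fset_ordered.
Qed.

(** * Renaming the variables *)

Definition inv_of (h : nat -> nat) (i : nat) : nat := xget 0%N [set j | h j = i]%classic.

Lemma inv_ofK h : injective h -> cancel h (inv_of h).
Proof. move=> hI i; apply: hI; apply: (@xgetPex _ 0%N [set j | h j = h i]%classic).
by exists i. Qed.

Definition erename (h : nat -> nat) (a : expo) : expo := erelabel h (inv_of h) a.
Definition mrename (h : nat -> nat) (m : smono) : smono := (erename h m.1, h @` m.2).

Section Rename.
Variable h : nat -> nat.
Hypothesis hI : injective h.

Lemma erename_in a i : erename h a (h i) = a i.
Proof.
rewrite fsfun_fun inv_ofK //; case: ifPn => // /imfsetP ni; case: finsuppP => // ia.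
by case: ni; exists i.
Qed.

Lemma erename_out a j : (forall i, h i != j) -> erename h a j = 0%N.
Proof.
move=> ne; rewrite fsfun_fun; case: ifPn => // /imfsetP[/= i _ e].
by have := ne i; rewrite e eqxx.
Qed.

Lemma im_or j : (exists i, j = h i) \/ (forall i, h i != j).
Proof.
have [[i ->]|no] := pselect (exists i, j = h i); [by left; exists i|right => i].
by apply/eqP => e; apply: no; exists i.
Qed.

Lemma eq_erename (a b : expo) : (forall i, b (h i) = a i) ->
  (forall j, b j != 0%N -> exists i, j = h i) -> b = erename h a.
Proof.
move=> h1 h2; apply/fsfunP => j; have [[i ->]|no] := im_or j.
  by rewrite erename_in h1.
rewrite erename_out //; apply/eqP/negPn/negP => /h2[i e].
by have := no i; rewrite e eqxx.
Qed.

Lemma mrename_inj : injective (mrename h).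
Proof.
move=> [a I] [b J] [/fsfunP e1 e2]; congr pair.
  by apply/fsfunP => i; rewrite -(erename_in a) -(erename_in b) e1.
apply/fsetP => i; have /fsetP/(_ (h i)) := e2; by rewrite !mem_imfset.
Qed.

Lemma mrename_mono_mul u v : mrename h (mono_mul u v) = mono_mul (mrename h u) (mrename h v).
Proof.
rewrite /mrename /mono_mul /= imfsetU; congr pair; apply/esym/eq_erename => [i|j].
  by rewrite !expo_addE !erename_in.
by have [//|no] := im_or j; rewrite expo_addE !erename_out.
Qed.

Lemma mrename1 : mrename h mono1 = mono1.
Proof.
rewrite /mrename /mono1 imfset0; congr pair; apply/esym/eq_erename => [i|j].
  by rewrite !fsfunE.
by rewrite fsfunE.
Qed.

(** Exponents never cancel: a variable of u outside the image of [h] would survive in the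
    product. *)
Lemma mrename_divl u v m : mono_mul u v = mrename h m -> exists u', u = mrename h u'.
Proof.
case: u v m => a I [b J] [c K] [/fsfunP e1 /fsetP e2].
have sub j : a j != 0%N -> exists i, j = h i.
  move=> aj; have [//|no] := im_or j; have := e1 j; rewrite expo_addE erename_out //.
  by move/eqP; rewrite addn_eq0 (negPf aj).
pose hs := inv_of h.
have hsK j : (exists i, j = h i) -> h (hs j) = j by case=> i ->; rewrite /hs inv_ofK.
exists ([fsfun i in hs @` finsupp a => a (h i)], hs @` I); congr pair.
  apply: eq_erename => // i; rewrite fsfun_fun; case: ifPn => // /imfsetP ni.
  case: finsuppP => // hi; case: ni; exists (h i) => //.
  by rewrite /hs inv_ofK.
apply/fsetP => j; have subI k : k \in I -> exists i, k = h i.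
  move=> kI; have := e2 k; rewrite inE kI => /esym/imfsetP[/= i _ ->]; by exists i.
apply/idP/imfsetP => [jI|[/= i /imfsetP[/= k kI ->] ->]].
  by exists (hs j); rewrite ?hsK //; [apply/imfsetP; exists j|exact: subI].
by rewrite hsK //; exact: subI.
Qed.

(** The result of substituting variable [h i] for variable i in f, all other variables being absent.
    The default [mono1] is discarded by the test when m is not in the image of [mrename h]. *)
Definition rename (f : series) : series := fun m =>
  let m' := xget mono1 [set m' | mrename h m' = m]%classic in
  if mrename h m' == m then wsign (map h (ordered m'.2)) * f m' else 0.

Lemma rename_in f m :
  rename f (mrename h m) = wsign (map h (ordered m.2)) * f m.
Proof.
rewrite /rename; set m' := xget _ _.
have e : mrename h m' = mrename h m 
  by apply: (@xgetPex _ mono1 [set m' | mrename h m' = mrename h m]%classic); exists m.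
by rewrite e eqxx; move/mrename_inj: e => ->.
Qed.

Lemma rename_out f n : (forall m, mrename h m != n) -> rename f n = 0.
Proof. by move=> ne; rewrite /rename (negPf (ne _)). Qed.

Lemma rename_ind (P : smono -> Prop) : (forall m, P (mrename h m)) ->
  (forall n, (forall m, mrename h m != n) -> P n) -> forall n, P n.
Proof.
move=> h1 h2 n; have [[m <-]|no] := pselect (exists m, mrename h m = n); first exact: h1.
by apply: h2 => m; apply/eqP => e; apply: no; exists m.
Qed.

Lemma rename_neq0 f n : rename f n != 0 -> exists2 m, n = mrename h m & f m != 0.
Proof.
move: n; apply: rename_ind => [m|n no]; last by rewrite rename_out // eqxx.
by rewrite rename_in mulf_eq0 negb_or => /andP[_]; exists m.
Qed.

Lemma rename_linear : linear rename.
Proof.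
move=> k f g; apply/funext; apply: rename_ind => [m|n no]; rewrite seriesE.
  by rewrite !rename_in seriesE; ring.
by rewrite !rename_out // mulr0 addr0.
Qed.

Lemma rename1 : rename series_one = series_one.
Proof.
apply/funext; apply: rename_ind => [m|n no]; rewrite /series_one.
  rewrite rename_in -{2}mrename1 (inj_eq mrename_inj); case: eqP => [->|_].
    by rewrite /mono1 ordered0 /= mulr1.
  by rewrite mulr0.
rewrite rename_out //; case: eqP => // e.
by have := no mono1; rewrite mrename1 e eqxx.
Qed.

Lemma rename_mul f g : rename (f ** g) = rename f ** rename g.
Proof.
apply/funext; apply: rename_ind => [m|n no]; last first.
  rewrite rename_out //; apply/esym/eqP/negPn/negP.
  case/series_mul_neq0 => u [v [e /rename_neq0[u' eu _] /rename_neq0[v' ev _]]].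
  by have := no (mono_mul u' v'); rewrite mrename_mono_mul -eu -ev e eqxx.
rewrite rename_in /series_mul mulr_fsumr; apply/esym.
pose k (p : smono * smono) := (mrename h p.1, mrename h p.2).
have hb : set_bij (factorizations m) (factorizations (mrename h m)) k.
  split.
  - by move=> [u v] /factorizationsP /= e; apply/factorizationsP; rewrite -mrename_mono_mul e.
  - move=> [u v] [u' v'] _ _ e.
    have /mrename_inj -> : mrename h u = mrename h u' := congr1 fst e.
    by have /mrename_inj -> : mrename h v = mrename h v' := congr1 snd e.
  - move=> [u v] /factorizationsP /= e.
    have [u' eu] := mrename_divl e; have [v' ev] : exists v', v = mrename h v'.
      by apply: (@mrename_divl _ u m); rewrite mono_mulC.
    exists (u', v'); last by rewrite /k /= -eu -ev.
    apply/factorizationsP; apply: mrename_inj; by rewrite mrename_mono_mul -eu -ev.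
rewrite (reindex_fsbig k _ _ _ hb); apply: eq_fsbigr => -[u v] /set_mem /factorizationsP /= e.
rewrite /k /= !rename_in -e /= -(mono_wsign_relabel u.2 v.2 hI) /=.
set w := wsign (map h (ordered (u.2 `|` v.2))).
have w2 : w * w = 1 by rewrite wsign_sq // map_inj_uniq ?ordered_uniq.
by rewrite -[LHS]mul1r -w2; ring.
Qed.

Lemma rename_homog b f : homog b f -> homog b (rename f).
Proof.
by move=> hf n /rename_neq0[m -> /hf <-] /=; rewrite card_imfset.
Qed.

Lemma rename_lambda (f : Lambda) : bijective h -> rename f = f.
Proof.
move=> [t ht th]; have e m : mrename h m = mrelabel h t m.
  congr pair; apply/esym/eq_erename => [i|j _]; first by rewrite erelabelE // ht.
  by exists (t j); rewrite th.
apply/funext; apply: rename_ind => [m|n no].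
  by rewrite rename_in e (symmetric_relabel ht th) //; exact: lambda_symmetric.
by have := no (mrelabel t h n); rewrite e mrelabelK ?eqxx.
Qed.

End Rename.

Lemma eq_rename h k f : h =1 k -> rename h f = rename k f.
Proof. by move=> /funext ->. Qed.

Lemma rename_comp h k f : injective h -> injective k ->
  rename h (rename k f) = rename (h \o k) f.
Proof.
move=> hI kI; have hkI : injective (h \o k) by exact: inj_comp.
have e m : mrename (h \o k) m = mrename h (mrename k m).
  rewrite /mrename /= -imfset_comp; congr pair; apply/esym/eq_erename => // [i|j].
    by rewrite /= !erename_in.
  have [[i ->]|no] := im_or h j; last by rewrite erename_out.
  rewrite erename_in //; have [[i' ->] _|no] := im_or k i; first by exists i'.
  by rewrite erename_out.
apply/funext; apply: (@rename_ind (h \o k)) => [m|n no].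
  by rewrite rename_in // e !rename_in // mulrA [wsign _ * wsign _]mulrC
    wsign_relabel_map // -map_comp.
rewrite [RHS]rename_out //; apply/eqP/negPn/negP.
case/(rename_neq0 hI) => m e1 /(rename_neq0 kI)[m' e2 _].
by have := no m'; rewrite e -e2 -e1 eqxx.
Qed.

(** * The coproduct as an equality of series *)

Lemma tensor_ext_lin (K : fieldType) (U V W : lmodType K) (L M : U ⨂ V -> W) :
  linear L -> linear M -> (forall u v, L (u ⊗ v) = M (u ⊗ v)) -> L =1 M.
Proof.
move=> lL lM e t; rewrite [t]tens_sum.
elim: (repr t : seq _) => [|p s IH]; first by rewrite !big_nil !(linear_at0, linear_at0 lL, linear_at0 lM).
rewrite !big_cons -[tens _ _]scale1r lL lM IH; congr (_ *: _ + _); exact: e.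
Qed.

Lemma linear_comp (K : fieldType) (U V W : lmodType K) (L : V -> W) (M : U -> V) :
  linear L -> linear M -> linear (fun u => L (M u)).
Proof. by move=> lL lM k u v; rewrite lM lL. Qed.

Lemma id_linear (K : fieldType) (U : lmodType K) : linear (fun u : U => u).
Proof. by []. Qed.

Lemma lin_sum (K : fieldType) (U V : lmodType K) (L : U -> V) (I : Type) (s : seq I)
  (c : I -> K) (F : I -> U) :
  linear L -> L (\sum_(i <- s) c i *: F i) = \sum_(i <- s) c i *: L (F i).
Proof.
move=> lL; elim: s => [|i s IH]; first by rewrite !big_nil (linear_at0 lL).
by rewrite !big_cons lL IH.
Qed.

Lemma lin_big (K : fieldType) (U V : lmodType K) (L : U -> V) (I : Type) (s : seq I)
  (F : I -> U) :
  linear L -> L (\sum_(i <- s) F i) = \sum_(i <- s) L (F i).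
Proof.
move=> lL; have := lin_sum s (fun=> 1) F lL.
by under eq_bigr do rewrite scale1r; under [RHS]eq_bigr do rewrite scale1r.
Qed.

Definition mpair (m n : smono) : smono := mono_mul (mrename dbl m) (mrename dblS n).

Lemma dbl_dblS i j : dbl i != dblS j.
Proof. by apply/eqP => /(congr1 odd); rewrite /dbl /dblS /= !odd_double. Qed.

Lemma dblS_dbl i j : dblS i != dbl j.
Proof. by rewrite eq_sym dbl_dblS. Qed.

Lemma mpair_even m n i : (mpair m n).1 (dbl i) = m.1 i.
Proof.
rewrite expo_addE (erename_in dbl_inj) erename_out ?addn0 // => j; exact: dblS_dbl.
Qed.

Lemma mpair_odd m n i : (mpair m n).1 (dblS i) = n.1 i.
Proof.
rewrite expo_addE (erename_in dblS_inj) erename_out // => j; exact: dbl_dblS.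
Qed.

Lemma mpair_evenS m n i : (dbl i \in (mpair m n).2) = (i \in m.2).
Proof.
rewrite inE mem_imfset; last exact: dbl_inj.
rewrite orbC; case: imfsetP => // -[/= j _ e].
by have := dbl_dblS i j; rewrite e eqxx.
Qed.

Lemma mpair_oddS m n i : (dblS i \in (mpair m n).2) = (i \in n.2).
Proof.
rewrite inE [X in _ || X]mem_imfset; last exact: dblS_inj.
case: imfsetP => // -[/= j _ e].
by have := dblS_dbl i j; rewrite e eqxx.
Qed.

Lemma mpair_inj m n m' n' : mpair m n = mpair m' n' -> m = m' /\ n = n'.
Proof.
case: m n m' n' => a I [b J] [a' I'] [b' J'] e; split; congr pair.
- by apply/fsfunP => i; rewrite -(mpair_even (a, I) (b, J)) e mpair_even.
- by apply/fsetP => i; rewrite -(mpair_evenS (a, I) (b, J)) e mpair_evenS.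
- by apply/fsfunP => i; rewrite -(mpair_odd (a, I) (b, J)) e mpair_odd.
- by apply/fsetP => i; rewrite -(mpair_oddS (a, I) (b, J)) e mpair_oddS.
Qed.

Lemma even_or_odd j : (exists i, j = dbl i) \/ (exists i, j = dblS i).
Proof.
rewrite -[j]odd_double_half; case: (odd j); last by left; exists j./2.
by right; exists j./2.
Qed.

Lemma mpair_surj k : exists m n, k = mpair m n.
Proof.
case: k => a I.
have ex (h : nat -> nat) : injective h -> exists m : smono,
    (forall i, m.1 i = a (h i)) /\ (forall i, (i \in m.2) = (h i \in I)).
  move=> hI; pose t := inv_of h.
  exists ([fsfun i in t @` finsupp a => a (h i)], [fset i in t @` I | h i \in I]).
  split=> i /=.
    rewrite fsfun_fun; case: ifPn => // /imfsetP ni; case: finsuppP => // hi.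
    by case: ni; exists (h i) => //; rewrite /t inv_ofK.
  rewrite !inE /=; case: (boolP (h i \in I)) => hi; rewrite ?andbF ?andbT //.
  by apply/imfsetP; exists (h i) => //; rewrite /t inv_ofK.
have [m [m1 m2]] := ex dbl dbl_inj; have [n [n1 n2]] := ex dblS dblS_inj.
exists m, n; rewrite [RHS]surjective_pairing; congr pair.
  apply/fsfunP => j; have [[i ->]|[i ->]] := even_or_odd j.
    by rewrite mpair_even m1.
  by rewrite mpair_odd n1.
apply/fsetP => j; have [[i ->]|[i ->]] := even_or_odd j.
  by rewrite mpair_evenS m2.
by rewrite mpair_oddS n2.
Qed.

(** The first set of anticommuting variables precedes the second, so the word is not sorted; its
    [wsign] is the discrepancy between a coefficient in two sets of variables and one in the
    interlaced variables. *)
Definition mpair_word (m n : smono) := map dbl (ordered m.2) ++ map dblS (ordered n.2).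

Lemma mpair_word_uniq m n : uniq (mpair_word m n).
Proof.
rewrite cat_uniq !map_inj_uniq ?ordered_uniq //; [|exact: dblS_inj|exact: dbl_inj].
rewrite andbT /=; apply/hasPn => _ /mapP[i _ ->]; apply/negP => /mapP[j _ e].
by have := dblS_dbl i j; rewrite e eqxx.
Qed.

(** A single factorization contributes: the even and the odd variables of an interlaced monomial
    determine its factors. *)
Lemma rename_dbl_mul (f g : series) m n :
  (rename dbl f ** rename dblS g) (mpair m n) = wsign (mpair_word m n) * (f m * g n).
Proof.
have eI := dbl_inj; have oI := dblS_inj.
rewrite /series_mul (fsbigE [:: (mrename dbl m, mrename dblS n)]) //=; last 2 first.
- by move=> p /=; rewrite inE => /eqP ->; apply/factorizationsP.
- move=> [u v] /factorizationsP /= e ne; apply/eqP; move: ne; apply: contraNT.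
  rewrite !mulf_eq0 !negb_or => /and3P[_ /(rename_neq0 eI)[u' eu _] /(rename_neq0 oI)[v' ev _]].
  move: e; rewrite eu ev => e; have [-> ->] := @mpair_inj u' v' m n e.
  by rewrite inE.
rewrite big_mkcond big_seq1 ifT; last by apply/mem_set/factorizationsP.
rewrite !rename_in //= wsign_cat !wsign_ordered !mul1r /mpair_word wsign_cat.
have pm h (hI : injective h) (L : {fset nat}) : perm_eq (ordered (h @` L)) (map h (ordered L)).
  by apply: ordered_perm; rewrite ?map_inj_uniq ?ordered_uniq // fset_map fset_ordered.
by rewrite (perm_cross (pm _ eI m.2) (pm _ oI n.2)); ring.
Qed.

(* f(x) g(y) written in the interlaced variables x_0, y_0, x_1, y_1, ... of
   series_union: under this embedding the coproduct becomes the identity. *)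
Definition tmerge : Lambda ⨂ Lambda -> series :=
  tlift (fun f g : Lambda => rename dbl f ** rename dblS g : series).

Lemma lval_linear : linear lval.
Proof. by []. Qed.

Lemma tmerge_bilin : bilin (fun f g : Lambda => rename dbl f ** rename dblS g : series).
Proof.
apply: (bilin_comp series_mul_bilin); apply: linear_comp lval_linear.
  exact: rename_linear dbl_inj.
exact: rename_linear dblS_inj.
Qed.

Lemma tmerge_linear : linear tmerge. Proof. exact: tlift_linear tmerge_bilin. Qed.

Lemma tmerge_tens f g : tmerge (f ⊗ g) = rename dbl f ** rename dblS g.
Proof. exact: tlift_tens tmerge_bilin. Qed.

Lemma tmerge_mpair t m n : tmerge t (mpair m n) = wsign (mpair_word m n) * two_sets t (m, n).
Proof.
apply: (tensor_ext_lin (L := fun t => tmerge t (mpair m n) : rat^o)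
  (M := fun t => wsign (mpair_word m n) * two_sets t (m, n) : rat^o)) => [k u v|k u v|f g].
- by rewrite tmerge_linear.
- rewrite two_sets_linear -[(k *: _ + _) _]/(k * two_sets u (m, n) + two_sets v (m, n)).
  by rewrite -[RHS]/(k * (wsign (mpair_word m n) * two_sets u (m, n)) +
      wsign (mpair_word m n) * two_sets v (m, n)); ring.
- by rewrite tmerge_tens rename_dbl_mul two_sets_tens.
Qed.

Lemma tmerge_inj : injective tmerge.
Proof.
move=> s t e; apply: two_sets_inj; apply/funext => -[m n].
have := congr1 (@^~ (mpair m n)) e; rewrite !tmerge_mpair => /mulfI; apply.
by rewrite wsign_uniq mpair_word_uniq.
Qed.

Lemma tmerge_coproduct f : tmerge (coproduct f) = f.
Proof.
apply/funext => k; have [m [n ->]] := mpair_surj k.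
rewrite tmerge_mpair coproductE /series_union /wcoef mulrA wsign_sq ?mpair_word_uniq // mul1r.
congr (f _); congr pair.
  apply/fsfunP => j; rewrite interleaveE; have [[i ->]|[i ->]] := even_or_odd j.
    by rewrite odd_double doubleK (mpair_even m n).
  by rewrite /dblS /= odd_double /= uphalf_double (mpair_odd m n).
rewrite fset_wcat !fset_map !fset_ordered //.
Qed.

Lemma coproductP (f : Lambda) t : tmerge t = f -> coproduct f = t.
Proof. by move=> e; apply: tmerge_inj; rewrite tmerge_coproduct. Qed.

Lemma coproduct_linear : linear coproduct.
Proof.
move=> k f g; apply: coproductP; rewrite tmerge_linear !tmerge_coproduct //.
Qed.

(** * The bialgebra axioms *)

Lemma Lambda_mulA : associative Lambda_mul.
Proof. by move=> f g h; apply: val_inj; exact: series_mulA. Qed.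

Lemma Lambda_mul1l : left_id Lambda_one Lambda_mul.
Proof. by move=> f; apply: val_inj; exact: series_mul1m. Qed.

Lemma Lambda_mul1r : right_id Lambda_one Lambda_mul.
Proof. by move=> f; apply: val_inj; exact: series_mulm1. Qed.

Lemma Lambda_mul_bilin : bilin Lambda_mul.
Proof.
by split=> [g k f f'|f k g g']; apply: val_inj; [exact: series_mul_linl|exact: series_mul_linr].
Qed.

Lemma Lambda_super_algebra : super_algebra Lambda_mul Lambda_one.
Proof.
split; [exact: Lambda_mul_bilin|exact: Lambda_mulA|exact: Lambda_mul1l|exact: Lambda_mul1r].
Qed.


Lemma parity_homog b (f : Lambda) : par b f <-> homog b f.
Proof.
split=> [hf m nz|hf i].
  apply/eqP; apply: contraNT nz => /negPf ne.
  have := congr1 (fun g : Lambda => g m) (hf b); rewrite eqxx /= /series_par ne.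
  by move=> <-.
apply: lambda_ext => m /=; rewrite /series_par.
have [fm|/hf ->] := eqVneq (f m) 0; last by case: ifP.
by rewrite [lval f m]fm if_same; case: ifP => _ //; rewrite [RHS]fm.
Qed.

Lemma Lambda_par_homog b f : par b (Lambda_par b f).
Proof. by apply/parity_homog => m /=; rewrite /series_par; case: ifP => [/eqP //|_]; rewrite eqxx. Qed.

Lemma parity_mul b c f g : par b f -> par c g -> par (b (+) c) (f *L g).
Proof. by move=> /parity_homog hf /parity_homog hg; apply/parity_homog/homog_mul. Qed.

Lemma parity_one : par false Lambda_one.
Proof.
apply/parity_homog => m; rewrite /= /series_one; case: (m =P mono1) => [-> _|_]; last by rewrite eqxx.
by rewrite cardfs0.
Qed.

Lemma Lambda_mulC b c f g : par b f -> par c g ->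
  f *L g = (-1) ^+ (b && c) *: (g *L f).
Proof. by move=> /parity_homog hf /parity_homog hg; apply/val_inj/series_mulC. Qed.

Lemma tens_linl (U V : lmodType rat) (v : V) : linear (fun u : U => u ⊗ v).
Proof. exact: (@tens_bilin rat U V).1. Qed.

Lemma tens_linr (U V : lmodType rat) (u : U) : linear (fun v : V => u ⊗ v).
Proof. exact: (@tens_bilin rat U V).2. Qed.

Lemma lin_add (K : fieldType) (U V : lmodType K) (L : U -> V) :
  linear L -> {morph L : u v / u + v}.
Proof. by move=> lL u v; have := lL 1 u v; rewrite !scale1r. Qed.

Lemma lin_scale (K : fieldType) (U V : lmodType K) (L : U -> V) k u :
  linear L -> L (k *: u) = k *: L u.
Proof. by move=> lL; have := lL k u 0; rewrite addr0 (linear_at0 lL) addr0. Qed.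

Lemma super_ext (V : lmodType rat) (L M : Lambda ⨂ Lambda -> V) :
  linear L -> linear M ->
  (forall b c f g, par b f -> par c g -> L (f ⊗ g) = M (f ⊗ g)) -> L =1 M.
Proof.
move=> lL lM e; apply: tensor_ext_lin => // f g.
rewrite -[f]Lambda_par_sum -[g]Lambda_par_sum.
rewrite !(lin_add (tens_linl _)) !(lin_add (tens_linr _)) !(lin_add lL) !(lin_add lM).
by congr (_ + _ + (_ + _)); apply: e; exact: Lambda_par_homog.
Qed.

Lemma tmul_linl t : linear (fun s => tmulL s t).
Proof.
apply: tlift_linear; apply: tlift_bilin => a d; apply: bisum_bilin => i j.
apply: (bilin_comp (@tens_bilin _ _ _)) => k u v; first exact: Lambda_mul_bilin.1.
by rewrite Lambda_par_linear; exact: Lambda_mul_bilin.1.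
Qed.

Lemma tlift_lin2 (K : fieldType) (U V X W : lmodType K) (F : U -> V -> X -> W) (s : U ⨂ V) :
  (forall u v, linear (F u v)) -> linear (fun x => tlift (fun u v => F u v x) s).
Proof.
move=> lF k x y; rewrite /tlift /tsum scaler_sumr -big_split /=.
by apply: eq_bigr => p _; exact: lF.
Qed.

Lemma tmul_linr s : linear (tmulL s).
Proof.
apply: (tlift_lin2 (F := fun f1 g1 t => tlift _ t)) => u v.
apply: tlift_linear; apply: bisum_bilin => i j.
apply: (bilin_comp (@tens_bilin _ _ _)) => k x y; last exact: Lambda_mul_bilin.2.
by rewrite Lambda_par_linear; exact: Lambda_mul_bilin.2.
Qed.

(** The sign in the product of tensors is the one produced by moving [g1], written in odd variables,
    past [f2], written in even ones. *)
Lemma tmerge_tmul s t : tmerge (tmulL s t) = tmerge s ** tmerge t.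
Proof.
move: s; apply: super_ext.
- exact: linear_comp tmerge_linear (tmul_linl t).
- exact: linear_comp (series_mul_linl _) tmerge_linear.
move=> b c f1 g1 hf1 hg1; move: t; apply: super_ext.
- exact: linear_comp tmerge_linear (tmul_linr _).
- exact: linear_comp (series_mul_linr _) tmerge_linear.
move=> d e f2 g2 hf2 hg2.
rewrite (tmul_tens Lambda_par_linear f1 g2 Lambda_mul_bilin hg1 hf2) (lin_scale _ _ tmerge_linear).
rewrite !tmerge_tens /= (rename_mul dbl_inj) (rename_mul dblS_inj).
have hg := rename_homog dblS_inj ((parity_homog _ _).1 hg1).
have hf := rename_homog dbl_inj ((parity_homog _ _).1 hf2).
rewrite -!series_mulA [rename dblS g1 ** (_ ** _)]series_mulA (series_mulC hg hf).
rewrite (lin_scale _ _ (series_mul_linl _)) (lin_scale _ _ (series_mul_linr _)).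
by rewrite -series_mulA.
Qed.

Lemma coproduct_mul f g : coproduct (f *L g) = tmulL (coproduct f) (coproduct g).
Proof. by apply: coproductP; rewrite tmerge_tmul !tmerge_coproduct. Qed.

Lemma coproduct_one : coproduct Lambda_one = Lambda_one ⊗ Lambda_one.
Proof.
apply: coproductP; rewrite tmerge_tens /= (rename1 dbl_inj) (rename1 dblS_inj).
exact: series_mul1m.
Qed.

(** * Cocommutativity *)

Definition parity_flip (i : nat) := if odd i then i.-1 else i.+1.

Lemma parity_flipK : involutive parity_flip.
Proof. by case=> [|i] //; rewrite /parity_flip /=; case o: (odd i) => /=; rewrite ?o //=; case: i o. Qed.

(** Exchanging the two sets of variables is the bijection [parity_flip] of the interlaced ones,
    which fixes f. It reverses the two factors of a merged tensor, and restoring their order costs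
    exactly the sign of [tswap]. *)
Lemma coproduct_cocommutative : super_cocommutative Lambda_par coproduct.
Proof.
move=> f; apply/esym/coproductP.
have bf : bijective parity_flip by exists parity_flip; exact: parity_flipK.
have fI := bij_inj bf.
rewrite -[RHS](rename_lambda fI f bf) -tmerge_coproduct.
move: (coproduct f); apply: super_ext.
- apply: linear_comp tmerge_linear _; apply: tlift_linear; apply: bisum_bilin => i j.
  by apply: (bilin_comp (bilin_flip (@tens_bilin _ _ _))); exact: Lambda_par_linear.
- exact: linear_comp (rename_linear fI) tmerge_linear.
move=> b c g h hg hh; rewrite (tswap_tens Lambda_par_linear hg hh) (lin_scale _ _ tmerge_linear).
rewrite !tmerge_tens (rename_mul fI) !(rename_comp _ fI); try exact: dbl_inj; try exact: dblS_inj.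
rewrite (@eq_rename (parity_flip \o dbl) dblS); last first.
  by move=> i; rewrite /= /parity_flip /dbl odd_double.
rewrite (@eq_rename (parity_flip \o dblS) dbl); last first.
  by move=> i; rewrite /= /parity_flip /dblS /= odd_double.
rewrite (series_mulC (rename_homog dblS_inj ((parity_homog _ _).1 hg))
  (rename_homog dbl_inj ((parity_homog _ _).1 hh))) //.
Qed.

(** * Invariance under injections of the variables, and the counit *)

Lemma eq_in_mrename h k m : injective h -> injective k ->
  {in msupp m, h =1 k} -> mrename h m = mrename k m.
Proof.
case: m => a I hI kI hk; congr pair.
  apply/fsfunP => j; have [[i ->]|no] := im_or h j.
    rewrite erename_in //; have [ia|] := boolP (i \in finsupp a).
      by rewrite hk ?erename_in // inE ia.
    rewrite memNfinsupp => /eqP ai; have [[i' e]|no'] := im_or k (h i); last by rewrite erename_out.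
    rewrite e erename_in // ai; apply/esym/eqP/negPn/negP => ai'.
    have : i' \in msupp (a, I) by rewrite inE mem_finsupp ai'.
    by move/hk; rewrite -e => /hI ei; rewrite ei ai in ai'.
  rewrite erename_out //; have [[i e]|no'] := im_or k j; last by rewrite erename_out.
  rewrite e erename_in //; apply/esym/eqP/negPn/negP => ai.
  have : i \in msupp (a, I) by rewrite inE mem_finsupp ai.
  by move/hk; rewrite -e => e'; have := no i; rewrite e' eqxx.
by apply: eq_in_imfset => // i /= iI; apply: hk; rewrite inE iI orbT.
Qed.

(** A monomial involves finitely many variables, and on these an injection agrees with a bijection:
    send both the support and its image onto the same initial segment, and compose one map with the
    inverse of the other. *)
Lemma lambda_rename (f : Lambda) h m : injective h ->
  f (mrename h m) = wsign (map h (ordered m.2)) * f m.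
Proof.
move=> hI; have [s bs es] := bij_iota (fset_uniq (msupp m)).
have [t bt et] : exists2 t : nat -> nat, bijective t & map t (map h (msupp m)) = iota 0 (size (msupp m)).
  by rewrite -(size_map h); apply: bij_iota; rewrite map_inj_uniq ?fset_uniq.
have [t' tt' t't] := bt.
have bk : bijective (t' \o s) by apply: bij_comp bs; exists t.
have hk : {in msupp m, h =1 t' \o s}.
  move=> i im; apply: (bij_inj bt); rewrite /= t't.
  have : map (t \o h) (msupp m) = map s (msupp m) by rewrite map_comp et es.
  by move/eq_in_map => /(_ i im) /= ->.
rewrite (eq_in_mrename hI (bij_inj bk) hk) -{1}(rename_lambda (bij_inj bk) f bk).
rewrite rename_in ?(bij_inj bk) //; last exact: bij_inj.
congr (wsign _ * _); apply/esym/eq_in_map => i; rewrite mem_ordered => im.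
by apply: hk; rewrite inE im orbT.
Qed.

Lemma ordered_sorted I : sorted leq (ordered I).
Proof. by rewrite sort_sorted //; exact: leq_total. Qed.

Lemma two_sets_coproduct (f : Lambda) m n :
  two_sets (coproduct f) (m, n) = wsign (mpair_word m n) * f (mpair m n).
Proof.
by rewrite -(tmerge_coproduct f) tmerge_mpair mulrA wsign_sq ?mul1r ?mpair_word_uniq.
Qed.

Lemma counit_linear : scalar counit.
Proof. by move=> k f g. Qed.

Lemma counitl_linear : bilin (fun a b : Lambda => counit a *: b).
Proof.
split=> [b k f g|a k f g]; first by rewrite counit_linear scalerDl scalerA.
by rewrite scalerDr !scalerA mulrC.
Qed.

(** The counit on the first factor extracts the coefficients at [(mono1, n)]. They are coefficients
    of f along [dblS], an injection that is not surjective. *)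
Lemma counitl f : tlift (fun a b => counit a *: b) (coproduct f) = f.
Proof.
apply: lambda_ext => n.
have e t : (tlift (fun a b : Lambda => counit a *: b) t) n = two_sets t (mono1, n).
  apply: (@tensor_ext_lin rat Lambda Lambda rat^o
     (fun t => lval (tlift (fun a b : Lambda => counit a *: b) t) n)
     (fun t => two_sets t (mono1, n))) => [k u v|k u v|a b].
  - by rewrite (tlift_linear counitl_linear).
  - by rewrite two_sets_linear.
  - by rewrite tlift_tens ?two_sets_tens //; exact: counitl_linear.
rewrite e two_sets_coproduct /mpair (mrename1 dbl_inj) mono_mul1l (lambda_rename _ _ dblS_inj).
by rewrite /mpair_word ordered0 mulrA wsign_sq ?mul1r // map_inj_uniq ?ordered_uniq //; exact: dblS_inj.
Qed.

Lemma counitr f : tlift (fun a b => counit b *: a) (coproduct f) = f.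
Proof.
apply: lambda_ext => n.
have e t : (tlift (fun a b : Lambda => counit b *: a) t) n = two_sets t (n, mono1).
  apply: (@tensor_ext_lin rat Lambda Lambda rat^o
     (fun t => lval (tlift (fun a b : Lambda => counit b *: a) t) n)
     (fun t => two_sets t (n, mono1))) => [k u v|k u v|a b].
  - by rewrite (tlift_linear (bilin_flip counitl_linear)).
  - by rewrite two_sets_linear.
  - rewrite tlift_tens ?two_sets_tens; first exact: mulrC.
    exact: bilin_flip counitl_linear.
rewrite e two_sets_coproduct /mpair (mrename1 dblS_inj) mono_mulC mono_mul1l (lambda_rename _ _ dbl_inj).
rewrite /mpair_word ordered0 cats0 mulrA wsign_sq ?mul1r // map_inj_uniq ?ordered_uniq //; exact: dbl_inj.
Qed.

Lemma counit_mul f g : counit (f *L g) = counit f * counit g.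
Proof.
have [N w] := within_ex mono1.
rewrite /counit /= (series_mulE _ _ w).
have no u v : mono_mul u v = mono1 -> u = mono1 /\ v = mono1.
  move=> e; have := msupp_mono_mul u v; rewrite e {1}/msupp finsupp0 fsetU0 => /esym/eqP.
  by rewrite fsetU_eq0 => /andP[/eqP /msupp0 -> /eqP /msupp0 ->].
have i1 := within_monos w.
rewrite (bigD1_seq mono1) ?monos_uniq //= [X in _ + X]big1 ?addr0; last first.
  by move=> u ne; rewrite big1 // => v /eqP/no[e]; rewrite e eqxx in ne.
rewrite (eq_bigl (fun v => (v == mono1) && true)); last first.
  by move=> v; rewrite mono_mul1l andbT.
by rewrite big_uniq_pick ?monos_uniq // mono_sign1l mul1r.
Qed.

(** * Coassociativity *)

(** Elimination on the number of terms: if some functional is nonzero on the first f, the vanishing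
    of the sums expresses its partner g through the other second factors, and the first term is
    absorbed. General spaces are allowed because in [tmerge3_inj] one factor is itself a tensor
    product. *)
Lemma tens_separated (U V : lmodType rat) (X Y : Type)
    (eu : U -> X -> rat) (ev : V -> Y -> rat) (s : seq (U * V)) :
  (forall x, scalar (eu^~ x)) -> (forall y, scalar (ev^~ y)) ->
  (forall u, (forall x, eu u x = 0) -> u = 0) ->
  (forall v, (forall y, ev v y = 0) -> v = 0) ->
  (forall x y, \sum_(p <- s) eu p.1 x * ev p.2 y = 0) -> \sum_(p <- s) p.1 ⊗ p.2 = 0.
Proof.
move=> luE lvE su sv.
have lu x : linear (fun u => eu u x : rat^o) := luE x.
have lv y : linear (fun v => ev v y : rat^o) := lvE y.
have [k] := ubnP (size s); elim: k s => // k IH [|[f g] s] /=; first by rewrite big_nil.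
rewrite ltnS => sk H; rewrite big_cons /=.
have [[x0 fx0]|f0] := pselect (exists x, eu f x != 0); last first.
  have fx x : eu f x = 0 by apply/eqP/negPn/negP => nz; apply: f0; exists x.
  rewrite (su _ fx) (linear_at0 (tens_linl g)) add0r; apply: IH => // x y.
  by have := H x y; rewrite big_cons /= fx mul0r add0r.
pose c (p : U * V) := - (eu p.1 x0 / eu f x0).
have gE : g = \sum_(p <- s) c p *: p.2.
  apply/eqP; rewrite -subr_eq0; apply/eqP/sv => y.
  rewrite -scaleN1r addrC lvE mulN1r.
  have -> : ev (\sum_(p <- s) c p *: p.2) y = \sum_(p <- s) c p * ev p.2 y := lin_sum s c snd (lv y).
  apply: (mulfI fx0); rewrite mulr0 mulrDr mulrN mulr_sumr addrC -[RHS](H x0 y) big_cons /=.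
  congr (_ + _); rewrite -sumrN; apply: eq_bigr => p _; rewrite /c; field.
  exact: fx0.
have -> : f ⊗ g = \sum_(p <- s) (c p *: f) ⊗ p.2.
  rewrite gE (lin_sum s c snd (tens_linr f)); apply: eq_bigr => p _.
  by rewrite (lin_scale _ _ (tens_linl _)).
rewrite -big_split /=; under eq_bigr do rewrite -(lin_add (tens_linl _)).
have := IH [seq (c p *: f + p.1, p.2) | p <- s]; rewrite size_map big_map /=.
apply=> // x y; rewrite big_map /= -[RHS](H x y) big_cons /=.
have -> : ev g y = \sum_(p <- s) c p * ev p.2 y by rewrite {1}gE; exact: lin_sum s c snd (lv y).
rewrite mulr_sumr -big_split /=; apply: eq_bigr => p _; rewrite luE; ring.
Qed.

Definition tmerge3 : Lambda ⨂ (Lambda ⨂ Lambda) -> series :=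
  tlift (fun f t => rename dbl (lval f) ** rename dblS (tmerge t) : series).

Lemma tmerge3_bilin :
  bilin (fun (f : Lambda) t => rename dbl f ** rename dblS (tmerge t) : series).
Proof.
apply: (bilin_comp series_mul_bilin).
  exact: linear_comp (rename_linear dbl_inj) lval_linear.
exact: linear_comp (rename_linear dblS_inj) tmerge_linear.
Qed.

Lemma tmerge3_linear : linear tmerge3. Proof. exact: tlift_linear tmerge3_bilin. Qed.

Lemma tmerge3_tens f t : tmerge3 (f ⊗ t) = rename dbl f ** rename dblS (tmerge t).
Proof. exact: tlift_tens tmerge3_bilin. Qed.

Lemma tmerge3_inj : injective tmerge3.
Proof.
suff k0 t : tmerge3 t = 0 -> t = 0.
  move=> s t e; apply/eqP; rewrite -subr_eq0; apply/eqP/k0.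
  by rewrite -scaleN1r addrC tmerge3_linear e scaleN1r addNr.
move=> e; rewrite [t]tens_sum.
apply: (@tens_separated _ _ _ _ (fun (f : Lambda) m => f m) (fun s n => tmerge s n)).
- by [].
- by move=> n k u v; rewrite tmerge_linear.
- by move=> u H; apply: lambda_ext.
- by move=> v H; apply: tmerge_inj; rewrite (linear_at0 tmerge_linear); exact/funext.
move=> m n; have /(congr1 (fun g : series => g (mpair m n))) := e.
rewrite {1}[t]tens_sum.
have lE : linear (fun t => tmerge3 t (mpair m n) : rat^o).
  by move=> k u v; rewrite tmerge3_linear.
rewrite (lin_big _ _ lE); under eq_bigr do rewrite tmerge3_tens rename_dbl_mul.
by rewrite -mulr_sumr => /eqP; rewrite mulf_eq0 (negPf (_ : wsign _ != 0)) ?wsign_uniq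
  ?mpair_word_uniq // => /eqP.
Qed.

(* Matches the interlacing of ((x, y), z) with that of (x, (y, z)). *)
Definition reassoc (i : nat) := if odd i then i.*2.+1 else if odd i./2 then i.-1 else i./2.
Definition reassoc_inv (i : nat) :=
  if odd i then if odd i./2 then i./2 else i.+1 else i.*2.

Lemma reassocK : cancel reassoc reassoc_inv.
Proof.
move=> i; rewrite /reassoc; case oi: (odd i).
  by rewrite /reassoc_inv /= odd_double /= uphalf_double oi.
case oi2: (odd i./2); rewrite /reassoc_inv; last first.
  by rewrite oi2 -[RHS]odd_double_half oi.
have ei : i = i./2./2.*2.+1.*2.
  by rewrite -[i in LHS]odd_double_half oi -[i./2 in LHS]odd_double_half oi2.
move: (i./2./2) ei => j {oi oi2} ->.
have -> : (j.*2.+1.*2.-1 = j.*2.*2.+1)%N by lia.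
by rewrite /= odd_double /= uphalf_double odd_double.
Qed.

Lemma reassoc_invK : cancel reassoc_inv reassoc.
Proof.
move=> i; rewrite /reassoc_inv; case: ifP => oi; last first.
  by rewrite /reassoc odd_double doubleK oi.
case: ifP => oi2; rewrite /reassoc.
  by rewrite oi2 -[RHS]odd_double_half oi.
have -> : odd i.+1 = false by rewrite /= oi.
by rewrite /= uphalf_half oi add1n /= oi2.
Qed.

Lemma tmerge3_tassoc s c : tmerge3 (tassoc (s ⊗ c)) =
  rename reassoc (rename dbl (tmerge s) ** rename dblS c).
Proof.
have bR : bijective reassoc by exists reassoc_inv; [exact: reassocK|exact: reassoc_invK].
have rI := bij_inj bR; have dI := dbl_inj; have oI := dblS_inj.
have b3 (c' : Lambda) : bilin (fun a b : Lambda => a ⊗ (b ⊗ c')).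
  by split=> [b|a]; [exact: tens_linl | apply: linear_comp (tens_linr _) (tens_linl _)].
rewrite /tassoc tlift_tens; last first.
  split=> [c'|s']; first exact: tlift_linear.
  apply: (tlift_lin2 (F := fun a b c => a ⊗ (b ⊗ c))) => u v.
  exact: linear_comp (tens_linr _) (tens_linr _).
move: s; apply: tensor_ext_lin.
- move: (tlift_linear (b3 c)); exact: linear_comp tmerge3_linear.
- apply: linear_comp (rename_linear rI) _.
  apply: (linear_comp (series_mul_linl _)).
  exact: linear_comp (rename_linear dI) tmerge_linear.
move=> a b; rewrite tlift_tens // tmerge3_tens !tmerge_tens.
rewrite !(rename_mul dI) !(rename_mul oI) !(rename_mul rI).
rewrite !(rename_comp _ rI) // !(rename_comp _ (inj_comp rI dI)) //.
rewrite !(rename_comp _ oI) //.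
have E1 : (reassoc \o dbl) \o dbl =1 dbl.
  by move=> i; rewrite /= /reassoc /dbl odd_double doubleK odd_double.
have E2 : (reassoc \o dbl) \o dblS =1 dblS \o dbl.
  by move=> i; rewrite /= /reassoc /dbl /dblS odd_double doubleK /= odd_double.
have E3 : reassoc \o dblS =1 dblS \o dblS.
  by move=> i; rewrite /= /reassoc /dblS /= odd_double.
by rewrite series_mulA (eq_rename _ E1) (eq_rename _ E2) (eq_rename _ E3).
Qed.

(** Under [tmerge3] the right side becomes f, and the left side becomes f with its variables
    permuted by [reassoc], hence f again. *)
Lemma coproduct_coassoc f :
  tassoc (tlift (fun a b => coproduct a ⊗ b) (coproduct f)) =
  tlift (fun a b => a ⊗ coproduct b) (coproduct f).
Proof.
have bR : bijective reassoc by exists reassoc_inv; [exact: reassocK|exact: reassoc_invK].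
have bl : bilin (fun a b : Lambda => coproduct a ⊗ b).
  exact: (bilin_comp (@tens_bilin _ _ _) coproduct_linear (@id_linear _ _)).
have br : bilin (fun a b : Lambda => a ⊗ coproduct b).
  exact: (bilin_comp (@tens_bilin _ _ _) (@id_linear _ _) coproduct_linear).
have lA : linear (@tassoc rat Lambda).
  apply: tlift_linear; split=> [c'|s'].
    apply: tlift_linear; split=> [b|a]; first exact: tens_linl.
    exact: linear_comp (tens_linr _) (tens_linl _).
  apply: (tlift_lin2 (F := fun a b c => a ⊗ (b ⊗ c))) => u v.
  exact: linear_comp (tens_linr _) (tens_linr _).
apply: tmerge3_inj; transitivity (rename reassoc (tmerge (coproduct f))).
  move: (coproduct f); apply: tensor_ext_lin.
  - by apply: linear_comp tmerge3_linear (linear_comp lA (tlift_linear bl)).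
  - exact: linear_comp (rename_linear (bij_inj bR)) tmerge_linear.
  by move=> a b; rewrite tlift_tens // tmerge3_tassoc tmerge_coproduct tmerge_tens.
rewrite tmerge_coproduct (rename_lambda (bij_inj bR)) // -{1}(tmerge_coproduct f).
move: (coproduct f); apply: tensor_ext_lin; first exact: tmerge_linear.
  exact: linear_comp tmerge3_linear (tlift_linear br).
by move=> a b; rewrite tlift_tens // tmerge3_tens tmerge_coproduct tmerge_tens.
Qed.

Lemma Lambda_super_bialgebra :
  super_bialgebra Lambda_par Lambda_mul Lambda_one coproduct counit.
Proof.
split; [exact: Lambda_super_algebra| |split|split].
- split; [exact: coproduct_linear|exact: counit_linear|exact: coproduct_coassoc
         |exact: counitl|exact: counitr].
- exact: coproduct_mul.
- exact: coproduct_one.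
- exact: counit_mul.
- by rewrite -[RHS](counit_constant 1) scale1r.
Qed.

(** * Words in letters of either parity *)

Definition word_parity (s : seq nat) : bool := odd (count odd s).

Lemma word_parity_cons z s : word_parity (z :: s) = odd z (+) word_parity s.
Proof. by rewrite /word_parity /= oddD; case: (odd z). Qed.

Lemma word_parity_cat s t : word_parity (s ++ t) = word_parity s (+) word_parity t.
Proof. by rewrite /word_parity count_cat oddD. Qed.

Definition supersym (V : lmodType rat) (F : seq nat -> V) := forall s1 a b s2,
  F (s1 ++ a :: b :: s2) = (-1) ^+ (odd a && odd b) *: F (s1 ++ b :: a :: s2).

Lemma supersym_cons (V : lmodType rat) (F : seq nat -> V) x :
  supersym F -> supersym (fun s => F (x :: s)).
Proof. by move=> sF s1 a b s2; exact: (sF (x :: s1)). Qed.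

Lemma supersym_front (V : lmodType rat) (F : seq nat -> V) s1 x s2 : supersym F ->
  F (s1 ++ x :: s2) = (-1) ^+ (odd x && word_parity s1) *: F (x :: s1 ++ s2).
Proof.
elim: s1 F => [|z s1 IH] F sF; first by rewrite andbF scale1r.
rewrite cat_cons (IH _ (supersym_cons z sF)) (sF [::] z x) scalerA -signr_addb.
rewrite word_parity_cons; congr (_ ^+ _ *: _).
by case: (odd x); case: (odd z); case: (word_parity s1).
Qed.

Definition word_valid (s : seq nat) := uniq [seq z <- s | odd z].

Lemma word_valid_perm s t : perm_eq s t -> word_valid s = word_valid t.
Proof. by move=> st; apply: perm_uniq; apply: perm_filter. Qed.

(** The order of the quantifiers matters: one sign serves all spaces and all supersymmetric
    functions at once. *)
Lemma perm_sign s t : perm_eq s t -> exists e : bool,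
  forall (V : lmodType rat) (F : seq nat -> V), supersym F -> F t = (-1) ^+ e *: F s.
Proof.
elim: s t => [|x s IH] t.
  by rewrite perm_sym => /perm_nilP ->; exists false => V F _; rewrite scale1r.
move=> p; have xt : x \in t by rewrite -(perm_mem p) mem_head.
case/splitPr: t / xt p => t1 t2 p.
have /IH[e he] : perm_eq s (t1 ++ t2).
  by rewrite -(perm_cons x) (perm_trans p) // perm_catC /= perm_cons perm_catC.
exists ((odd x && word_parity t1) (+) e) => V F sF.
by rewrite supersym_front // (he _ _ (supersym_cons x sF)) scalerA signr_addb.
Qed.

(** Once two equal odd letters are adjacent, exchanging them gives F = -F, and 2 is invertible. *)
Lemma supersym_invalid (V : lmodType rat) (F : seq nat -> V) s :
  supersym F -> ~~ word_valid s -> F s = 0.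
Proof.
elim: s F => // x s IH F sF; rewrite /word_valid /=.
have [ox|ex] /= := boolP (odd x); last exact: (IH _ (supersym_cons x sF)).
rewrite negb_and negbK => /orP[|]; last exact: (IH _ (supersym_cons x sF)).
rewrite mem_filter ox /= => /perm_to_rem p.
have [e he] := perm_sign p; have := he _ _ (supersym_cons x sF).
have := sF [::] x x (rem x s); rewrite ox /= expr1 scaleN1r => /eqP.
rewrite -addr_eq0 -mulr2n -scaler_nat scaler_eq0 pnatr_eq0 /= => /eqP ->.
by move/eqP; rewrite eq_sym scaler_eq0 signr_eq0 /= => /eqP.
Qed.

(* Signed sum of G over the deletions of one letter x; x is moved out to the
   right, so that the sign is counted with the letters after it. *)
Fixpoint letter_der (x : nat) (G : seq nat -> rat) (s : seq nat) : rat :=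
  if s is z :: t then
    (if x == z then (-1) ^+ (odd x && word_parity t) * G t else 0) + letter_der x (fun u => G (z :: u)) t
  else 0.

Lemma letter_der_ext H x G s : G =1 H -> letter_der x G s = letter_der x H s.
Proof. by move=> /funext ->. Qed.

Lemma letter_der_lin x k G H s : letter_der x (fun u => k * G u + H u) s = k * letter_der x G s + letter_der x H s.
Proof.
elim: s G H => [|z t IH] G H /=; first by rewrite mulr0 addr0.
by rewrite IH; case: eqP => _; ring.
Qed.

Lemma letter_der_scale x k G s : letter_der x (fun u => k * G u) s = k * letter_der x G s.
Proof.
have := letter_der_lin x k G (fun=> 0) s; have : letter_der x (fun=> 0) s = 0.
  by elim: s => //= z t ->; case: eqP; rewrite ?mulr0 addr0.
by move=> ->; rewrite addr0 => <-; apply: letter_der_ext => u; rewrite addr0.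
Qed.

Lemma letter_der_cat x G s1 s2 : letter_der x G (s1 ++ s2) =
  (-1) ^+ (odd x && word_parity s2) * letter_der x (fun s => G (s ++ s2)) s1 + letter_der x (fun s => G (s1 ++ s)) s2.
Proof.
elim: s1 G => [|z s1 IH] G /=; first by rewrite mulr0 add0r.
rewrite IH /=; case: eqP => _; last by ring.
rewrite word_parity_cat andb_addr signr_addb; ring.
Qed.

Lemma letter_der_neq0 x G s : letter_der x G s != 0 -> exists s1 s2, s = s1 ++ x :: s2 /\ G (s1 ++ s2) != 0.
Proof.
elim: s G => [|z t IH] G //=.
have [/IH[s1 [s2 [-> nz]]] _|] := boolP (letter_der x (fun u => G (z :: u)) t != 0).
  by exists (z :: s1), s2.
rewrite negbK => /eqP ->; rewrite addr0; case: (x =P z) => [<-|_]; last by rewrite eqxx.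
by rewrite mulf_eq0 negb_or => /andP[_ nz]; exists [::], t.
Qed.

Lemma letter_der_notin x G s : x \notin s -> letter_der x G s = 0.
Proof.
move=> xs; apply/eqP; apply: contraNT xs => /letter_der_neq0[s1 [s2 [-> _]]].
by rewrite mem_cat mem_head orbT.
Qed.

Lemma letter_der_supersym x G : supersym (G : seq nat -> rat^o) -> supersym (letter_der x G : seq nat -> rat^o).
Proof.
move=> sG s1; elim: s1 G sG => [|z s1 IH] G sG a b s2.
  rewrite -[RHS]/(_ * _) /= (@letter_der_ext (fun u => (-1) ^+ (odd a && odd b) * G [:: b, a & u])); last first.
    by move=> u; exact: (sG [::] a b u).
  rewrite letter_der_scale !word_parity_cons.
  case: (eqVneq x a) => [<-|_]; case: (eqVneq x b) => [e|_]; rewrite -?e; 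
   case: (odd x); case: (odd a); case: (odd b); case: (word_parity s2); rewrite /= ?expr1 ?expr0; ring.
rewrite -[RHS]/(_ * _) /= (IH _ (supersym_cons z sG)) -[X in _ + X]/(_ * _).
have := sG s1 a b s2 => /= e; rewrite !word_parity_cat !word_parity_cons (addbCA (odd a)).
by case: eqP => _; rewrite ?e -?[X in _ * X + _]/(_ * _) ; ring.
Qed.

(** All words obtained by deleting x have the same parity, that of s corrected by that of x, so the
    twist factors out. *)
Lemma letter_der_twist x (c : bool) G s :
  letter_der x (fun u => (-1) ^+ (c && word_parity u) * G u) s =
  (-1) ^+ (c && (odd x (+) word_parity s)) * letter_der x G s.
Proof.
elim: s G => [|z t IH] G /=; first by rewrite mulr0.
rewrite (@letter_der_ext (fun u => (-1) ^+ (c && odd z) * ((-1) ^+ (c && word_parity u) * G (z :: u)))).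
  rewrite letter_der_scale IH word_parity_cons; case: eqP => [->|_].
    by case: (c); case: (odd z); case: (word_parity t); rewrite /= ?expr1 ?expr0; ring.
  by case: (c); case: (odd x); case: (odd z); case: (word_parity t); rewrite /= ?expr1 ?expr0; ring.
by move=> u; rewrite word_parity_cons; case: (c); case: (odd z); case: (word_parity u);
  rewrite /= ?expr1 ?expr0; ring.
Qed.

(** This gives the supersymmetry of [word_pair] in its first word, whose letters act as successive
    deletions. *)
Lemma letter_der_comm x y G s :
  letter_der x (letter_der y G) s = (-1) ^+ (odd x && odd y) * letter_der y (letter_der x G) s.
Proof.
elim: s G => [|z t IH] G /=; first by rewrite mulr0.
have E u v H : letter_der u (fun t' => (if v == z then (-1) ^+ (odd v && word_parity t') * H t' else 0) +
     letter_der v (fun t'' => H (z :: t'')) t') t =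
   (if v == z then (-1) ^+ (odd v && (odd u (+) word_parity t)) * letter_der u H t else 0) +
     letter_der u (letter_der v (fun t'' => H (z :: t''))) t.
  pose k : rat := if v == z then 1 else 0.
  rewrite (@letter_der_ext (fun t' => k * ((-1) ^+ (odd v && word_parity t') * H t') +
     letter_der v (fun t'' => H (z :: t'')) t')).
    by rewrite letter_der_lin letter_der_twist /k; case: eqP => _; rewrite ?mul1r ?mul0r.
  by move=> t'; rewrite /k; case: eqP => _; rewrite ?mul1r ?mul0r.
rewrite (E x y G) (E y x G) IH !mulrDr !addrA; congr (_ + _).
rewrite addrC; congr (_ + _); case: eqP => _; rewrite ?mulr0 // mulrA -signr_addb;
  congr (_ ^+ _ * _); by case: (odd x); case: (odd y); case: (word_parity t).
Qed.

(* The Gram matrix of the products of power sums: a permanent in the even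
   letters times a determinant in the odd ones. *)
Fixpoint word_pair (t s : seq nat) : rat :=
  if t is x :: t' then letter_der x (word_pair t') s else (s == [::])%:R.

Lemma word_pair_perm t s : word_pair t s != 0 -> perm_eq t s.
Proof.
elim: t s => [|x t IH] s /=; first by case: (s =P [::]) => [->|_]; rewrite ?eqxx.
case/letter_der_neq0 => s1 [s2 [-> /IH p]].
by rewrite perm_sym perm_catC /= perm_cons perm_catC perm_sym.
Qed.

Lemma word_pair_supersymr t : supersym (word_pair t : seq nat -> rat^o).
Proof.
elim: t => [|x t IH] /=; last exact: letter_der_supersym.
by move=> [|z s1] a b s2 /=; rewrite scaler0.
Qed.

Lemma word_pair_supersyml s : supersym (fun t => word_pair t s : rat^o).
Proof.
move=> t1 a b t2; elim: t1 s => [|x t1 IH] s /=; first exact: letter_der_comm.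
by rewrite -[RHS]/(_ * _) -letter_der_scale; apply: letter_der_ext => u; exact: IH.
Qed.

Lemma word_pairC t s : word_pair t s = word_pair s t.
Proof.
have [p|np] := boolP (perm_eq s t); last first.
  have z u v : ~~ perm_eq u v -> word_pair u v = 0.
    by move=> n; apply/eqP; apply: contraNT n; exact: word_pair_perm.
  by rewrite !z // perm_sym.
have [e he] := perm_sign p.
have := he _ _ (word_pair_supersyml s); have := he _ _ (word_pair_supersymr s).
by move=> -> ->.
Qed.

Lemma supersym_even_front (V : lmodType rat) (G : seq nat -> V) x t :
  ~~ odd x -> x \in t -> supersym G -> G (x :: rem x t) = G t.
Proof.
move=> ex; elim: t G => // z t IH G; rewrite inE eq_sym /= => xt sG.
case: eqP xt => [->|_] //= xt.
by rewrite (sG [::] x z) (negPf ex) scale1r; exact: (IH _ xt (supersym_cons z sG)).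
Qed.

Lemma letter_der_even x G s : ~~ odd x -> supersym (G : seq nat -> rat^o) ->
  letter_der x G s = (count_mem x s)%:R * G (rem x s).
Proof.
move=> ex; elim: s G => [|z t IH] G sG /=; first by rewrite mul0r.
rewrite (IH _ (supersym_cons z sG)) (negPf ex) expr0 mul1r eq_sym.
case: eqP => [->|_] /=; last by rewrite add0r.
rewrite natrD mulrDl mul1r; congr (_ + _).
have [xt|nt] := boolP (x \in t); last by rewrite (count_memPn nt) !mul0r.
by rewrite (supersym_even_front ex xt sG).
Qed.

(** Up to sign this is the product of the factorials of the multiplicities of the even letters; an
    odd letter occurs once and contributes a sign. *)
Lemma word_pair_self s : word_valid s -> word_pair s s != 0.
Proof.
elim: s => [//|x s IH]; rewrite /word_valid /=.
have [ox|ex] : odd x \/ ~~ odd x by case: (odd x); [left|right].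
  rewrite ox => /= /andP[xs us].
  rewrite eqxx [X in _ + X]letter_der_notin ?addr0 ?mulf_neq0 ?signr_eq0 ?IH //.
  by rewrite mem_filter ox in xs.
rewrite (negPf ex) -{1}(negPf ex) => us.
rewrite -[X in X != 0]/(letter_der x (word_pair s) (x :: s)) (letter_der_even _ ex (word_pair_supersymr s)) /= eqxx.
by rewrite mulf_neq0 ?IH // pnatr_eq0.
Qed.

(** * Power sums *)

(* The letter z encodes a factor x^r with r = z/2 + 1 when z is even and th x^s
   with s = z/2 when z is odd; power_sum z is accordingly p_r or the fermionic
   power sum of degree s. *)
Definition letter_exp (z : nat) := if odd z then z./2 else z./2.+1.

Lemma letter_exp_inj y z : odd y = odd z -> letter_exp y = letter_exp z -> y = z.
Proof.
rewrite /letter_exp => o; rewrite -[y]odd_double_half -[z]odd_double_half o !oddD !oddb !odd_double.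
rewrite !addbF !halfD !oddb !odd_double !andbF !doubleK.
by case: (odd z) => /= [|[]]; rewrite ?add0n => ->.
Qed.

Definition letter (z j : nat) : smono :=
  ([fsfun i in [fset j] => letter_exp z], if odd z then [fset j] else fset0).

Lemma letterE z j i : (letter z j).1 i = if i == j then letter_exp z else 0%N.
Proof. by rewrite fsfunE inE. Qed.

Lemma letterS z j i : (i \in (letter z j).2) = (i == j) && odd z.
Proof. by rewrite /=; case: (odd z); rewrite inE ?andbT ?andbF. Qed.

(** The shift in the even case of [letter_exp] is made for this: every letter really involves its
    variable, though an odd letter may have exponent 0. *)
Lemma letter_exp_gt0 z : (letter_exp z != 0%N) || odd z.
Proof. by rewrite /letter_exp; case: (odd z); rewrite ?orbT. Qed.

Lemma msuppE (m : smono) i : (i \in msupp m) = (m.1 i != 0%N) || (i \in m.2).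
Proof. by rewrite inE mem_finsupp. Qed.

Lemma msupp_letter z j : msupp (letter z j) = [fset j].
Proof.
apply/fsetP => i; rewrite msuppE letterE letterS inE.
by case: (i =P j) => //= _; rewrite letter_exp_gt0.
Qed.

Lemma edeg_letter z j : edeg (letter z j).1 = letter_exp z.
Proof.
have sub : finsupp (letter z j).1 `<=` [fset j].
  by rewrite -(msupp_letter z j) fsubsetUl.
by rewrite -(edeg_incl sub) big_seq_fset1 letterE eqxx.
Qed.

Lemma letter_inj z : injective (letter z).
Proof.
by move=> i j /(congr1 msupp); rewrite !msupp_letter => /fsetP/(_ i); rewrite !inE eqxx => /esym/eqP.
Qed.

Lemma smono_ext (m n : smono) : (forall i, m.1 i = n.1 i) ->
  (forall i, (i \in m.2) = (i \in n.2)) -> m = n.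
Proof.
by case: m n => a I [b J] /= h1 h2; congr pair; [exact/fsfunP|exact/fsetP].
Qed.

Lemma mrename_letter h z j : injective h -> mrename h (letter z j) = letter z (h j).
Proof.
move=> hI; apply: smono_ext => i.
  have [[k ->]|no] := im_or h i.
    by rewrite (erename_in hI) !letterE (inj_eq hI).
  by rewrite erename_out // letterE eq_sym (negPf (no j)).
rewrite letterS /=; case: (odd z); rewrite ?imfset0 ?inE ?andbF ?andbT //.
apply/imfsetP/eqP => [[/= k]|->]; first by rewrite inE => /eqP ->.
by exists j => //=; rewrite inE.
Qed.

Definition gen_series (z : nat) : series := fun m => (`[< exists j, m = letter z j >])%:R.

Lemma gen_series_letter z j : gen_series z (letter z j) = 1.
Proof. by rewrite /gen_series asboolT //; exists j. Qed.

Lemma gen_series_neq0 z m : gen_series z m != 0 -> exists j, m = letter z j.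
Proof. by rewrite /gen_series; case: asboolP => // _; rewrite eqxx. Qed.

Lemma gen_series_out z m : (forall j, m <> letter z j) -> gen_series z m = 0.
Proof. by move=> no; rewrite /gen_series asboolF // => -[j]; exact: no. Qed.

Lemma wsign_map_letter h z j : wsign (map h (ordered (letter z j).2)) = 1.
Proof.
rewrite /=; case: (odd z); last by rewrite ordered0.
have : perm_eq (ordered [fset j]) [:: j].
  apply: ordered_perm => //; apply/fsetP => i; rewrite in_fset !inE.
  by rewrite orbF.
by move/perm_small_eq => ->.
Qed.

Lemma rename_gen_series h z n : injective h -> rename h (gen_series z) n = (`[< exists j, n = letter z (h j) >])%:R.
Proof.
move=> hI; have [[j ->]|no] := pselect (exists j, n = letter z (h j)).
  rewrite -(mrename_letter z j hI) rename_in // wsign_map_letter gen_series_letter mulr1 asboolT //.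
  by exists j; rewrite mrename_letter.
rewrite asboolF //; apply/eqP; apply/negPn/negP => /(rename_neq0 hI)[m e /gen_series_neq0[j ej]].
by apply: no; exists j; rewrite e ej mrename_letter.
Qed.

Lemma gen_series_proof z : gen_series z \in sym_super.
Proof.
apply/asboolP; split.
  exists (mdeg (letter z 0)) => m /gen_series_neq0[j ->]; rewrite /mdeg /=.
  by rewrite -!/(edeg _) !edeg_letter; case: (odd z); rewrite ?cardfs1.
move=> sigma a b I bs ab; have sI := bij_inj bs; have [tau st ts] := bs.
rewrite wcoef_ordered /wcoef fset_map fset_ordered.
have -> : (b, sigma @` I) = mrename sigma (a, I).
  congr pair; apply: eq_erename => // j _; by exists (tau j); rewrite ts.
have e : rename sigma (gen_series z) = gen_series z.
  apply/funext => n; rewrite rename_gen_series // /gen_series; congr (_%:R); congr nat_of_bool.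
  apply: asbool_equiv_eq; split=> -[j ->]; first by exists (sigma j).
  by exists (tau j); rewrite ts.
rewrite -{1}e rename_in // mulrA wsign_sq ?mul1r // map_inj_uniq ?ordered_uniq //.
Qed.

Definition power_sum z : Lambda := MkLambda (gen_series_proof z).

(** In interlaced variables, the sum over all variables splits into the even and the odd ones. *)
Lemma coproduct_power_sum z : coproduct (power_sum z) = power_sum z ⊗ Lambda_one + Lambda_one ⊗ power_sum z.
Proof.
apply: coproductP; rewrite (lin_add tmerge_linear) !tmerge_tens /=.
rewrite (rename1 dbl_inj) (rename1 dblS_inj) series_mul1m series_mulm1.
apply/funext => n; rewrite -[LHS]/(rename dbl (gen_series z) n + rename dblS (gen_series z) n).
rewrite !rename_gen_series; [|exact: dblS_inj|exact: dbl_inj].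
have [[j ->]|no] := pselect (exists j, n = letter z j); last first.
  rewrite !asboolF ?addr0; last 2 first.
  - by case=> j e; apply: no; exists (dblS j).
  - by case=> j e; apply: no; exists (dbl j).
  by rewrite gen_series_out // => j e; apply: no; exists j.
rewrite gen_series_letter; have [[i ->]|[i ->]] := even_or_odd j.
  rewrite asboolT; last by exists i.
  rewrite asboolF ?addr0 // => -[k /letter_inj e]; by have := dbl_dblS i k; rewrite e eqxx.
rewrite asboolF; last by case=> k /letter_inj e; have := dblS_dbl i k; rewrite e eqxx.
by rewrite asboolT ?add0r //; exists i.
Qed.

Lemma power_sum_parity z : par (odd z) (power_sum z).
Proof.
apply/parity_homog => m /gen_series_neq0[j ->] /=.
by case: (odd z); rewrite ?cardfs1 ?cardfs0.
Qed.

Definition power_product (t : seq nat) : Lambda := foldr (fun z f => power_sum z *L f) Lambda_one t.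

Lemma power_product_cat s t : power_product (s ++ t) = power_product s *L power_product t.
Proof.
elim: s => [|z s IH] /=; first by rewrite Lambda_mul1l.
by rewrite IH Lambda_mulA.
Qed.

Lemma power_product_parity t : par (word_parity t) (power_product t).
Proof.
elim: t => [|z t IH]; first exact: parity_one.
by rewrite word_parity_cons; apply: parity_mul IH; exact: power_sum_parity.
Qed.

Lemma power_product_supersym : supersym power_product.
Proof.
move=> s1 a b s2; rewrite !power_product_cat /= !Lambda_mulA.
rewrite -[power_product s1 *L _ *L power_sum b]Lambda_mulA (Lambda_mulC (power_sum_parity a) (power_sum_parity b)).
rewrite (lin_scale _ _ (Lambda_mul_bilin.2 _)) (lin_scale _ _ (Lambda_mul_bilin.1 _)).
by rewrite !Lambda_mulA.
Qed.

Lemma card_msupp_letter z j v : (#|` msupp (mono_mul (letter z j) v)| <= #|` msupp v|.+1)%N.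
Proof.
rewrite msupp_mono_mul msupp_letter cardfsU cardfs1 add1n; exact: leq_subr.
Qed.

Lemma power_product_msupp t n : power_product t n != 0 -> (#|` msupp n| <= size t)%N.
Proof.
elim: t n => [|z t IH] n /=.
  rewrite /series_one; case: (n =P mono1) => [-> _|_]; last by rewrite eqxx.
  by rewrite /msupp finsupp0 fsetU0 cardfs0.
case/series_mul_neq0 => u [v [<- /gen_series_neq0[j ->] /IH]].
move=> h; exact: leq_trans (card_msupp_letter _ _ _) _.
Qed.

(** * Triangularity and the basis of power sum products *)

(* The first letter goes to the variable of largest index, so that prepending a
   letter leaves the other ones in place. *)
Fixpoint word_mono (k : nat) (s : seq nat) : smono :=
  if s is z :: t then mono_mul (letter z (k + size t)) (word_mono k t) else mono1.
Local Notation wmono := (word_mono 0).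

Lemma word_mono_cat k s t : word_mono k (s ++ t) = mono_mul (word_mono (k + size t) s) (word_mono k t).
Proof.
elim: s => [|z s IH] /=; first by rewrite mono_mul1l.
by rewrite IH mono_mulA size_cat -addnA [(size t + _)%N]addnC.
Qed.

Lemma msupp1 : msupp mono1 = fset0.
Proof. by rewrite /msupp finsupp0 fsetU0. Qed.

Lemma msupp_word_mono k s i : (i \in msupp (word_mono k s)) = (k <= i < k + size s)%N.
Proof.
elim: s => [|z s IH] /=.
  by rewrite msupp1 inE addn0; case: leqP => // ?; rewrite ltnNge ltnW.
rewrite msupp_mono_mul msupp_letter in_fsetU in_fset1 IH; lia.
Qed.

Lemma card_msupp_word_mono k s : #|` msupp (word_mono k s)| = size s.
Proof.
have -> : msupp (word_mono k s) = [fset i in iota k (size s)].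
  by apply/fsetP => i; rewrite msupp_word_mono in_fset mem_iota.
by rewrite card_fseq undup_id ?size_iota ?iota_uniq.
Qed.

Lemma word_mono_word_parity k s : odd #|` (word_mono k s).2| = word_parity s.
Proof.
elim: s => [|z s IH]; first by rewrite cardfs0.
rewrite word_parity_cons -IH /=; case: (boolP (odd z)) => oz; last by rewrite fset0U.
have ni : (k + size s)%N \notin (word_mono k s).2.
  apply/negP => h; have : (k + size s)%N \in msupp (word_mono k s) by rewrite inE h orbT.
  by rewrite msupp_word_mono ltnn andbF.
by rewrite cardfsU1 ni oddD.
Qed.

Lemma mrename_word_mono h k k' s : injective h ->
  (forall i, (i < size s)%N -> h (k + i)%N = (k' + i)%N) -> mrename h (word_mono k s) = word_mono k' s.
Proof.
move=> hI; elim: s => [|z s IH] hk /=; first by rewrite mrename1.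
rewrite mrename_mono_mul // mrename_letter // hk //= IH // => i /ltnW le; exact: hk.
Qed.

Lemma wsign_map_homo h I : {homo h : i j / (i < j)%N} -> wsign (map h (ordered I)) = 1.
Proof.
move=> hh; apply: wsign_sorted.
  rewrite map_inj_uniq ?ordered_uniq // => i j e.
  by case: (ltngtP i j) => // /hh; rewrite e ltnn.
apply: (homo_sorted (e := leq)); last exact: ordered_sorted.
by move=> i j; rewrite leq_eqVlt => /predU1P[->|/hh/ltnW].
Qed.

(** Deleting a letter leaves a gap at index [size s2]; closing it is an increasing renaming, which
    costs no sign. *)
Lemma lambda_skip (f : Lambda) s1 s2 :
  f (mono_mul (word_mono (size s2).+1 s1) (wmono s2)) = f (wmono (s1 ++ s2)).
Proof.
pose h := bump (size s2).
have hI : injective h by exact: (can_inj (bumpK _)).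
have -> : mono_mul (word_mono (size s2).+1 s1) (wmono s2) = mrename h (wmono (s1 ++ s2)).
  rewrite word_mono_cat mrename_mono_mul //; congr mono_mul; apply/esym/mrename_word_mono => // i le.
    by rewrite /h /bump add0n leq_addr addSn.
  by rewrite /h /bump !add0n leqNgt le.
rewrite lambda_rename // wsign_map_homo ?mul1r // => i j ij.
by rewrite /h /bump; lia.
Qed.

Lemma card_msupp_rest (s1 s2 : seq nat) :
  #|` msupp (mono_mul (word_mono (size s2).+1 s1) (wmono s2))| = (size s1 + size s2)%N.
Proof.
have hI : injective (bump (size s2)) by exact: (can_inj (bumpK _)).
transitivity (#|` bump (size s2) @` msupp (wmono (s1 ++ s2))|); last first.
  by rewrite card_imfset // card_msupp_word_mono size_cat.
congr (#|` _|); apply/fsetP => i; rewrite msupp_mono_mul in_fsetU !msupp_word_mono add0n.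
apply/idP/imfsetP => [h|[/= j]].
  exists (unbump (size s2) i); rewrite /= ?msupp_word_mono ?size_cat /unbump /bump; lia.
by rewrite msupp_word_mono size_cat => h ->; rewrite /bump; lia.
Qed.

Lemma letter_der_sum x G s : letter_der x G s = \sum_(0 <= i < size s | x == nth 0%N s i)
  (-1) ^+ (odd x && word_parity (drop i.+1 s)) * G (take i s ++ drop i.+1 s).
Proof.
elim: s G => [|z t IH] G /=; first by rewrite big_geq.
rewrite IH [RHS]big_mkcond big_nat_recl //= drop0; congr (_ + _).
by rewrite big_mkcond.
Qed.

Lemma letter_der_eq_size x G H s : (forall u, (size u).+1 = size s -> G u = H u) ->
  letter_der x G s = letter_der x H s.
Proof.
move=> e; rewrite !letter_der_sum big_nat_cond [RHS]big_nat_cond; apply: eq_bigr => i /andP[/andP[_ il] _].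
rewrite e // size_cat size_takel ?size_drop; [lia|exact: ltnW].
Qed.

(** Letters of s1 sit at larger indices and those of s2 at smaller ones, so an odd letter is moved
    past the odd letters of s2 only. This is the sign in [letter_der]. *)
Lemma mono_sign_letter y s1 s2 :
  mono_sign (letter y (size s2)) (mono_mul (word_mono (size s2).+1 s1) (wmono s2)) = (-1) ^+ (odd y && word_parity s2).
Proof.
rewrite /mono_sign [(letter _ _).2]/=; case: (odd y); last by rewrite ordered0 wsign_ordered.
set A := word_mono _ s1; set B := wmono s2.
have -> : ordered [fset size s2] = [:: size s2].
  apply: perm_small_eq => //; apply: ordered_perm => //.
  by apply/fsetP => i; rewrite in_fset !inE orbF.
have hA i : i \in A.2 -> (size s2 < i)%N.
  by move=> h; have : i \in msupp A; [rewrite inE h orbT | rewrite msupp_word_mono => /andP[]].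
have hB i : i \in B.2 -> (i < size s2)%N.
  by move=> h; have : i \in msupp B; [rewrite inE h orbT | rewrite msupp_word_mono => /andP[]].
rewrite /= mem_ordered inE; case: ifP => [/orP[/hA|/hB]|_]; rewrite ?ltnn //.
rewrite wsign_ordered mulr1 -signr_odd; congr (_ ^+ _).
have -> : count (fun j => (j < size s2)%N) (ordered (A.2 `|` B.2)) = #|` B.2|.
  have p : perm_eq (ordered (A.2 `|` B.2)) (ordered A.2 ++ ordered B.2).
    apply: ordered_perm; last by rewrite fset_wcat !fset_ordered.
    rewrite cat_uniq !ordered_uniq andbT /=; apply/hasPn => i; rewrite !mem_ordered => /hB iB.
    by apply/negP => /hA; rewrite ltnNge ltnW.
  rewrite (permP p) count_cat -size_ordered (@eq_in_count _ _ pred0) ?count_pred0; last first.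
    by move=> i; rewrite mem_ordered => /hA; rewrite ltnNge => /negbTE /= h; rewrite ltnNge ltnW // ltnNge h.
  by apply/eqP; rewrite -all_count; apply/allP => i; rewrite mem_ordered => /hB.
by rewrite word_mono_word_parity.
Qed.

Lemma wmono_split s1 z s2 : wmono (s1 ++ z :: s2) =
  mono_mul (letter z (size s2)) (mono_mul (word_mono (size s2).+1 s1) (wmono s2)).
Proof. by rewrite word_mono_cat /= !mono_mulA [mono_mul (word_mono _ _) _]mono_mulC. Qed.

Lemma letter_cancel y z j u v : mono_mul (letter y j) u = mono_mul (letter z j) v ->
  j \notin msupp u -> j \notin msupp v -> y = z /\ u = v.
Proof.
rewrite !msuppE !negb_or !negbK => e /andP[/eqP u1 u2] /andP[/eqP v1 v2].
have e1 i : ((letter y j).1 i + u.1 i = (letter z j).1 i + v.1 i)%N.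
  by rewrite -!expo_addE -[expo_add _ _]/(mono_mul (letter y j) u).1 e.
have e2 i : (i \in (letter y j).2) || (i \in u.2) = (i \in (letter z j).2) || (i \in v.2).
  by rewrite -!in_fsetU -[_ `|` _]/(mono_mul (letter y j) u).2 e.
split.
  have := e1 j; have := e2 j; rewrite !letterE !letterS !eqxx u1 v1 (negPf u2) (negPf v2) /= !orbF !addn0.
  exact: letter_exp_inj.
apply: smono_ext => i; have [->|ne] := eqVneq i j.
- by rewrite u1 v1.
- by have := e1 i; rewrite !letterE (negPf ne).
- by rewrite (negPf u2) (negPf v2).
- by have := e2 i; rewrite !letterS (negPf ne).
Qed.

(* On monomials with as many variables as s has letters, multiplication by a power
   sum cannot merge its letter with another one: it only inserts it. *)
Lemma power_sum_mul_top y (f : Lambda) s :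
  (forall n, f n != 0 -> (#|` msupp n| < size s)%N) ->
  (power_sum y *L f) (wmono s) = letter_der y (fun u => f (wmono u)) s.
Proof.
move=> hf; pose k i := size (drop i.+1 s).
pose p i : smono * smono :=
  (letter y (k i), mono_mul (word_mono (k i).+1 (take i s)) (wmono (drop i.+1 s))).
have sE i : (i < size s)%N -> s = take i s ++ nth 0%N s i :: drop i.+1 s.
  by move=> il; rewrite -drop_nth // cat_take_drop.
have nE i : (i < size s)%N -> wmono s = mono_mul (letter (nth 0%N s i) (k i)) (p i).2.
  by move=> il; rewrite [in LHS](sE _ il) wmono_split.
pose r := [seq p i | i <- [seq i <- iota 0 (size s) | y == nth 0%N s i]].
have kI i j : (i < size s)%N -> (j < size s)%N -> k i = k j -> i = j.
  by rewrite /k !size_drop; lia.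
rewrite [LHS]/= /series_mul (fsbigE r).
- rewrite letter_der_sum big_map big_filter_cond /index_iota subn0 big_seq_cond [RHS]big_seq_cond.
  apply: eq_big => [i|i /andP[]].
    rewrite mem_iota add0n /=; case: (ltnP i (size s)) => //= il.
    case: eqP => //= e; apply/mem_set/factorizationsP.
    by rewrite (nE _ il) -e.
  rewrite mem_iota add0n => /andP[_ il] /andP[/eqP e _].
  rewrite -[wsign _]/(mono_sign (p i).1 (p i).2) /p /= mono_sign_letter gen_series_letter mul1r.
  by rewrite lambda_skip.
- rewrite map_inj_in_uniq ?filter_uniq ?iota_uniq // => i j.
  rewrite !mem_filter !mem_iota !add0n => /andP[_ /andP[_ il]] /andP[_ /andP[_ jl]].
  by move=> /(congr1 fst) /letter_inj; exact: kI.
- move=> q /mapP[i]; rewrite mem_filter mem_iota add0n => /andP[/eqP e /andP[_ il]] ->.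
  by apply/factorizationsP; rewrite (nE _ il) -e.
move=> [u v] /factorizationsP /= e; apply: contraNeq.
rewrite !mulf_eq0 !negb_or => /and3P[_ /gen_series_neq0[j eu] /hf lv]; subst u.
have js : (j < size s)%N.
  have : j \in msupp (wmono s) by rewrite -e msupp_mono_mul msupp_letter !inE eqxx.
  by rewrite msupp_word_mono.
(* Positions in the word run opposite to the indices of the variables. *)
pose i := (size s - j.+1)%N; have il : (i < size s)%N by rewrite /i; lia.
have ki : k i = j by rewrite /k size_drop /i; lia.
pose R := mono_mul (word_mono j.+1 (take i s)) (wmono (drop i.+1 s)).
have eR : wmono s = mono_mul (letter (nth 0%N s i) j) R.
  by rewrite (nE _ il) ki /p ki.
have jR : j \notin msupp R.
  by rewrite msupp_mono_mul in_fsetU !msupp_word_mono ltnn /= add0n -/(k i) ki ltnn.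
have cR : #|` msupp R| = (size s).-1.
  rewrite /R -{1}ki card_msupp_rest -size_cat; have := congr1 size (sE _ il).
  by rewrite !size_cat /= addnS => ->.
(* v contains every variable other than j, and it has fewer than [size s] of them because f is
   nonzero there, so j cannot occur in it. *)
have sub : msupp R `<=` msupp v.
  apply/fsubsetP => x xR; have : x \in msupp (wmono s) by rewrite eR msupp_mono_mul in_fsetU xR orbT.
  rewrite -e msupp_mono_mul msupp_letter in_fsetU in_fset1 => /orP[/eqP xj|//].
  by rewrite -xj xR in jR.
have jv : j \notin msupp v.
  have /eqP <- // : msupp R == msupp v.
  rewrite eqEfcard sub cR /=. by rewrite -ltnS prednK ?lv //; exact: leq_ltn_trans il.
have [yz vR] := letter_cancel (etrans e eR) jv jR.
apply/mapP; exists i; first by rewrite mem_filter mem_iota add0n il yz eqxx.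
by rewrite /p ki vR.
Qed.

Lemma power_product_wmono t s : (size t <= size s)%N -> power_product t (wmono s) = word_pair t s.
Proof.
elim: t s => [|y t IH] s /=.
  move=> _; rewrite /series_one; congr (nat_of_bool _)%:R.
  apply/eqP/eqP => [/(congr1 msupp)|->] //.
  by move/(congr1 (fun I : {fset nat} => #|` I|)); rewrite card_msupp_word_mono msupp1 cardfs0 => /size0nil.
move=> st; rewrite -[LHS]/((power_sum y *L power_product t) (wmono s)) power_sum_mul_top; last first.
  by move=> n /power_product_msupp h; apply: leq_ltn_trans h _.
by apply: letter_der_eq_size => u us; apply: IH; rewrite -ltnS us.
Qed.

Definition adj_swap (k i : nat) := if i == k then k.+1 else if i == k.+1 then k else i.

Lemma adj_swapK k : involutive (adj_swap k).
Proof. by move=> i; rewrite /adj_swap; do ?case: eqP => //=; lia. Qed.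

Lemma in_word_monoS k s i : i \in (word_mono k s).2 -> (k <= i < k + size s)%N.
Proof. by move=> h; rewrite -msupp_word_mono inE h orbT. Qed.

(** The booleans tell whether variables k+1 and k are present. No index lies between them, so both
    cross r with the same sign; these signs cancel and only the mutual crossing of the two variables
    remains. *)
Lemma wsign_adj_swap k (a b : bool) (r : seq nat) : k \notin r -> k.+1 \notin r ->
  uniq r -> let t := nseq a k.+1 ++ nseq b k ++ r in
  wsign t * wsign (map (adj_swap k) t) = (-1) ^+ (a && b).
Proof.
move=> kr kr1 ur; have mr : map (adj_swap k) r = r.
  rewrite -[RHS]map_id; apply/eq_in_map => i ir; rewrite /adj_swap.
  by case: eqP ir => [->|_ ir]; [rewrite (negPf kr)|case: eqP ir => [->|]; rewrite ?(negPf kr1)].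
have PQ : \prod_(j <- r) sg k.+1 j = \prod_(j <- r) sg k j.
  apply: eq_big_seq => i ir; rewrite /sg.
  have -> : (k.+1 == i) = false by apply: contraNF kr1 => /eqP ->.
  have nk : (k == i) = false by apply: contraNF kr => /eqP ->.
  by rewrite nk ltnS leq_eqVlt eq_sym nk.
have w2 : wsign r * wsign r = 1 by exact: wsign_sq.
have Q2 : \prod_(j <- r) sg k j * \prod_(j <- r) sg k j = 1.
  have : wsign (k :: r) * wsign (k :: r) = 1 by apply: wsign_sq; rewrite /= kr.
  by rewrite wsign_cons mulrACA w2 mulr1.
set Q := \prod_(j <- r) sg k j in PQ Q2.
have s1 : sg k.+1 k = -1 by rewrite /sg (gtn_eqF (ltnSn k)) ltnSn.
have s2 : sg k k.+1 = 1 by rewrite sgC s1 opprK.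
have t1 : adj_swap k k = k.+1 by rewrite /adj_swap eqxx.
have t2 : adj_swap k k.+1 = k by rewrite /adj_swap (gtn_eqF (ltnSn k)) eqxx.
case: a; case: b; cbn [cat map nseq ncons iter nat_of_bool andb];
  rewrite ?mr ?t1 ?t2 ?wsign_cons ?big_cons ?PQ ?s1 ?s2 ?expr1 ?expr0 -/Q.
- by transitivity (- (Q * Q * (Q * Q) * (wsign r * wsign r))); [|rewrite Q2 w2]; ring.
- by transitivity (Q * Q * (wsign r * wsign r)); [|rewrite Q2 w2]; ring.
- by transitivity (Q * Q * (wsign r * wsign r)); [|rewrite Q2 w2]; ring.
- exact: w2.
Qed.

Definition word_coef (f : Lambda) (s : seq nat) : rat^o := f (wmono s).

(** Adjacent letters occupy neighbouring variables, so exchanging them is a transposition of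
    variables, under which f is invariant. *)
Lemma word_coef_supersym f : supersym (word_coef f).
Proof.
move=> s1 a b s2; set k := size s2; pose tau := adj_swap k.
have bt : bijective tau by exists tau; exact: adj_swapK.
have tI := bij_inj bt.
have e : mrename tau (wmono (s1 ++ b :: a :: s2)) = wmono (s1 ++ a :: b :: s2).
  rewrite !word_mono_cat /= !mrename_mono_mul // !mrename_letter // add0n.
  rewrite (@mrename_word_mono tau (size s2).+2 (size s2).+2) //; last first.
    by move=> i _; rewrite /tau /adj_swap -/k; do 2!(case: eqP; [lia|move=> _]).
  rewrite (@mrename_word_mono tau 0 0) //; last first.
    by move=> i il; rewrite /tau /adj_swap -/k; do 2!(case: eqP; [lia|move=> _]).
  rewrite -/k /tau /adj_swap eqxx (gtn_eqF (ltnSn k)) eqxx; congr mono_mul.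
  by rewrite mono_mulA [mono_mul (letter b _) _]mono_mulC -mono_mulA.
rewrite /word_coef -e lambda_rename //; congr (_ * _).
set I := (wmono _).2; pose r := ordered ((word_mono k.+2 s1).2 `|` (wmono s2).2).
have rn i : i \in r -> i != k /\ i != k.+1.
  rewrite mem_ordered inE => /orP[] /in_word_monoS; rewrite -/k; lia.
have kr : k \notin r by apply/negP => /rn[/eqP].
have kr1 : k.+1 \notin r by apply/negP => /rn[_ /eqP].
have := @wsign_adj_swap k (odd b) (odd a) r kr kr1 (ordered_uniq _) => /=.
set t := nseq _ _ ++ _; have pt : perm_eq (ordered I) t.
  apply: uniq_perm; first exact: ordered_uniq.
    have kk : (k.+1 == k) = false by rewrite (gtn_eqF (ltnSn k)).
    rewrite /t; case: (odd a); case: (odd b); rewrite /= ?inE ?kk ?(negPf kr) ?(negPf kr1);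
      exact: ordered_uniq.
  move=> i; rewrite mem_ordered /I word_mono_cat /t !mem_cat !mem_nseq mem_ordered !in_fsetU.
  rewrite !letterS /= add0n !lt0b -/k.
  rewrite ![odd _ && _]andbC; case: ((i == k.+1) && odd b); case: ((i == k) && odd a);
    by rewrite /= ?orbT.
have := perm_wsign_map tI pt; rewrite wsign_ordered mul1r -/tau => -> ->.
by rewrite andbC.
Qed.

Lemma wmono_surj l (m : smono) : (forall i, (i \in msupp m) = (i < l)%N) ->
  exists2 s, size s = l & m = wmono s.
Proof.
elim: l m => [|l IH] m hm.
  by exists [::] => //; apply: msupp0; apply/fsetP => i; rewrite hm inE.
pose m' : smono := ([fsfun i in [fset i in iota 0 l] => m.1 i], m.2 `\ l).
have m'1 i : m'.1 i = if (i < l)%N then m.1 i else 0%N.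
  by rewrite fsfunE in_fset mem_iota.
have m'2 i : (i \in m'.2) = (i != l) && (i \in m.2) by rewrite in_fsetD1.
have [i|s ss e] := IH m'.
  rewrite msuppE m'1 m'2; have := hm i; rewrite msuppE ltnS leq_eqVlt.
  by case: ltngtP => //= _ /norP[_ /negbTE].
(* This inverts the encoding of letters. In the even case the exponent is positive, since l belongs
   to the support. *)
pose z := if l \in m.2 then (m.1 l).*2.+1 else (m.1 l).-1.*2.
exists (z :: s); rewrite /= ?ss // add0n -e.
have oz : odd z = (l \in m.2) by rewrite /z; case: ifP; rewrite /= ?odd_double.
have ez : letter_exp z = m.1 l.
  rewrite /letter_exp oz /z; case: (boolP (l \in m.2)) => [_|nl] /=; first by rewrite uphalf_double.
  rewrite doubleK prednK // lt0n; have := hm l; by rewrite msuppE (negPf nl) orbF ltnSn.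
have out i : (l < i)%N -> m.1 i = 0%N /\ (i \in m.2) = false.
  move=> il; have := hm i; rewrite msuppE ltnS leqNgt il /= => /norP[].
  by rewrite negbK => /eqP -> /negbTE ->.
apply: smono_ext => i.
  rewrite expo_addE letterE m'1 ez; case: ltngtP => [//|/out[-> _]//|->]; by rewrite addn0.
rewrite inE letterS m'2 oz; case: eqP => [->|_] /=; by rewrite ?orbF.
Qed.

Lemma mono_word n : exists2 s, size s = #|` msupp n| &
  forall f : Lambda, f (wmono s) = 0 -> f n = 0.
Proof.
have [sigma bs es] := bij_iota (fset_uniq (msupp n)).
have sI := bij_inj bs.
have [i|s ss e] := @wmono_surj #|` msupp n| (mrename sigma n).
  transitivity (i \in map sigma (msupp n)); last by rewrite es mem_iota.
  have [tau st ts] := bs; rewrite -[i]ts (mem_map sI) !msuppE /= (erename_in sI).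
  by rewrite mem_imfset.
exists s => // f; rewrite -e lambda_rename // => /eqP; rewrite mulf_eq0.
by rewrite (negPf (_ : wsign _ != 0)) ?wsign_uniq ?map_inj_uniq ?ordered_uniq // => /eqP.
Qed.

Definition word_std s := sorted leq s && word_valid s.

Lemma sort_std s : word_valid s -> word_std (sort leq s).
Proof.
move=> vs; rewrite /word_std sort_sorted ?(word_valid_perm (_ : perm_eq _ s)) //.
  by rewrite perm_sort.
Qed.

Lemma perm_std s t : word_std s -> word_std t -> perm_eq s t -> s = t.
Proof.
by move=> /andP[ss _] /andP[st _]; apply: (sorted_eq leq_trans anti_leq).
Qed.

Lemma vanish_std (f : Lambda) l :
  (forall s, word_std s -> size s = l -> f (wmono s) = 0) ->
  forall n, #|` msupp n| = l -> f n = 0.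
Proof.
move=> H n nl; have [s ss] := mono_word n; apply.
have [vs|ns] := boolP (word_valid s); last exact: supersym_invalid (word_coef_supersym f) ns.
have [e he] := perm_sign (permEl (perm_sort leq s)).
rewrite -[LHS]/(word_coef f s) (he _ _ (word_coef_supersym f)) /word_coef H ?scaler0 ?sort_std //.
by rewrite size_sort ss.
Qed.

(** Bounded degree thus leaves finitely many words of a given length on which f can be nonzero. *)
Lemma wmono_letter_bound z s : z \in s -> (z <= (mdeg (wmono s)).*2.+1)%N.
Proof.
move=> zs; have [s1 [s2 ->]] : exists s1 s2, s = s1 ++ z :: s2.
  by case/splitPr: s / zs => s1 s2; exists s1, s2.
rewrite wmono_split; apply: leq_trans (_ : (letter_exp z).*2.+1 <= _)%N.
  rewrite -{1}[z]odd_double_half /letter_exp; case: (odd z); rewrite //= doubleS.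
  by rewrite add0n; lia.
rewrite ltnS leq_double; apply: leq_trans (mdeg_mono_mul _ _).
by rewrite /mdeg -/(edeg _) edeg_letter leq_addr.
Qed.

Lemma card_msupp_mdeg m : (#|` msupp m| <= mdeg m)%N.
Proof.
rewrite cardfsU; apply: leq_trans (leq_subr _ _) _.
rewrite leq_add2r -sum1_size big_seq [X in (_ <= X)%N]big_seq.
by apply: leq_sum => i; rewrite mem_finsupp lt0n.
Qed.

Definition wsum (V : lmodType rat) (F : seq nat -> V) (l : seq (rat * seq nat)) : V :=
  \sum_(p <- l) p.1 *: F p.2.

Definition wscale (k : rat) (l : seq (rat * seq nat)) := [seq (k * p.1, p.2) | p <- l].

Lemma wsum_cat (V : lmodType rat) (F : seq nat -> V) l l' :
  wsum F (l ++ l') = wsum F l + wsum F l'.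
Proof. by rewrite /wsum big_cat. Qed.

Lemma wsum_scale (V : lmodType rat) (F : seq nat -> V) k l :
  wsum F (wscale k l) = k *: wsum F l.
Proof.
by rewrite /wsum big_map scaler_sumr; apply: eq_bigr => p _; rewrite scalerA.
Qed.

Lemma word_pair_std s t : word_std s -> word_std t -> t != s -> word_pair t s = 0.
Proof.
move=> ss st; apply: contraNeq => /word_pair_perm p; apply/eqP; exact: perm_std.
Qed.

(** Induction on the number of variables. On the top layer the Gram matrix is diagonal over standard
    words, so dividing by its diagonal gives the combination [r0] that cancels f there; the
    difference involves fewer variables. *)
Lemma power_product_span_lt l (f : Lambda) : (forall n, f n != 0 -> (#|` msupp n| < l)%N) ->
  exists r, f = wsum power_product r.
Proof.
elim: l f => [|l IH] f hf.
  exists [::]; rewrite /wsum big_nil; apply: lambda_ext => n.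
  by apply/eqP/negPn/negP => /hf.
have [N hN] := lambda_bounded f; pose M := N.*2.+2.
pose U := [seq s <- [seq map val (tval t) | t : l.-tuple 'I_M] | word_std s].
have uU : uniq U.
  rewrite filter_uniq // map_inj_uniq ?enum_uniq // => s t.
  by move/(inj_map val_inj)/val_inj.
have U1 s : s \in U -> word_std s /\ size s = l.
  by rewrite mem_filter => /andP[ss /mapP[t _ es]]; split=> //; rewrite es size_map size_tuple.
have U2 s : word_std s -> size s = l -> s \notin U -> f (wmono s) = 0.
  move=> ss sl; apply: contraNeq => /hN fs; rewrite mem_filter ss /=.
  have b z : z \in s -> (z < M)%N.
    by move/wmono_letter_bound => h; rewrite ltnS (leq_trans h) // ltnS leq_double.
  have ts : size [seq inord z : 'I_M | z <- s] == l by rewrite size_map sl.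
  apply/mapP; exists (Tuple ts); first by rewrite mem_enum.
  rewrite /= -map_comp -[LHS]map_id; apply/eq_in_map => z /b zM /=.
  by rewrite inordK.
pose r0 := [seq (f (wmono s) / word_pair s s, s) | s <- U].
have [n|r er] := IH (-1 *: wsum power_product r0 + f); last first.
  exists (r0 ++ r); rewrite wsum_cat -er scaleN1r addrA subrr add0r //.
rewrite lval_lin; have -> : wsum power_product r0 n = \sum_(s <- U) f (wmono s) / word_pair s s * power_product s n.
  by rewrite /wsum big_map lambda_sumE.
(* Beyond l variables both f and the products vanish; at exactly l, [vanish_std] reduces to standard
   words. *)
apply: contraR; rewrite -leqNgt leq_eqVlt => /predU1P[en|lt]; last first.
  have -> : f n = 0 by apply/eqP; apply: contraLR lt => /hf; rewrite -leqNgt.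
  rewrite addr0 big1_seq ?mulr0 // => s /andP[_ /U1[_ ss]].
  suff -> : power_product s n = 0 by rewrite mulr0.
  by apply/eqP; apply: contraLR lt => /power_product_msupp; rewrite ss -leqNgt.
pose g := -1 *: wsum power_product r0 + f.
suff : g n = 0.
  by rewrite /g lval_lin /wsum big_map lambda_sumE => ->.
apply: (@vanish_std g l) => // s ss sl; rewrite /g lval_lin /wsum big_map lambda_sumE.
have e t : t \in U -> f (wmono t) / word_pair t t * power_product t (wmono s) =
    if t == s then f (wmono s) else 0.
  move=> /U1[st tl]; rewrite power_product_wmono ?tl ?sl //.
  case: eqP => [->|/eqP ts]; last by rewrite (word_pair_std ss st ts) mulr0.
  by rewrite divfK // word_pair_self //; case/andP: ss.
rewrite (eq_big_seq _ e) -big_mkcond.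
have [sU|nU] := boolP (s \in U).
  rewrite (eq_bigl (fun t => (t == s) && true)); last by move=> t; rewrite andbT.
  by rewrite big_uniq_pick // mulN1r addNr.
rewrite (U2 s) // addr0 big1_seq ?mulr0 // => t /andP[/eqP -> tU].
Qed.

Lemma power_product_span f : exists r, f = wsum power_product r.
Proof.
have [N hN] := lambda_bounded f; apply: (@power_product_span_lt N.+1) => n /hN h.
by rewrite ltnS (leq_trans (card_msupp_mdeg n)).
Qed.

(** Longest words first. At [wmono s], longer words are already known to have coefficient 0, and the
    other standard words contribute nothing because they are not permutations of s. *)
Lemma power_product_indep (U : seq (seq nat)) (c : seq nat -> rat) :
  uniq U -> {in U, forall s, word_std s} -> \sum_(s <- U) c s *: power_product s = 0 ->
  {in U, forall s, c s = 0}.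
Proof.
move=> uU sU e; pose M := (\max_(s <- U) size s)%N.
have hM s : s \in U -> (size s <= M)%N.
  by move=> su; rewrite /M (big_rem s) //= leq_max leqnn.
suff H k s : s \in U -> (M < size s + k)%N -> c s = 0.
  by move=> s su; apply: (H M.+1) => //; rewrite addnS ltnS leq_addl.
elim: k s => [|k IH] s su; first by rewrite addn0 ltnNge hM.
move=> lt; have /(congr1 (fun f : Lambda => f (wmono s))) := e.
rewrite lambda_sumE (bigD1_seq s) //= big1_seq => [|t /andP[ts tU]].
  rewrite addr0 => /eqP; rewrite mulf_eq0 power_product_wmono //.
  by rewrite (negPf (word_pair_self _)) ?orbF => [/eqP//|]; case/andP: (sU _ su).
have [st|ts'] := ltnP (size s) (size t).
  by rewrite IH ?scale0r //; lia.
by rewrite -[LHS]/(c t * power_product t (wmono s)) power_product_wmono // word_pair_std ?mulr0 ?sU.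
Qed.

(* U and c depend on r only, not on F: this is why a relation between products of
   power sums passes to every supersymmetric F. *)
Lemma wsum_normal (r : seq (rat * seq nat)) : exists (U : seq (seq nat)) (c : seq nat -> rat),
  [/\ uniq U, {in U, forall s, word_std s} &
      forall (V : lmodType rat) (F : seq nat -> V), supersym F ->
        wsum F r = \sum_(s <- U) c s *: F s].
Proof.
elim: r => [|[k t] r [U [c [uU sU hc]]]].
  by exists [::], (fun=> 0); split=> // V F _; rewrite /wsum !big_nil.
have [vt|nt] := boolP (word_valid t); last first.
  exists U, c; split=> // V F sF.
  by rewrite /wsum big_cons (supersym_invalid sF nt) scaler0 add0r; exact: hc.
pose s := sort leq t; have [e he] := perm_sign (permEl (perm_sort leq t)).
have ss : word_std s by exact: sort_std.
have E (V : lmodType rat) (F : seq nat -> V) : supersym F ->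
    wsum F ((k, t) :: r) = (k * (-1) ^+ e) *: F s + \sum_(s <- U) c s *: F s.
  by move=> sF; rewrite /wsum big_cons -[X in _ + X]/(wsum F r) hc // (he _ _ sF) scalerA.
have [sU'|nU] := boolP (s \in U).
  exists U, (fun x => (if x == s then k * (-1) ^+ e else 0) + c x); split=> // V F sF.
  rewrite E // [X in _ + X](bigD1_seq s) // [RHS](bigD1_seq s) //= eqxx scalerDl addrA.
  by congr (_ + _); apply: eq_bigr => x /negPf ->; rewrite add0r.
exists (s :: U), (fun x => if x == s then k * (-1) ^+ e else c x); split=> [|x|V F sF].
- by rewrite /= nU.
- by rewrite inE => /predU1P[->|/sU].
rewrite E // big_cons eqxx; congr (_ + _); apply: eq_big_seq => x xU.
by case: eqP => // xs; rewrite -xs xU in nU.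
Qed.

Lemma wsum_rel (V : lmodType rat) (F : seq nat -> V) r : supersym F ->
  wsum power_product r = 0 -> wsum F r = 0.
Proof.
move=> sF; have [U [c [uU sU hc]]] := wsum_normal r.
rewrite !hc //; last exact: power_product_supersym.
by move/(power_product_indep uU sU) => c0; apply: big1_seq => s /andP[_ /c0 ->]; rewrite scale0r.
Qed.

(** An expansion of f is chosen; by [wsum_rel] the value depends on f alone, which gives
    linearity. *)
Lemma word_lift (V : lmodType rat) (F : seq nat -> V) : supersym F ->
  exists2 L : Lambda -> V, linear L & forall t, L (power_product t) = F t.
Proof.
move=> sF; pose rep f := projT1 (cid (power_product_span f)).
have repE f : wsum power_product (rep f) = f by rewrite /rep; case: cid.
have eqF r r' : wsum power_product r = wsum power_product r' -> wsum F r = wsum F r'.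
  move=> e; apply/eqP; rewrite -subr_eq0 -scaleN1r -wsum_scale -wsum_cat; apply/eqP.
  by apply: wsum_rel => //; rewrite wsum_cat wsum_scale e scaleN1r subrr.
exists (fun f => wsum F (rep f)) => [k f g|t].
  by rewrite -wsum_scale -wsum_cat; apply: eqF; rewrite wsum_cat wsum_scale !repE.
have -> : F t = wsum F [:: (1, t)] by rewrite /wsum big_seq1 scale1r.
by apply: eqF; rewrite repE /wsum big_seq1 scale1r.
Qed.

Lemma word_ext (V : lmodType rat) (L M : Lambda -> V) : linear L -> linear M ->
  (forall t, L (power_product t) = M (power_product t)) -> L =1 M.
Proof.
move=> lL lM e f; have [r ->] := power_product_span f.
by rewrite /wsum !(lin_sum _ _ _ lL, lin_sum _ _ _ lM); apply: eq_bigr => p _; rewrite e.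
Qed.

Lemma word_ext2 (V : lmodType rat) (L M : Lambda ⨂ Lambda -> V) : linear L -> linear M ->
  (forall s t, L (power_product s ⊗ power_product t) = M (power_product s ⊗ power_product t)) -> L =1 M.
Proof.
move=> lL lM e; apply: tensor_ext_lin => // f g; move: f.
apply: word_ext => [||s]; try exact: linear_comp (tens_linl g).
move: g; apply: word_ext => [||t]; try exact: linear_comp (tens_linr _).
exact: e.
Qed.

(** * Antipode and pairing *)

Lemma counit_power_product t : counit (power_product t) = (t == [::])%:R.
Proof.
case: t => [|z t]; first by rewrite -[RHS](counit_constant 1) scale1r.
rewrite -[power_product _]/(power_sum z *L power_product t) counit_mul.
suff -> : counit (power_sum z) = 0 by rewrite mul0r.
apply: gen_series_out => j /(congr1 msupp).
by rewrite msupp1 msupp_letter => /fsetP/(_ j); rewrite !inE eqxx.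
Qed.

Lemma tmul_power_sum z a b : tmulL (coproduct (power_sum z)) (power_product a ⊗ power_product b) =
  power_product (z :: a) ⊗ power_product b + (-1) ^+ (odd z && word_parity a) *: (power_product a ⊗ power_product (z :: b)).
Proof.
rewrite coproduct_power_sum (lin_add (tmul_linl _)).
rewrite (tmul_tens Lambda_par_linear _ _ Lambda_mul_bilin parity_one (power_product_parity a)).
rewrite (tmul_tens Lambda_par_linear _ _ Lambda_mul_bilin (power_sum_parity z) (power_product_parity a)).
by rewrite scale1r !Lambda_mul1l.
Qed.

(** The coproduct of a nonempty product is the coproduct of its first power sum times some tensor.
    The last hypothesis kills every such multiple, so no induction on the word takes place. *)
Lemma coproduct_ind (V : lmodType rat) (L : Lambda ⨂ Lambda -> V) (e : Lambda -> V) :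
  linear L -> linear e -> L (Lambda_one ⊗ Lambda_one) = e Lambda_one ->
  (forall z t, e (power_product (z :: t)) = 0) ->
  (forall z a b, L (tmulL (coproduct (power_sum z)) (power_product a ⊗ power_product b)) = 0) ->
  forall f, L (coproduct f) = e f.
Proof.
move=> lL le h1 e0 h; apply: word_ext => //; first exact: linear_comp lL coproduct_linear.
case=> [|z t]; first by rewrite /= coproduct_one.
rewrite e0 [power_product _]/= coproduct_mul.
have l2 : linear (fun u => L (tmulL (coproduct (power_sum z)) u)).
  exact: linear_comp lL (tmul_linr _).
apply: (word_ext2 (M := fun=> 0) l2 _ (h z)) => k u v; by rewrite scaler0 addr0.
Qed.

(** An antipode reverses products up to sign, and supercommutativity undoes the reversal, so only
    the -1 of each primitive factor remains. *)
Lemma antipode_exists : exists2 S : Lambda -> Lambda, linear S &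
  forall t, S (power_product t) = (-1) ^+ size t *: power_product t.
Proof.
apply: word_lift => s1 a b s2; rewrite power_product_supersym !scalerA mulrC.
by rewrite !size_cat.
Qed.

Section Antipode.
Variable S : Lambda -> Lambda.
Hypotheses (lS : linear S) (SE : forall t, S (power_product t) = (-1) ^+ size t *: power_product t).

Lemma antipode_cons z t : S (power_product (z :: t)) = - (power_sum z *L S (power_product t)).
Proof.
by rewrite !SE /= (lin_scale _ _ (Lambda_mul_bilin.2 _)) exprS mulN1r scaleNr.
Qed.

Lemma antipode_parity t : par (word_parity t) (S (power_product t)).
Proof.
move=> i; rewrite SE (lin_scale _ _ (Lambda_par_linear i)) (power_product_parity t).
by case: ifP => // _; rewrite scaler0.
Qed.

Lemma counit_one_linear : linear (fun f => counit f *: Lambda_one).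
Proof. by move=> k f g; rewrite counit_linear scalerDl scalerA. Qed.

Lemma tmap_bilin (g h : Lambda -> Lambda) : linear g -> linear h ->
  bilin (fun a b => g a ⊗ h b).
Proof. exact: bilin_comp (@tens_bilin _ _ _). Qed.

Lemma mul_tmap_linear (g h : Lambda -> Lambda) : linear g -> linear h ->
  linear (fun u => tlift Lambda_mul (tmap g h u)).
Proof.
move=> lg lh; apply: linear_comp (tlift_linear Lambda_mul_bilin) _.
exact: tlift_linear (tmap_bilin lg lh).
Qed.

Lemma mul_tmap_tens (g h : Lambda -> Lambda) a b : linear g -> linear h ->
  tlift Lambda_mul (tmap g h (a ⊗ b)) = g a *L h b.
Proof.
move=> lg lh; rewrite /tmap tlift_tens; last exact: tmap_bilin.
by rewrite tlift_tens //; exact: Lambda_mul_bilin.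
Qed.

Lemma antipode_one : S Lambda_one = Lambda_one.
Proof. by have := SE [::]; rewrite /= scale1r. Qed.

(** The two terms of the coproduct of a power sum contribute opposite values once that power sum is
    moved to the front, which is possible as [S] preserves parity. *)
Lemma Lambda_antipode : antipode Lambda_mul Lambda_one coproduct counit S.
Proof.
have lid := @id_linear _ Lambda.
have e0 z t : counit (power_product (z :: t)) *: Lambda_one = 0.
  by rewrite counit_power_product scale0r.
have e1 : counit Lambda_one *: Lambda_one = Lambda_one.
  by rewrite (counit_power_product [::]) scale1r.
have lN (f : Lambda) : linear (fun g => f *L g) := Lambda_mul_bilin.2 f.
have lM (g : Lambda) : linear (fun f => f *L g) := Lambda_mul_bilin.1 g.
split=> // f.
- apply: (coproduct_ind (mul_tmap_linear lS lid) counit_one_linear) => // [|z a b].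
    by rewrite mul_tmap_tens // antipode_one e1 Lambda_mul1l.
  rewrite tmul_power_sum (lin_add (mul_tmap_linear lS lid)) (lin_scale _ _ (mul_tmap_linear lS lid)).
  rewrite !mul_tmap_tens // antipode_cons [power_product (z :: b)]/= Lambda_mulA.
  rewrite (Lambda_mulC (antipode_parity a) (power_sum_parity z)) (lin_scale _ _ (lM _)) scalerA.
  by rewrite andbC -signr_addb addbb scale1r -[- (_ *L _)]scaleN1r
    (lin_scale _ _ (lM _)) scaleN1r addNr.
- apply: (coproduct_ind (mul_tmap_linear lid lS) counit_one_linear) => // [|z a b].
    by rewrite mul_tmap_tens // antipode_one e1 Lambda_mul1l.
  rewrite tmul_power_sum (lin_add (mul_tmap_linear lid lS)) (lin_scale _ _ (mul_tmap_linear lid lS)).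
  rewrite !mul_tmap_tens // antipode_cons [power_product (z :: a)]/=.
  rewrite -[- (_ *L _)]scaleN1r (lin_scale _ _ (lN _)) Lambda_mulA.
  rewrite (Lambda_mulC (power_product_parity a) (power_sum_parity z)) (lin_scale _ _ (lM _)) !scalerA.
  by rewrite mulrN1 mulNr andbC -signr_addb addbb scaleN1r subrr.
Qed.

End Antipode.

(** Two successive lifts: in the second argument for each fixed word s, then in s with values in the
    space of all functions on [Lambda]. The second lift does not record linearity of these values,
    so it is checked again on products of power sums. *)
Lemma pairing_exists : exists2 pair : Lambda -> Lambda -> rat^o, bilin pair &
  forall s t, pair (power_product s) (power_product t) = word_pair t s.
Proof.
have /choice[P hP] s : exists L : Lambda -> rat^o,
    linear L /\ forall t, L (power_product t) = word_pair t s.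
  by have [L lL LE] := word_lift (word_pair_supersyml s); exists L.
have [|pair lp pE] := @word_lift (Lambda -> rat^o) P.
  move=> s1 a b s2; apply/funext.
  have [l1 e1] := hP (s1 ++ a :: b :: s2); have [l2 e2] := hP (s1 ++ b :: a :: s2).
  set k := (-1) ^+ _.
  apply: (@word_ext rat^o _ (fun f => k *: P (s1 ++ b :: a :: s2) f)) => // [c u v|t].
    by rewrite l2 scalerDr !scalerA mulrC.
  by rewrite e1 e2; exact: word_pair_supersymr.
exists pair => [|s t]; last by rewrite pE; have [_] := hP s; exact.
split=> [a k f g|f k a b]; first by rewrite lp.
apply: (@word_ext rat^o (fun f => pair f (k *: a + b)) (fun f => k *: pair f a + pair f b)).
- by move=> c u v; rewrite lp.
- move=> c u v; rewrite !lp.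
  rewrite -[RHS]/(c * (k * pair u a + pair u b) + (k * pair v a + pair v b)).
  by rewrite -[LHS]/(k * (c * pair u a + pair v a) + (c * pair u b + pair v b)); ring.
- by move=> t; rewrite pE; have [l _] := hP t; rewrite l.
Qed.

Section Pairing.
Variable pair : Lambda -> Lambda -> rat^o.
Hypotheses (pb : bilin pair) (pE : forall s t, pair (power_product s) (power_product t) = word_pair t s).

Lemma scalar_mul_bilin : bilin (fun x y : rat^o => x * y : rat^o).
Proof.
split=> [y k x x'|x k y y'] /=; first by rewrite mulrDl -mulrA.
by rewrite mulrDr mulrCA.
Qed.

Lemma tpair_linl t : linear (fun s => tpairL pair s t : rat^o).
Proof.
apply: tlift_linear; apply: tlift_bilin => a d; apply: bisum_bilin => i j.
apply: (bilin_comp scalar_mul_bilin) => k u v; first exact: pb.1.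
by rewrite Lambda_par_linear; exact: pb.1.
Qed.

Lemma tpair_linr s : linear (fun t => tpairL pair s t : rat^o).
Proof.
apply: (tlift_lin2 (F := fun f1 g1 t => tlift _ t)) => u v.
apply: tlift_linear; apply: bisum_bilin => i j.
apply: (bilin_comp scalar_mul_bilin) => k x y; last exact: pb.2.
by rewrite Lambda_par_linear; exact: pb.2.
Qed.

Lemma tpair_words s1 s2 t1 t2 : tpairL pair (power_product s1 ⊗ power_product s2) (power_product t1 ⊗ power_product t2) =
  (-1) ^+ (word_parity s2 && word_parity t1) * (word_pair t1 s1 * word_pair t2 s2).
Proof.
by rewrite (tpair_tens Lambda_par_linear _ _ pb (power_product_parity s2) (power_product_parity t1)) !pE.
Qed.

(** The right side has the shape of [letter_der_cat]: a letter deleted from s1 leaves to the right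
    and crosses s2, whence the sign. *)
Lemma tpair_power_sum z s1 s2 u : tpairL pair (power_product s1 ⊗ power_product s2) (tmulL (coproduct (power_sum z)) u) =
  (-1) ^+ (odd z && word_parity s2) * letter_der z (fun s => tpairL pair (power_product s ⊗ power_product s2) u) s1 +
  letter_der z (fun s => tpairL pair (power_product s1 ⊗ power_product s) u) s2.
Proof.
move: u; apply: (@word_ext2 rat^o (fun u => tpairL pair _ (tmulL _ u))
   (fun u => (-1) ^+ (odd z && word_parity s2) * letter_der z (fun s => tpairL pair (power_product s ⊗ power_product s2) u) s1 +
  letter_der z (fun s => tpairL pair (power_product s1 ⊗ power_product s) u) s2)).
- exact: linear_comp (tpair_linr _) (tmul_linr _).
- move=> k u v.
  have D (T : seq nat -> Lambda ⨂ Lambda) s :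
      letter_der z (fun s => tpairL pair (T s) (k *: u + v)) s =
      k * letter_der z (fun s => tpairL pair (T s) u) s + letter_der z (fun s => tpairL pair (T s) v) s.
    by rewrite -letter_der_lin; apply: letter_der_ext => s'; exact: tpair_linr.
  rewrite (D (fun s => power_product s ⊗ power_product s2)) (D (fun s => power_product s1 ⊗ power_product s)).
  by rewrite -[X in _ = X + _]/(k * _); ring.
move=> a b; rewrite tmul_power_sum (lin_add (tpair_linr _)) (lin_scale _ _ (tpair_linr _)) !tpair_words.
congr (_ + _).
  rewrite (@letter_der_ext (fun s => (-1) ^+ (word_parity s2 && word_parity a) * word_pair b s2 * word_pair a s)); last first.
    by move=> s; rewrite tpair_words; ring.
  rewrite letter_der_scale word_parity_cons -/(word_pair (z :: a) s1) andb_addr signr_addb andbC; ring.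
rewrite (@letter_der_ext (fun s => word_pair a s1 * ((-1) ^+ (word_parity a && word_parity s) * word_pair b s))); last first.
  by move=> s; rewrite tpair_words andbC; ring.
rewrite letter_der_scale letter_der_twist -/(word_pair (z :: b) s2) andb_addr signr_addb -[LHS]/(_ * _).
rewrite [word_parity a && odd z]andbC [word_parity a && _]andbC; ring.
Qed.

(** Both sides obey one recursion in t, given by [letter_der_cat] on the left and by
    [tpair_power_sum] on the right. *)
Lemma pair_mull_words s1 s2 t : pair (power_product s1 *L power_product s2) (power_product t) =
  tpairL pair (power_product s1 ⊗ power_product s2) (coproduct (power_product t)).
Proof.
rewrite -power_product_cat pE; elim: t s1 s2 => [|z t IH] s1 s2.
  rewrite /= coproduct_one (tpair_words s1 s2 [::] [::]) andbF mul1r /=.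
  by case: s1 => [|? ?]; case: s2 => [|? ?]; rewrite ?mul1r ?mul0r.
rewrite [power_product _]/= coproduct_mul tpair_power_sum /= letter_der_cat.
by congr (_ * _ + _); apply: letter_der_ext => s; rewrite IH.
Qed.

Lemma pair_mull_all f g a : pair (f *L g) a = tpairL pair (f ⊗ g) (coproduct a).
Proof.
move: f; apply: (@word_ext rat^o (fun f => pair (f *L g) a) (fun f => tpairL pair (f ⊗ g) (coproduct a))).
- exact: linear_comp (pb.1 a) (Lambda_mul_bilin.1 g).
- exact: linear_comp (tpair_linl _) (tens_linl g).
move=> s; move: g; apply: (@word_ext rat^o (fun g => pair (_ *L g) a) (fun g => tpairL pair (_ ⊗ g) (coproduct a))).
- exact: linear_comp (pb.1 a) (Lambda_mul_bilin.2 _).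
- exact: linear_comp (tpair_linl _) (tens_linr _).
move=> t; move: a; apply: (@word_ext rat^o (pair _) (fun a => tpairL pair _ (coproduct a))).
- exact: pb.2.
- exact: linear_comp (tpair_linr _) coproduct_linear.
exact: pair_mull_words.
Qed.

Lemma pairC f a : pair f a = pair a f.
Proof.
move: f; apply: (@word_ext rat^o (fun f => pair f a) (pair a)); [exact: pb.1|exact: pb.2|].
move=> s; move: a; apply: (@word_ext rat^o (pair _) (fun a => pair a _)).
- exact: pb.2.
- exact: pb.1.
by move=> t; rewrite !pE word_pairC.
Qed.

(** The sign looks asymmetric, but nonzero Gram entries force the paired words to have equal
    parities. *)
Lemma tpairC u v : tpairL pair u v = tpairL pair v u.
Proof.
move: u; apply: (@word_ext2 rat^o (fun u => tpairL pair u v) (tpairL pair v)).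
- exact: tpair_linl.
- exact: tpair_linr.
move=> s1 s2; move: v; apply: (@word_ext2 rat^o (tpairL pair _) (fun v => tpairL pair v _)).
- exact: tpair_linr.
- exact: tpair_linl.
move=> t1 t2; rewrite !tpair_words (word_pairC s1) (word_pairC s2).
have wp s t : word_pair s t != 0 -> word_parity s = word_parity t.
  by move/word_pair_perm/permP => e; rewrite /word_parity e.
have [->|/wp e1] := eqVneq (word_pair t1 s1) 0; first by rewrite !mul0r !mulr0.
have [->|/wp e2] := eqVneq (word_pair t2 s2) 0; first by rewrite !mulr0.
by rewrite e1 e2 andbC.
Qed.

Lemma pair_separated f : (forall a, pair f a = 0) -> f = 0.
Proof.
move=> H; have [r fr] := power_product_span f; have [U [c [uU sU hc]]] := wsum_normal r.
rewrite (hc _ _ power_product_supersym) in fr.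
rewrite fr big1_seq // => s /andP[_ su]; suff -> : c s = 0 by rewrite scale0r.
have := H (power_product s); rewrite fr (lin_sum _ _ _ (pb.1 (power_product s))).
rewrite (bigD1_seq s) //= big1_seq => [|t /andP[ts tU]].
  rewrite addr0 pE => /eqP; rewrite mulf_eq0.
  by rewrite (negPf (word_pair_self _)) ?orbF => [/eqP//|]; case/andP: (sU _ su).
by rewrite pE word_pairC word_pair_std ?scaler0 ?sU.
Qed.

Lemma pair_one a : pair Lambda_one a = counit a.
Proof.
move: a; apply: (@word_ext rat^o (pair _) counit); [exact: pb.2|exact: counit_linear|].
by move=> t; rewrite (pE [::]) counit_power_product; case: t.
Qed.

Lemma Lambda_self_dual_pairing S : linear S ->
  (forall t, S (power_product t) = (-1) ^+ size t *: power_product t) ->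
  self_dual_pairing Lambda_par Lambda_mul Lambda_one coproduct counit S pair.
Proof.
move=> lS SE; split.
- exact: pb.
- split; first exact: pair_separated.
  by move=> a H; apply: pair_separated => f; rewrite pairC.
- exact: pair_mull_all.
(* By symmetry this is the law for products in the first argument. *)
- by move=> f a b; rewrite pairC pair_mull_all tpairC.
- exact: pair_one.
- by move=> f; rewrite pairC pair_one.
move=> f a; move: f; apply: (@word_ext rat^o (fun f => pair (S f) a) (fun f => pair f (S a))).
- exact: linear_comp (pb.1 a) lS.
- exact: pb.1.
move=> s; move: a; apply: (@word_ext rat^o (pair _) (fun a => pair _ (S a))).
- exact: pb.2.
- exact: linear_comp (pb.2 _) lS.
move=> t; rewrite !SE (lin_scale _ _ (pb.1 _)) (lin_scale _ _ (pb.2 _)) pE.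
(* Words of different lengths are orthogonal, so the two signs agree wherever they matter. *)
have [->|/word_pair_perm/perm_size ->] := eqVneq (word_pair t s) 0; by rewrite ?scaler0.
Qed.

End Pairing.

Theorem proposition4p8 :
  exists S : Lambda -> Lambda,
    [/\ super_hopf Lambda_par Lambda_mul Lambda_one coproduct counit S,
        super_cocommutative Lambda_par coproduct &
        self_dual Lambda_par Lambda_mul Lambda_one coproduct counit S].
Proof.
have [S lS SE] := antipode_exists; have [pair pb pE] := pairing_exists.
exists S; split; first by split; [exact: Lambda_super_bialgebra|exact: Lambda_antipode].
  exact: coproduct_cocommutative.
by exists pair; exact: Lambda_self_dual_pairing.
Qed.
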